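(* Let $k$ be an algebraically closed field, $Q$ a finite quiver with at least one arrow, $I\subset kQ$ an admissible ideal, $B=kQ/I$ and $n=\dim_k B$. Put $T_2Q=kQ/J(Q)^2$. Then: (a) $\operatorname{AlgGr}_{n-1}(B)$ depends only on the Ext-quiver $Q$ of $B$: as a projective variety it is isomorphic to $\operatorname{AlgGr}_{\dim_k T_2Q-1}(T_2Q)$ via $A\mapsto A/J(B)^2$, where $B/J(B)^2$ is identified with $T_2Q$. (b) Write $Q_0=\{v_0<\dots<v_{n_0}\}$, $Q_1=\{\alpha_1<\dots<\alpha_{n_1}\}$, let $V=\operatorname{span}_k\big((Q_0\setminus\{v_0\})\cup Q_1\big)$ and $R=k[v_1,\dots,v_{n_0},\alpha_1,\dots,\alpha_{n_1}]$, the homogeneous coordinate ring of $\operatorname{Gr}_{n_0+n_1-1}(V)\cong\mathbb P^{N}$, $N=|Q_0|+|Q_1|-2$. There is a closed embedding $\operatorname{AlgGr}_{n-1}(B)\hookrightarrow \operatorname{Gr}_{n_0+n_1-1}(V)\cong \mathbb P^N$ under which the irreducible components of $\operatorname{AlgGr}_{n-1}(B)$ become linear subspaces, and such that the homogeneous vanishing ideal of the image is $X=X_0+X_{1/2}+X_1\subset R$ (in particular the image is the vanishing set of $X$), where (i) $X_0$ is the ideal generated by $\{v_i^2v_j-(-1)^{j-i-1}v_iv_j^2 \mid 1\le i<j\le n_0\}\cup\{v_iv_jv_l\mid 1\le i<j<l\le n_0\}$; (ii) $X_{1/2}$ is the ideal generated by the sets $\{\alpha_iv_j\mid 1\le i\le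 n_1,\ 1\le j\le n_0,\ v_j\notin\{s(\alpha_i),t(\alpha_i)\}\}$, $\{(v_l-(-1)^{l-j-1}v_j)\alpha_i\mid 1\le j<l\le n_0,\ \alpha_i\in v_jQ_1v_l\}$, and $\{v_j\alpha_i\mid 1\le j\le n_0,\ 1\le i\le n_1,\ s(\alpha_i)=v_j=t(\alpha_i)\}$; (iii) $X_1$ is the ideal generated by $\{\alpha_i\alpha_j\mid \alpha_i \text{ is not parallel to } \alpha_j\}$. (c) Identifying $\operatorname{AlgGr}_{n-1}(B)$ with $\operatorname{AlgGr}_{\dim_kT_2Q-1}(T_2Q)$ as in (a), its irreducible components are exactly the following sets of subalgebras of $T_2Q$: (1) $\{A(s+t)\}$, for each two-element subset $\{s,t\}\subset Q_0$ with $sQ_1t\cup tQ_1s=\emptyset$; (2) $\Big(\bigcup_{U\in\mathbb P((skQ_1t)^* )}\operatorname{Inn}^*(T_2Q)\cdot A(s,t,U)\Big)\cup\{A(s+t)\}$, for each pair $(s,t)\in V^2(Q)$ with $s\ne t$; (3) $\bigcup_{U\in\mathbb P((skQ_1s)^* )}\operatorname{Inn}^*(T_2Q)\cdot A(s,s,U)$, for each $(s,s)\in V^2(Q)$.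
   Context: Algebras are unital, associative, finite-dimensional over $k$; subalgebras contain the unit. Varieties are allowed to be reducible. For a finite-dimensional algebra $B$, $\operatorname{AlgGr}_m(B)$ is the set of $m$-dimensional subalgebras of $B$, regarded as a closed subvariety of the Grassmannian $\operatorname{Gr}_m(B)$ of $m$-dimensional subspaces. $J(B)$ is the Jacobson radical. A quiver $Q$ has vertex set $Q_0$, arrow set $Q_1$, source and target maps $s,t$. $kQ$ is the path algebra, $J(Q)$ the two-sided ideal generated by $Q_1$; an ideal $I$ is admissible if $J(Q)^2\supset I\supset J(Q)^\ell$ for some $\ell\ge2$. $uQ_1v$ is the set of arrows with source $u$ and target $v$; $ukQ_1v$ is its $k$-span; $V^2(Q)=\{(u,v)\in Q_0\times Q_0\mid uQ_1v\ne\emptyset\}$. Two arrows are parallel if they have the same source and the same target. The total order on $Q_1$ is chosen such that each nonempty $uQ_1v$ is an interval; $Q_0\cup Q_1$ is totally ordered by extending the orders on $Q_0$ and $Q_1$ with $v<\alpha$ for $v\in Q_0,\alpha\in Q_1$. Coordinates on $\operatorname{Gr}_{n_0+n_1-1}(V)$: for a hyperplane $A\subset V$, a frame $F$ of $A$ is an $(n_0+n_1)\times(n_0+n_1-1)$ matrix whose columns form an ordered basis of $A$ (rows indexed by the ordered set $(Q_0\setminus\{v_0\})\cup Q_1$), and the coordinate $x\in (Q_0\setminus\{v_0\})\cup Q_1$ takes at $A$ the value $x(F)$, the minor of $F$ obtained by deleting row $x$ (well defined up to a common scalar). For $C=T_2Q$: for a two-element subset $\{u,v\}\subset Q_0$,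 $A(u+v)=k(u+v)\oplus\bigoplus_{w\in Q_0\setminus\{u,v\}}kw\oplus J(C)$. For $(u,v)\in V^2(Q)$ and a codimension-1 subspace $U\le ukQ_1v$, $A(u,v,U)=kQ_0\oplus U\oplus\bigoplus_{(w,y)\in Q_0^2\setminus\{(u,v)\}}wkQ_1y\oplus J(C)^2$ (with $J(C)^2=0$ here). $\mathbb P((ukQ_1v)^* )$ is identified with the set of codimension-1 subspaces of $ukQ_1v$. $\operatorname{Inn}^*(C)=\{\iota_{1+x}\mid x\in J(C)\}$ with $\iota_u(y)=uyu^{-1}$, and $\operatorname{Inn}^*(C)\cdot A$ denotes the orbit of $A$.
   Formalization: In (b)(ii), the generators (v_l-(-1)^{l-j-1}v_j)α_i, j<l, are taken for α_i in v_jQ_1v_l or v_lQ_1v_j, not only v_jQ_1v_l; as printed (b) fails, e.g. for v_0<v_1<v_2 with a single arrow v_2→v_1. *)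

(* Defs.v *)
From HB Require Import structures.
From mathcomp Require Import all_boot all_order all_algebra all_field.
From mathcomp Require Import finmap boolp classical_sets.
(* The notations of monalg clash with those of mpoly. *)
From mathcomp Require Import -(notations) monalg.
From mathcomp Require Import mpoly.

Set Implicit Arguments.
Unset Strict Implicit.
Unset Printing Implicit Defensive.

Import GRing.Theory.
Local Open Scope ring_scope.
Local Open Scope classical_set_scope.

(** * Quivers and path algebras *)

(* A finite quiver.  The field [vertex_gt0] makes the path algebra a nonzero
   ring; it holds as soon as there is an arrow. *)
Record quiver := Quiver {
  vertex : finType;
  arrow : finType;
  src : arrow -> vertex;
  tgt : arrow -> vertex;
  vertex_gt0 : (0 < #|vertex|)%N }.

Definition arrow_from_to (Q : quiver) (u v : vertex Q) : pred (arrow Q) :=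
  fun a => (src a == u) && (tgt a == v).

Definition parallel (Q : quiver) (a b : arrow Q) : bool :=
  (src a == src b) && (tgt a == tgt b).

Fixpoint walk (Q : quiver) (u : vertex Q) (w : seq (arrow Q)) : bool :=
  if w is a :: w' then (src a == u) && walk (tgt a) w' else true.

(* A path is a start vertex followed by composable arrows, read from left to
   right; the empty sequence gives the trivial path. *)
Record qpath (Q : quiver) := QPath {
  qpath_val : vertex Q * seq (arrow Q);
  qpath_valP : walk qpath_val.1 qpath_val.2 }.

HB.instance Definition _ (Q : quiver) := [isSub for @qpath_val Q].
HB.instance Definition _ (Q : quiver) := [Choice of qpath Q by <:].

Section Paths.
Variable Q : quiver.
Implicit Types (p q r : qpath Q) (u : vertex Q).

Definition walk_end u (w : seq (arrow Q)) : vertex Q :=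
  last u [seq tgt a | a <- w].

Definition qsource p := (qpath_val p).1.
Definition qtarget p := walk_end (qpath_val p).1 (qpath_val p).2.

Lemma walk_cat u w w' : walk u (w ++ w') = walk u w && walk (walk_end u w) w'.
Proof. by elim: w u => //= a w IH u; rewrite IH andbA. Qed.

Definition vertex_path u : qpath Q := @QPath Q (u, [::]) isT.

Lemma arrow_path_subproof (a : arrow Q) : walk (src a) [:: a].
Proof. by rewrite /= eqxx. Qed.
Definition arrow_path a : qpath Q :=
  @QPath Q (src a, [:: a]) (arrow_path_subproof a).

Definition qcomp p q : option (qpath Q) :=
  if qtarget p == qsource q
  then insub (qsource p, (qpath_val p).2 ++ (qpath_val q).2) else None.

Lemma qcompP p q : qtarget p = qsource q ->
  exists2 r, qcomp p q = Some r &
    qpath_val r = (qsource p, (qpath_val p).2 ++ (qpath_val q).2).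
Proof.
move=> e; rewrite /qcomp e eqxx; case: insubP => [r _ <-|]; first by exists r.
move=> /negP[] /=; rewrite walk_cat (qpath_valP p) /=.
by move: e; rewrite /qtarget => ->; apply: (qpath_valP q).
Qed.

Lemma qcomp_None p q : qtarget p != qsource q -> qcomp p q = None.
Proof. by rewrite /qcomp => /negPf->. Qed.

Lemma qtarget_comp p q r : qtarget p = qsource q ->
  qpath_val r = (qsource p, (qpath_val p).2 ++ (qpath_val q).2) ->
  qtarget r = qtarget q.
Proof.
rewrite /qtarget /walk_end => + ->; rewrite /= map_cat last_cat.
by rewrite /qsource => ->.
Qed.

Lemma qcompA p q r :
  obind (qcomp p) (qcomp q r) = obind (qcomp^~ r) (qcomp p q).
Proof.
have [pq|npq] := eqVneq (qtarget p) (qsource q); last first.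
  rewrite (qcomp_None npq) /=.
  have [qr|nqr] := eqVneq (qtarget q) (qsource r); last by rewrite qcomp_None.
  have [s -> sE] := qcompP qr; rewrite /= qcomp_None //.
  by rewrite /qsource sE.
have [t tS tE] := qcompP pq; rewrite tS /=.
have tq := qtarget_comp pq tE.
have [qr|nqr] := eqVneq (qtarget q) (qsource r); last first.
  by rewrite !qcomp_None // tq.
have [s sS sE] := qcompP qr; rewrite sS /=.
have ps : qtarget p = qsource s by rewrite pq /qsource sE.
have tr : qtarget t = qsource r by rewrite tq.
have [x -> xE] := qcompP ps; have [y -> yE] := qcompP tr.
by congr Some; apply: val_inj; rewrite /= xE yE sE /qsource tE /= catA.
Qed.

Lemma qcomp1p u p :
  qcomp (vertex_path u) p = if u == qsource p then Some p else None.
Proof.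
case: eqP => [e|/eqP ne]; last exact: qcomp_None.
have [r -> rE] := @qcompP (vertex_path u) p e.
by congr Some; apply: val_inj; rewrite /= rE /qsource /= e /qsource; case: (qpath_val p).
Qed.

Lemma qcompp1 p u :
  qcomp p (vertex_path u) = if u == qtarget p then Some p else None.
Proof.
rewrite eq_sym; case: eqP => [e|/eqP ne]; last exact: qcomp_None.
have [r -> rE] := @qcompP p (vertex_path u) e.
by congr Some; apply: val_inj; rewrite /= rE /qsource /= cats0; case: (qpath_val p).
Qed.

End Paths.

(* The path algebra kQ: the free module on the paths, with the bilinear product
   that concatenates composable paths and sends the other pairs to 0. *)
Definition path_algebra (k : fieldType) (Q : quiver) := malg (qpath Q) k.

HB.instance Definition _ (k : fieldType) (Q : quiver) :=
  GRing.Lmodule.copy (path_algebra k Q) (malg (qpath Q) k).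

Section PathAlgebra.
Variables (k : fieldType) (Q : quiver).
Local Notation kQ := (path_algebra k Q).

Definition path_elt (p : qpath Q) : kQ := mkmalgU p 1.
Definition opath_elt (o : option (qpath Q)) : kQ := oapp path_elt 0 o.

Definition path_mul (f g : kQ) : kQ :=
  \sum_(p <- monalg.msupp f) \sum_(q <- monalg.msupp g)
    (monalg.mcoeff p f * monalg.mcoeff q g) *: opath_elt (qcomp p q).

Definition path_one : kQ := \sum_(u : vertex Q) path_elt (vertex_path u).

Definition path_lift (M : lmodType k) (h : qpath Q -> M) (f : kQ) : M :=
  \sum_(p <- monalg.msupp f) monalg.mcoeff p f *: h p.

Section Lift.
Variables (M : lmodType k).
Implicit Types (h : qpath Q -> M).

Lemma path_liftEw h (f : kQ) (d : {fset qpath Q}) : (monalg.msupp f `<=` d)%fset ->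
  path_lift h f = \sum_(p <- d) monalg.mcoeff p f *: h p.
Proof.
move=> le; rewrite /path_lift (big_fset_incl _ le) // => p _ /monalg.mcoeff_outdom->.
by rewrite scale0r.
Qed.

Lemma path_lift_is_linear h : linear (path_lift h).
Proof.
move=> c f g.
pose d := (monalg.msupp f `|` monalg.msupp g)%fset.
have lf : (monalg.msupp f `<=` d)%fset by apply: fsubsetUl.
have lg : (monalg.msupp g `<=` d)%fset by apply: fsubsetUr.
have lfg : (monalg.msupp (c *: f + g : (malg (qpath Q) k)) `<=` d)%fset.
  apply: (fsubset_trans (monalg.msuppD_le _ _)).
  by apply: fsetSU; apply: monalg.msuppZ_le.
rewrite (path_liftEw h lf) (path_liftEw h lg) (path_liftEw h lfg).
rewrite scaler_sumr -big_split /=; apply: eq_bigr => p _.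
by rewrite monalg.mcoeffD monalg.mcoeffZ scalerDl scalerA.
Qed.

HB.instance Definition _ h :=
  GRing.isLinear.Build k kQ M *:%R (path_lift h) (path_lift_is_linear h).

Lemma path_lift_elt h p : path_lift h (path_elt p) = h p.
Proof.
have le : (monalg.msupp (path_elt p) `<=` [fset p])%fset by apply: monalg.msuppU_le.
by rewrite (path_liftEw h le) big_seq_fset1 monalg.mcoeffUU scale1r.
Qed.

Lemma eq_path_lift h h' : h =1 h' -> path_lift h =1 path_lift h'.
Proof. by move=> e f; apply: eq_bigr => p _; rewrite e. Qed.

Lemma path_ext (F G : {linear kQ -> M}) :
  (forall p, F (path_elt p) = G (path_elt p)) -> F =1 G.
Proof.
move=> e f.
have -> : f = \sum_(p <- monalg.msupp f) monalg.mcoeff p f *: path_elt p.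
  rewrite {1}[f](monalgE f); apply: eq_bigr => p _.
  by apply/malgP => q; rewrite monalg.mcoeffZ !monalg.mcoeffU mulr_natr.
by rewrite !linear_sum; apply: eq_bigr => p _; rewrite !linearZ e.
Qed.

End Lift.

Lemma path_mulE f g : path_mul f g =
  path_lift (fun p => path_lift (fun q => opath_elt (qcomp p q)) g) f.
Proof.
apply: eq_bigr => p _; rewrite scaler_sumr.
by apply: eq_bigr => q _; rewrite scalerA.
Qed.

Lemma path_mulDl : left_distributive path_mul +%R.
Proof. by move=> f g h; rewrite !path_mulE linearD. Qed.

Lemma path_mulZl c f g : path_mul (c *: f) g = c *: path_mul f g.
Proof. by rewrite !path_mulE linearZ. Qed.

Lemma path_mulDr : right_distributive path_mul +%R.
Proof.
move=> f g h; rewrite !path_mulE /path_lift -big_split /=.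
by apply: eq_bigr => p _; rewrite -scalerDr; congr (_ *: _);
  rewrite -/(path_lift _ _) linearD.
Qed.

Lemma path_mulZr c f g : path_mul f (c *: g) = c *: path_mul f g.
Proof.
rewrite !path_mulE /path_lift scaler_sumr.
apply: eq_bigr => p _; rewrite scalerA mulrC -scalerA; congr (_ *: _).
by rewrite -/(path_lift _ _) linearZ.
Qed.

Definition path_rmul g f := path_mul f g.

Lemma path_rmul_linear g : linear (path_rmul g).
Proof. by move=> c f f'; rewrite /path_rmul path_mulDl path_mulZl. Qed.
Lemma path_mul_linearr f : linear (path_mul f).
Proof. by move=> c g g'; rewrite path_mulDr path_mulZr. Qed.

HB.instance Definition _ g :=
  GRing.isLinear.Build k kQ kQ *:%R (path_rmul g) (path_rmul_linear g).
HB.instance Definition _ f :=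
  GRing.isLinear.Build k kQ kQ *:%R (path_mul f) (path_mul_linearr f).

Lemma path_mul_elt p q :
  path_mul (path_elt p) (path_elt q) = opath_elt (qcomp p q).
Proof. by rewrite path_mulE !path_lift_elt. Qed.

Lemma path_mulA : associative path_mul.
Proof.
move=> f g h.
apply: (@path_ext _ (path_rmul (path_mul g h))
  (path_rmul h \o path_rmul g)) => p /=.
apply: (@path_ext _ (path_mul (path_elt p) \o path_rmul h)
  (path_rmul h \o path_mul (path_elt p))) => q /=.
apply: (@path_ext _ (path_mul (path_elt p) \o path_mul (path_elt q))
  (path_mul (path_mul (path_elt p) (path_elt q)))) => r /=.
rewrite !path_mul_elt; have := qcompA p q r.
case: (qcomp q r) => [s|] /=; case: (qcomp p q) => [t|] /= e.
- by rewrite !path_mul_elt e.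
- by rewrite path_mul_elt e -[path_mul 0 _]/(path_rmul (path_elt r) 0) linear0.
- by rewrite linear0 path_mul_elt -e.
- by rewrite linear0 -[path_mul 0 _]/(path_rmul (path_elt r) 0) linear0.
Qed.

Lemma path_mul1 : left_id path_one path_mul.
Proof.
move=> f; apply: (@path_ext _ (path_mul path_one) idfun) => p /=.
rewrite -[path_mul _ _]/(path_rmul (path_elt p) path_one) linear_sum /=.
rewrite (bigD1 (qsource p)) //= /path_rmul path_mul_elt qcomp1p eqxx /= big1 ?addr0 //.
by move=> u /negPf ne; rewrite path_mul_elt qcomp1p ne.
Qed.

Lemma path_mulr1 : right_id path_one path_mul.
Proof.
move=> f; apply: (@path_ext _ (path_rmul path_one) idfun) => p /=.
rewrite /path_rmul.
rewrite linear_sum /=.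
rewrite (bigD1 (qtarget p)) //= path_mul_elt qcompp1 eqxx /= big1 ?addr0 //.
by move=> u /negPf ne; rewrite path_mul_elt qcompp1 ne.
Qed.

Lemma path_one_neq0 : path_one != 0.
Proof.
have /card_gt0P[u _] := vertex_gt0 Q.
apply/eqP => /(congr1 (monalg.mcoeff (vertex_path u))).
rewrite /path_one raddf_sum monalg.mcoeff0 (bigD1 u) //= monalg.mcoeffUU big1 ?addr0.
  by apply/eqP; rewrite oner_neq0.
move=> v ne; rewrite monalg.mcoeffU; case: eqP => [[e]|//].
by rewrite e eqxx in ne.
Qed.

End PathAlgebra.
Arguments path_elt k {Q} p.

HB.instance Definition _ (k : fieldType) (Q : quiver) :=
  GRing.Zmodule_isNzRing.Build (path_algebra k Q)
    (@path_mulA k Q) (@path_mul1 k Q) (@path_mulr1 k Q)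
    (@path_mulDl k Q) (@path_mulDr k Q) (@path_one_neq0 k Q).
HB.instance Definition _ (k : fieldType) (Q : quiver) :=
  GRing.Lmodule_isLalgebra.Build k (path_algebra k Q)
    (fun c f g => esym (@path_mulZl k Q c f g)).
HB.instance Definition _ (k : fieldType) (Q : quiver) :=
  GRing.Lalgebra_isAlgebra.Build k (path_algebra k Q)
    (fun c f g => esym (@path_mulZr k Q c f g)).

(** * Ideals, admissible ideals and quotients *)

Definition two_sided_ideal (R : pzRingType) (I : set R) : Prop :=
  [/\ I 0, forall x y, I x -> I y -> I (x + y)
    & forall a x, I x -> I (a * x) /\ I (x * a)].

Definition ideal_gen (R : pzRingType) (S : set R) : set R :=
  [set x | forall I, two_sided_ideal I -> S `<=` I -> I x].

Definition ideal_add (R : pzRingType) (I J : set R) : set R :=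
  [set x + y | x in I & y in J].

Definition ideal_mul (R : pzRingType) (I J : set R) : set R :=
  ideal_gen [set x * y | x in I & y in J].

Fixpoint ideal_exp (R : pzRingType) (I : set R) (l : nat) : set R :=
  if l is l'.+1 then ideal_mul (ideal_exp I l') I else [set: R].

Definition arrow_ideal (k : fieldType) (Q : quiver) : set (path_algebra k Q) :=
  ideal_gen [set path_elt k (arrow_path a) | a in [set: arrow Q]].
Arguments arrow_ideal k Q : clear implicits.

Definition admissible (k : fieldType) (Q : quiver)
    (I : set (path_algebra k Q)) : Prop :=
  [/\ two_sided_ideal I, I `<=` ideal_exp (arrow_ideal k Q) 2
    & exists2 l, (2 <= l)%N & ideal_exp (arrow_ideal k Q) l `<=` I].

(* [f] exhibits [B] as the quotient algebra [A / I]. *)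
Definition is_quotient (k : fieldType) (A : algType k) (I : set A)
    (B : algType k) (f : {lrmorphism A -> B}) : Prop :=
  (forall b, exists a, f a = b) /\ (forall a, f a = 0 <-> I a).

(** * Jacobson radical and subalgebras *)

Section Intersection.
Variables (k : fieldType) (V : vectType k).

(* The intersection of an arbitrary (possibly infinite) family of subspaces. *)
Definition capvs (F : set {vspace V}) : {vspace V} :=
  xget 0%VS [set U : {vspace V} | forall x, x \in U <-> forall W, F W -> x \in W].

Lemma memv_capvs (F : set {vspace V}) x :
  x \in capvs F <-> forall W, F W -> x \in W.
Proof.
suff [U UP] : exists U : {vspace V},
    forall x, x \in U <-> forall W, F W -> x \in W.
  exact: (@xgetI _ 0%VS [set U0 : {vspace V} |
    forall y, y \in U0 <-> forall W, F W -> y \in W] U UP).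
pose S (U : {vspace V}) := forall W, F W -> (U <= W)%VS.
pose P n := `[< exists2 U, S U & \dim U = n >].
have exP : exists n, P n.
  by exists 0%N; apply/asboolP; exists 0%VS; rewrite ?dimv0 // => W _; apply: sub0v.
have bP n : P n -> (n <= \dim {:V})%N.
  by move=> /asboolP[U _ <-]; apply/dimvS/subvf.
case: (ex_maxnP exP bP) => n /asboolP[U SU dU] nmax.
exists U => y; split=> [yU W FW|yF]; first exact: (subvP (SU W FW)).
have SUy : S (U + <[y]>)%VS.
  by move=> W FW; rewrite subv_add SU // -memvE yF.
have le : (\dim (U + <[y]>) <= \dim U)%N.
  by rewrite dU; apply: nmax; apply/asboolP; exists (U + <[y]>)%VS.
have : (U == U + <[y]>)%VS by rewrite eqEdim addvSl.
by move/eqP->; rewrite (subvP (addvSr _ _)) ?memv_line.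
Qed.

End Intersection.

Section Algebras.
Variables (k : fieldType) (B : falgType k).
Implicit Types (U A : {vspace B}).

Definition left_ideal U : Prop := ({: B} * U <= U)%VS.

Definition maximal_left_ideal U : Prop :=
  [/\ left_ideal U, U != fullv
    & forall W : {vspace B}, left_ideal W -> (U <= W)%VS -> W != fullv -> W = U].

Definition jacobson : {vspace B} := capvs maximal_left_ideal.

(* Unlike for [is_aspace], the unit is required to be that of [B]. *)
Definition subalgebra A : Prop := 1 \in A /\ (A * A <= A)%VS.

Definition inner (u : B) : 'End(B) := (amulr (u^-1)%R \o amull u)%VF.

Definition inn_star : set 'End(B) :=
  [set inner (1 + x) | x in [set x | x \in jacobson]].

Definition inn_star_orbit A : set {vspace B} :=
  [set (g @: A)%VS | g in inn_star].

End Algebras.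

(** * Projective varieties *)

(* A set of points of a projective space; a point is given by a choice of
   homogeneous coordinates. *)
Record projset (k : fieldType) := ProjSet {
  point : Type;
  ncoord : nat;
  hcoord : point -> 'I_ncoord -> k;
  pts : set point }.
Arguments pts {k} p _ : rename.

Definition homogeneous (k : fieldType) n (f : {mpoly k[n]}) : Prop :=
  exists d, f \is d.-homog.

Section ProjectiveVarieties.
Variable k : fieldType.
Implicit Types X Y : projset k.
Local Unset Implicit Arguments.

Definition restrict X (Z : set (point X)) : projset k :=
  @ProjSet k (point X) (ncoord X) (@hcoord k X) Z.

Definition zeros X (F : set {mpoly k[ncoord X]}) : set (point X) :=
  [set x | pts X x /\ forall f, F f -> f.@[hcoord x] = 0].

Definition zclosed X (Z : set (point X)) : Prop :=
  exists2 F : set {mpoly k[ncoord X]}, F `<=` @homogeneous k _ & Z = zeros X F.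

Definition zopen X (W : set (point X)) : Prop :=
  exists2 Z, zclosed X Z & W = pts X `\` Z.

(* Locally given by homogeneous polynomials of the same degree. *)
Definition morphism X Y (f : point X -> point Y) : Prop :=
  (forall x, pts X x -> pts Y (f x)) /\
  forall x, pts X x -> exists2 W : set (point X), zopen X W /\ W x &
    exists (d : nat) (g : 'I_(ncoord Y) -> {mpoly k[ncoord X]}),
      (forall j, g j \is d.-homog) /\
      forall y, W y -> exists2 c : k, c != 0 &
        forall j, (g j).@[hcoord y] = c * hcoord (f y) j.

Definition isomorphism X Y (f : point X -> point Y) : Prop :=
  morphism X Y f /\
  exists g : point Y -> point X,
    [/\ morphism Y X g, forall x, pts X x -> g (f x) = x
      & forall y, pts Y y -> f (g y) = y].

Definition closed_embedding X Y (f : point X -> point Y) : Prop :=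
  zclosed Y (f @` pts X) /\ isomorphism X (restrict Y (f @` pts X)) f.

Definition irreducible X (Z : set (point X)) : Prop :=
  [/\ Z `<=` pts X, Z !=set0
    & forall F G : set (point X), zclosed X F -> zclosed X G ->
        Z `<=` F `|` G -> Z `<=` F \/ Z `<=` G].

Definition irreducible_component X (Z : set (point X)) : Prop :=
  irreducible X Z /\
  forall Z' : set (point X), irreducible X Z' -> Z `<=` Z' -> Z' = Z.

Definition linear_subspace X (Z : set (point X)) : Prop :=
  exists2 F : set {mpoly k[ncoord X]},
    F `<=` [set f | f \is 1.-homog] & Z = zeros X F.

Definition vanishing_ideal X (Z : set (point X)) : set {mpoly k[ncoord X]} :=
  ideal_gen [set f | homogeneous f /\ forall x, Z x -> f.@[hcoord x] = 0].

End ProjectiveVarieties.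

Arguments restrict {k} X Z.
Arguments zeros {k} X F _.
Arguments zclosed {k} X Z.
Arguments zopen {k} X W.
Arguments morphism {k} X Y f.
Arguments isomorphism {k} X Y f.
Arguments closed_embedding {k} X Y f.
Arguments irreducible {k} X Z.
Arguments irreducible_component {k} X Z.
Arguments linear_subspace {k} X Z.
Arguments vanishing_ideal {k} X Z _.

(** * Grassmannians *)

(* Plücker coordinates: the m-minors of a frame, one for every sequence of m
   row indices.  Sequences that are not increasing only add coordinates that
   are zero or equal, up to sign, to the usual ones. *)
Definition plucker (k : fieldType) (V : vectType k) (m : nat) (U : {vspace V})
    (s : 'I_#|{: {ffun 'I_m -> 'I_(\dim {: V})}}|) : k :=
  \det (rowsub (enum_val s)
    (\matrix_(i < \dim {: V}, j < m) coord (vbasis {: V}) i (vbasis U)`_j)).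

Definition grassmannian (k : fieldType) (V : vectType k) (m : nat) : projset k :=
  ProjSet (@plucker k V m) [set U : {vspace V} | \dim U = m].

Definition alg_gr (k : fieldType) (B : falgType k) (m : nat) : projset k :=
  restrict (grassmannian B m)
    [set A : {vspace B} | \dim A = m /\ subalgebra A].

(* The Grassmannian of hyperplanes of k^n, identified with a projective space:
   the coordinate [x] is the minor of a frame with row [x] deleted. *)
Definition hyperplane_coord (k : fieldType) (n : nat)
    (A : {vspace 'cV[k]_n}) (x : 'I_n) : k :=
  \det (row' x (\matrix_(i < n, j < n.-1) (vbasis A)`_j i 0)).

Definition hyperplanes (k : fieldType) (n : nat) : projset k :=
  ProjSet (@hyperplane_coord k n) [set A | \dim A = n.-1].
Arguments hyperplanes k n : clear implicits.

(** * The subalgebras A(u+v) and A(u,v,U) *)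

(* [rho] identifies [C] with a quotient of the path algebra. *)
Section MaximalSubalgebras.
Variables (k : fieldType) (Q : quiver) (C : falgType k).
Variable rho : {lrmorphism path_algebra k Q -> C}.
Implicit Types (u v s t : vertex Q).

Definition vertex_elt u : C := rho (path_elt k (vertex_path u)).
Definition arrow_elt a : C := rho (path_elt k (arrow_path a)).

Definition arrow_span u v : {vspace C} :=
  (\sum_(a | arrow_from_to u v a) <[arrow_elt a]>)%VS.

Definition alg_glue u v : {vspace C} :=
  (<[vertex_elt u + vertex_elt v]>
   + \sum_(w | (w != u) && (w != v)) <[vertex_elt w]> + jacobson C)%VS.

Definition alg_arrow u v (U : {vspace C}) : {vspace C} :=
  (\sum_w <[vertex_elt w]> + U
   + \sum_(p : vertex Q * vertex Q | p != (u, v)) arrow_span p.1 p.2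
   + jacobson C * jacobson C)%VS.

Definition arrow_hyperplanes u v : set {vspace C} :=
  [set U | (U <= arrow_span u v)%VS /\ (\dim U).+1 = \dim (arrow_span u v)].

Definition orbit_union u v : set {vspace C} :=
  \bigcup_(U in arrow_hyperplanes u v) inn_star_orbit (alg_arrow u v U).

Definition components_glue : set (set {vspace C}) :=
  [set Z | exists s t, [/\ s != t,
     forall a, ~~ (arrow_from_to s t a || arrow_from_to t s a)
     & Z = [set alg_glue s t]]].

Definition components_arrow : set (set {vspace C}) :=
  [set Z | exists s t, [/\ s != t, exists a, arrow_from_to s t a
     & Z = orbit_union s t `|` [set alg_glue s t]]].

Definition components_loop : set (set {vspace C}) :=
  [set Z | exists s, (exists a, arrow_from_to s s a) /\ Z = orbit_union s s].

End MaximalSubalgebras.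

(** * The ideal X *)

(* The vertices are v_0 < ... < v_n0 and the arrows a_0 < ... < a_(n1-1).  The
   variable of index [lshift n1 i] is that of v_(i+1), and [rshift n0 i] that
   of a_i. *)
Section Equations.
Variables (k : fieldType) (Q : quiver) (n0 n1 : nat).
Variables (v : 'I_n0.+1 -> vertex Q) (a : 'I_n1 -> arrow Q).

Definition pvertex (i : 'I_n0) : vertex Q := v (lift ord0 i).
Definition vvar (i : 'I_n0) : {mpoly k[n0 + n1]} := 'X_(lshift n1 i).
Definition avar (i : 'I_n1) : {mpoly k[n0 + n1]} := 'X_(rshift n0 i).

Definition X_zero : set {mpoly k[n0 + n1]} := ideal_gen (
  [set f | exists i j : 'I_n0, (i < j)%N /\
     f = vvar i ^+ 2 * vvar j - (-1) ^+ (j - i - 1) * vvar i * vvar j ^+ 2]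
  `|`
  [set f | exists i j l : 'I_n0, (i < j < l)%N /\
     f = vvar i * vvar j * vvar l]).

(* In the second set the arrow may point in either direction: nothing relates
   the order on the vertices to the orientation of the arrows. *)
Definition X_half : set {mpoly k[n0 + n1]} := ideal_gen (
  [set f | exists (i : 'I_n1) (j : 'I_n0),
     (pvertex j != src (a i)) && (pvertex j != tgt (a i)) /\
     f = avar i * vvar j]
  `|`
  [set f | exists (j l : 'I_n0) (i : 'I_n1), [/\ (j < l)%N,
     arrow_from_to (pvertex j) (pvertex l) (a i)
       || arrow_from_to (pvertex l) (pvertex j) (a i)
     & f = (vvar l - (-1) ^+ (l - j - 1) * vvar j) * avar i]]
  `|`
  [set f | exists (j : 'I_n0) (i : 'I_n1),
     arrow_from_to (pvertex j) (pvertex j) (a i) /\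
     f = vvar j * avar i]).

Definition X_one : set {mpoly k[n0 + n1]} := ideal_gen
  [set f | exists i j : 'I_n1, ~~ parallel (a i) (a j) /\
     f = avar i * avar j].

Definition X_ideal : set {mpoly k[n0 + n1]} :=
  ideal_add (ideal_add X_zero X_half) X_one.

End Equations.
Arguments X_ideal k {Q n0 n1} v a _.

(* The total orders on vertices and arrows are given by the enumerations [v]
   and [a]; the arrows between two given vertices form an interval. *)
Definition ordered_quiver (Q : quiver) (n0 n1 : nat)
    (v : 'I_n0.+1 -> vertex Q) (a : 'I_n1 -> arrow Q) : Prop :=
  [/\ bijective v, bijective a
    & forall i j l : 'I_n1, (i <= j <= l)%N -> parallel (a i) (a l) ->
        parallel (a i) (a j)].

(* Main.v *)
(* A subalgebra of codimension one is the kernel of a linear form f with f(1) = 0,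
   and B / ker f is a one-dimensional bimodule over ker f.  Nilpotent elements act
   on it by zero, which forces f to vanish on J(B)^2; evaluating f on products of
   elements e_u - c e_v and e_u - c alpha then shows that there are vertices s, t
   such that f kills all vertices but s, t and all arrows but those from s to t.
   Conversely such an f satisfies f(xy) = x_s f(y) + f(x) y_t, where x_s is the
   coordinate of x at the vertex s, so that its kernel is a subalgebra.  Hence, in
   the values of f on vertices and arrows, which are linear coordinates of the
   Grassmannian up to scaling, the variety is a union of linear subspaces, one for
   each pair (s, t); none of this sees J(B)^2.

   In T_2 Q, conjugation by 1 + x replaces f by b |-> f(b) - f(x) (b_s - b_t), so
   that f can be moved to a form killing all vertices as soon as it does not kill
   all arrows: this identifies the linear pieces with unions of orbits.

   For the vanishing ideal, let p vanish on all pieces.  Modulo X, multiplication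
   by an arrow alpha : s -> t does not distinguish p from its restriction to the
   piece of (s, t), and multiplication by v_i v_j does not distinguish a polynomial
   in the vertices from its restriction to the line of e_i - e_j.  Writing p as a
   combination of arrows and of products v_i v_j shows that p lies in X. *)

Require Import Defs.
From HB Require Import structures.
From mathcomp Require Import all_boot all_order all_algebra all_field.
From mathcomp Require Import finmap boolp classical_sets.
From mathcomp Require Import -(notations) monalg.
From mathcomp Require Import mpoly ring.

Set Implicit Arguments.
Unset Strict Implicit.
Unset Printing Implicit Defensive.

Import GRing.Theory.
Local Open Scope ring_scope.
Local Open Scope classical_set_scope.

(** * Hyperplanes and signed minors *)

(** Homogeneous coordinates are minors of the frame [vbasis], an arbitrary choice, so identities
    between coordinates hold only up to a scalar that varies with the point. The geometry is
    therefore phrased through [chart]: coordinate systems that are linear in each other up to such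
    scalars give the same closed sets and morphisms. The Grassmannians of B and of T_2Q and the
    projective space all receive charts with the same n0 + n1 coordinates, the values of the
    functional on the vertices other than v_0 and on the arrows; in these charts the maps of (a) and
    (b) are the identity up to scalars.

    The functional of a hyperplane has signed minors as coefficients, whereas the coordinates of
    [hyperplanes] are unsigned. Undoing the alternating sign turns relations such as x_i x_j (x_i +
    x_j) = 0 into the generators of X with their signs.

    Algebraic closedness of k enters as the existence of non-roots of nonzero polynomials, both for
    the irreducibility of linear pieces and for passing from zero functions to zero polynomials. *)

Section SignedMinors.
Variable k : fieldType.

(** The cofactors along a column put in front of F, hence the coefficients of a linear form that
    vanishes on the columns of F. *)
Definition signed_minor n (F : 'M[k]_(n, n.-1)) (x : 'I_n) : k :=
  (-1) ^+ x * \det (row' x F).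

(** Repeating column j in front of F gives a square matrix with two equal columns; the sum is the
    expansion of its determinant along the first one. *)
Lemma signed_minor_mul n (F : 'M[k]_(n, n.-1)) j :
  \sum_x signed_minor F x * F x j = 0.
Proof.
case: n F j => [|n] F j; first by case: j.
pose G : 'M[k]_n.+1 := row_mx (col j F) F.
have G0 i : G i ord0 = F i j.
  have e : ord0 = lshift n (@ord0 0) by apply: val_inj.
  by rewrite [X in G i X]e; apply: etrans (row_mxEl (col j F) F i ord0) _; rewrite mxE.
have GS i b : G i (lift ord0 b) = F i b.
  have e : lift ord0 b = rshift 1 b by apply: val_inj.
  by rewrite [X in G i X]e; apply: (row_mxEr (col j F) F i b).
have : \det G = 0.
  rewrite -det_tr; apply: (@determinant_alternate _ _ _ ord0 (lift ord0 j)) => // i.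
  by rewrite [LHS]mxE [RHS]mxE G0 GS.
rewrite (expand_det_col _ ord0) => e0; rewrite -[RHS]e0; apply: eq_bigr => i _.
rewrite G0 /signed_minor /cofactor addn0 mulrC; congr (_ * (_ * \det _)).
by apply/matrixP => a b; rewrite [LHS]mxE [RHS]mxE [RHS]mxE GS.
Qed.

(** A choice of n - 1 rows misses some row x, so it factors through [lift x], and the minor is that
    of F without row x times the determinant of a selection matrix. Repeated and unordered rows,
    which [plucker] allows, are covered. *)
Lemma minor_rowsub n (s : 'I_n.-1 -> 'I_n) : (0 < n)%N ->
  exists (x : 'I_n) (c : k), forall F, \det (rowsub s F) = c * signed_minor F x.
Proof.
case: n s => // n s _.
have [x xs] : exists x, x \notin codom s.
  apply/existsP; rewrite -negb_forall; apply/negP => /forallP h.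
  have : (#|'I_n.+1| <= #|codom s|)%N by apply/subset_leq_card/fintype.subsetP => x _; apply: h.
  by move/leq_trans/(_ (leq_image_card _ _)); rewrite !card_ord ltnn.
have sx (j : 'I_n) : exists i, s j == lift x i.
  have : x != s j by apply: contraNneq xs => ->; apply: codom_f.
  by case/unlift_some => i -> _; exists i.
pose s' j := xchoose (sx j).
have s'P j : s j = lift x (s' j) := eqP (xchooseP (sx j)).
exists x, ((-1) ^+ x * \det (rowsub s' 1%:M)) => F.
rewrite /signed_minor mulrACA -expr2 sqrr_sign mul1r -det_mulmx -rowsubE.
by congr (\det _); apply/matrixP => i j; rewrite !mxE s'P.
Qed.

Lemma signed_minor_neq0 n (F : 'M[k]_(n, n.-1)) :
  (0 < n)%N -> row_full F -> exists x, signed_minor F x != 0.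
Proof.
move=> n0 fullF; have [x [c e]] := minor_rowsub (fullrankfun fullF) n0.
have := fullrowsub_unit fullF; rewrite unitmxE unitfE e.
by rewrite mulf_eq0 negb_or => /andP[_ nz]; exists x.
Qed.

End SignedMinors.

(** * Hyperplanes as kernels of linear forms *)

Section Functionals.
Variables (k : fieldType) (V : vectType k).

Lemma dim_lker_functional (f : 'Hom(V, k^o)) : f != 0 ->
  (\dim (lker f)).+1 = \dim {: V}.
Proof.
move=> nz; have := limg_ker_dim f fullv; rewrite capfv => <-.
suff -> : limg f = fullv by rewrite dimvf addn1.
apply/eqP; rewrite eqEdim subvf dimvf /= lt0n dimv_eq0.
apply: contraNN nz => /eqP e; apply/eqP/lfunP => x.
by apply/eqP; rewrite lfunE /= -memv0 -e memv_img ?memvf.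
Qed.

Lemma functional_unique (f g : 'Hom(V, k^o)) : f != 0 -> g != 0 ->
  (lker f <= lker g)%VS -> exists2 c : k, c != 0 & forall x, g x = c * f x.
Proof.
move=> nf ng /subvP le.
have [e fe] : exists e, f e != 0.
  apply: contrapT => h; case/eqP: nf; apply/lfunP => x; rewrite lfunE /=.
  by apply/eqP; apply: contrapT => /negP fx; apply: h; exists x.
have gE x : g x = (g e / f e) * f x.
  have : x - (f x / f e) *: e \in lker g.
    apply: le; rewrite memv_ker linearB linearZ /= /GRing.scale /= divfK //.
    by rewrite subrr.
  rewrite memv_ker linearB linearZ /= subr_eq0 /GRing.scale /= => /eqP ->.
  by rewrite mulrAC [RHS]mulrAC [f x * _]mulrC.
exists (g e / f e) => //; apply: contraNneq ng => c0; apply/eqP/lfunP => x.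
by rewrite gE c0 mul0r lfunE.
Qed.

Variables (n : nat) (phi : {linear V -> 'rV[k]_n}).

Definition hyperplane_frame (A : {vspace V}) : 'M[k]_(n, n.-1) :=
  \matrix_(i < n, j < n.-1) phi (vbasis A)`_j 0 i.

(** Coefficients of a form with kernel A. The identification [phi] of V with row vectors is a
    parameter, so that the same results serve an algebra in its basis and the space of columns. *)
Definition normal (A : {vspace V}) : 'I_n -> k :=
  signed_minor (hyperplane_frame A).

Definition pairing (w : 'I_n -> k) (v : V) : k^o := \sum_i phi v 0 i * w i.

Lemma pairing_linear w : linear (pairing w).
Proof.
move=> c u v; rewrite /pairing scaler_sumr -big_split; apply: eq_bigr => i _.
by rewrite linearP !mxE mulrDl -mulrA.
Qed.
HB.instance Definition _ w :=
  GRing.isLinear.Build k V k^o *:%R (pairing w) (pairing_linear w).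

Variable psi : 'rV[k]_n -> V.
Hypotheses (phiK : cancel phi psi) (psiK : cancel psi phi).
Hypotheses (dimV : \dim {: V} = n) (n_gt0 : (0 < n)%N).

Lemma hyperplane_frame_full (A : {vspace V}) : \dim A = n.-1 ->
  row_full (hyperplane_frame A).
Proof.
move=> dimA.
rewrite /row_full -mxrank_tr; apply: (@inj_row_free _ _ _ (hyperplane_frame A)^T).
move=> u u0.
pose c (i : 'I_(\dim A)) := u 0 (cast_ord dimA i).
have c0 : \sum_i c i *: (vbasis A)`_i = 0.
  apply: (can_inj phiK); rewrite linear0 linear_sum; apply/rowP => x.
  move/rowP/(_ x): u0; rewrite !mxE => <-; rewrite summxE.
  rewrite (reindex (cast_ord (esym dimA))) /=; last first.
    by exists (cast_ord dimA) => i _; rewrite ?cast_ordK ?cast_ordKV.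
  by apply: eq_bigr => i _; rewrite linearZ !mxE /c cast_ordKV.
have /freeP/(_ c c0) h := basis_free (vbasisP A).
apply/rowP => j; rewrite mxE; have := h (cast_ord (esym dimA) j).
by rewrite /c cast_ordKV.
Qed.

Lemma pairing_neq0 w : (exists x, w x != 0) -> linfun (pairing w) != 0.
Proof.
case=> x wx; apply/eqP => /lfunP/(_ (psi (delta_mx 0 x)))/eqP.
rewrite !lfunE /= /pairing psiK (bigD1 x) //= big1 ?addr0 ?mxE ?eqxx ?mul1r.
  exact/negP.
by move=> i /negPf ne; rewrite mxE eqxx ne mul0r.
Qed.

Lemma normal_neq0 (A : {vspace V}) : \dim A = n.-1 -> exists x, normal A x != 0.
Proof. by move=> dimA; apply/signed_minor_neq0/hyperplane_frame_full. Qed.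

Lemma lker_normal (A : {vspace V}) : \dim A = n.-1 ->
  lker (linfun (pairing (normal A))) = A.
Proof.
move=> dimA; apply/esym/eqP; rewrite eqEdim; apply/andP; split; last first.
  have := dim_lker_functional (pairing_neq0 (normal_neq0 dimA)).
  by rewrite dimV dimA => <-.
apply/subvP => v /coord_vbasis ->; apply: rpred_sum => j _; apply: rpredZ.
rewrite memv_ker lfunE /= /pairing.
rewrite -[X in _ == X](signed_minor_mul (hyperplane_frame A) (cast_ord dimA j)).
by apply/eqP/eq_bigr => i _; rewrite mulrC !mxE.
Qed.

(** Frees the later arguments from the frame [vbasis A]: a form may be produced by any means and
    compared with [normal A] afterwards. *)
Lemma normal_unique (A : {vspace V}) (g : 'Hom(V, k^o)) : \dim A = n.-1 ->
  g != 0 -> (A <= lker g)%VS ->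
  exists2 c : k, c != 0 & forall v, pairing (normal A) v = c * g v.
Proof.
move=> dimA nz le.
have nz' := pairing_neq0 (normal_neq0 dimA).
have le' : (lker g <= lker (linfun (pairing (normal A))))%VS.
  suff -> : lker g = A by rewrite lker_normal.
  apply/esym/eqP; rewrite eqEdim le /=.
  by have := dim_lker_functional nz; rewrite dimV dimA => <-.
have [c c0 h] := functional_unique nz nz' le'.
by exists c => // v; rewrite -h lfunE.
Qed.

Lemma pairing_psi w x : pairing w (psi (delta_mx 0 x)) = w x.
Proof.
rewrite /pairing psiK (bigD1 x) //= big1 ?addr0 ?mxE ?eqxx ?mul1r //.
by move=> i /negPf ne; rewrite mxE eqxx ne mul0r.
Qed.
End Functionals.

(** * Projective sets with linear coordinates *)

Section Homogeneous.
Variable k : fieldType.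

Lemma dhomog_sum n d (I : Type) (r : seq I) (P : pred I) (F : I -> {mpoly k[n]}) :
  (forall i, P i -> F i \is d.-homog) -> \sum_(i <- r | P i) F i \is d.-homog.
Proof. exact: rpred_sum. Qed.

Lemma dhomog_prod_ord n m (d : 'I_m -> nat) (F : 'I_m -> {mpoly k[n]}) :
  (forall i, F i \is (d i).-homog) -> \prod_i F i \is (\sum_i d i).-homog.
Proof.
move=> h; elim/big_rec2: _ => [|i e p _ IH]; first exact: dhomog1.
exact: dhomogM.
Qed.

Lemma dhomog_comp n m d (p : {mpoly k[n]}) (q : n.-tuple {mpoly k[m]}) :
  p \is d.-homog -> (forall i, tnth q i \is 1.-homog) -> p \mPo q \is d.-homog.
Proof.
move=> hp hq; rewrite comp_mpolyEX big_seq; apply: dhomog_sum => mm mp.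
rewrite dhomogZ // comp_mpolyX.
have <- : \sum_(i < n) mm i = d by rewrite -mdegE; apply: (dhomogP _ _ _ hp).
apply: dhomog_prod_ord => i; rewrite -[X in X.-homog]mul1n; exact: dhomogMn.
Qed.

Lemma meval_homog n d (p : {mpoly k[n]}) c (u : 'I_n -> k) : p \is d.-homog ->
  p.@[fun i => c * u i] = c ^+ d * p.@[u].
Proof.
move=> hp; rewrite !mevalE mulr_sumr !big_seq; apply: eq_bigr => m mp.
rewrite mulrCA; congr (_ * _).
rewrite -(dhomogP _ _ _ hp m mp) /= mdegE -prodrXr -big_split /=.
by apply: eq_bigr => i _; rewrite exprMn.
Qed.

Lemma meval_lin n (p : {mpoly k[n]}) c (u w : 'I_n -> k) : p \is 1.-homog ->
  p.@[fun i => u i + c * w i] = p.@[u] + c * p.@[w].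
Proof.
move=> hp; rewrite !mevalE mulr_sumr -big_split !big_seq; apply: eq_bigr => m mp /=.
have /mdeg1P[i /eqP ->] : mdeg m == 1%N.
  by apply/eqP; apply: (dhomogP _ _ _ hp).
have E v : \prod_j v j ^+ U_(i)%MM j = v i :> k.
  rewrite (bigD1 i) //= big1 ?mulr1 ?mnm1E ?eqxx //.
  by move=> j /negPf ne; rewrite mnm1E eq_sym ne.
by rewrite !E mulrDr mulrCA.
Qed.

End Homogeneous.

Local Notation point := Defs.point.

Section ProjectivelyLinear.
Variable k : fieldType.

(** The matrix is global but the factor c depends on the point, as homogeneous coordinates are
    meaningful only through their ratios. *)
Definition lin_on (T : Type) (S : set T) p q
    (u : T -> 'I_p -> k) (w : T -> 'I_q -> k) : Prop :=
  exists M : 'I_p -> 'I_q -> k, forall x, S x ->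
    exists2 c, c != 0 & forall j, w x j = c * \sum_i u x i * M i j.

Lemma lin_on_scale (T : Type) (S : set T) p (u w : T -> 'I_p -> k) :
  (forall x, S x -> exists2 c, c != 0 & forall j, w x j = c * u x j) ->
  lin_on S u w.
Proof.
move=> h; exists (fun i j => (i == j)%:R) => x /h[c c0 e]; exists c => // j.
rewrite e (bigD1 j) //= eqxx mulr1 big1 ?addr0 // => i /negPf->.
by rewrite mulr0.
Qed.

Lemma lin_on_trans (T : Type) (S : set T) p q r
    (u : T -> 'I_p -> k) (v : T -> 'I_q -> k) (w : T -> 'I_r -> k) :
  lin_on S u v -> lin_on S v w -> lin_on S u w.
Proof.
move=> [M MP] [N NP]; exists (fun i l => \sum_j M i j * N j l) => x Sx.
have [c c0 hc] := MP x Sx; have [d d0 hd] := NP x Sx.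
exists (d * c); first by rewrite mulf_neq0.
move=> l; rewrite hd -mulrA; congr (_ * _); rewrite mulr_sumr.
under eq_bigr => j _ do rewrite hc -mulrA mulr_suml mulr_sumr.
rewrite exchange_big; apply: eq_bigr => i _.
by rewrite 2!mulr_sumr; apply: eq_bigr => j _; rewrite !mulrA.
Qed.

Lemma lin_on_comp (T T' : Type) (S : set T) (S' : set T') p q
    (f : T -> T') (u : T' -> 'I_p -> k) (v : T' -> 'I_q -> k) :
  (forall x, S x -> S' (f x)) -> lin_on S' u v -> lin_on S (u \o f) (v \o f).
Proof. by move=> h [M MP]; exists M => x /h/MP. Qed.

Definition chart (X : projset k) n (nu : point X -> 'I_n -> k) : Prop :=
  lin_on (pts X) (@hcoord k X) nu /\ lin_on (pts X) nu (@hcoord k X).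

Lemma lin_on_eval p q (M : 'I_p -> 'I_q -> k) (f : {mpoly k[q]}) d :
  f \is d.-homog -> exists2 g : {mpoly k[p]}, g \is d.-homog &
    forall u, g.@[u] = f.@[fun j => \sum_i u i * M i j].
Proof.
move=> hf; pose t := [tuple \sum_i M i j *: 'X_i | j < q] : q.-tuple {mpoly k[p]}.
exists (f \mPo t).
  apply: dhomog_comp => // i; rewrite tnth_mktuple; apply: dhomog_sum => j _.
  by rewrite dhomogZ // dhomogX /= mdeg1.
move=> u; rewrite comp_mpoly_meval; apply: meval_eq => j; rewrite tnth_mktuple.
rewrite raddf_sum; apply: eq_bigr => i _ /=.
by rewrite mevalZ mevalXU mulrC.
Qed.

Lemma zclosed0 (X : projset k) : zclosed X set0.
Proof.
exists [set 1%R] => [f -> |]; first by exists 0%N; apply: dhomog1.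
apply/seteqP; split=> x //= [_ /(_ 1 erefl)]; rewrite meval1.
by move/eqP; rewrite oner_eq0.
Qed.

Lemma morphism_lin (X Y : projset k) (f : point X -> point Y) :
  (forall x, pts X x -> pts Y (f x)) ->
  lin_on (pts X) (@hcoord k X) (@hcoord k Y \o f) -> morphism X Y f.
Proof.
move=> h [M MP]; split=> // x Xx; exists (pts X).
  by split=> //; exists set0; [apply: zclosed0 | rewrite setD0].
exists 1%N, (fun j => \sum_i M i j *: 'X_i); split=> [j|y /MP[c c0 e]].
  by apply: dhomog_sum => i _; rewrite dhomogZ // dhomogX /= mdeg1.
exists c^-1; first by rewrite invr_eq0.
move=> j; rewrite /= in e; rewrite e mulKf // raddf_sum; apply: eq_bigr => i _ /=.
by rewrite mevalZ mevalXU mulrC.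
Qed.

(** In charts the map is the identity up to scalars, so it is given by linear forms on the whole of
    X. *)
Lemma morphism_chart (X Y : projset k) n (f : point X -> point Y)
    (nX : point X -> 'I_n -> k) (nY : point Y -> 'I_n -> k) :
  chart nX -> chart nY -> (forall x, pts X x -> pts Y (f x)) ->
  (forall x, pts X x ->
     exists2 c, c != 0 & forall j, nY (f x) j = c * nX x j) ->
  morphism X Y f.
Proof.
move=> [X1 _] [_ Y2] h e; apply: morphism_lin => //.
apply: (lin_on_trans X1); apply: (lin_on_trans (lin_on_scale e)).
exact: (lin_on_comp h Y2).
Qed.

(** Forms are pulled back along the matrices of the chart; the pointwise scalar contributes only a
    power of itself, because the forms are homogeneous. *)
Lemma chart_zclosed (X : projset k) n (nu : point X -> 'I_n -> k) Z :
  chart nu ->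
  zclosed X Z <-> exists2 F : set {mpoly k[n]}, F `<=` @homogeneous k n &
    Z = [set x | pts X x /\ forall f, F f -> f.@[nu x] = 0].
Proof.
have main p q (u : point X -> 'I_p -> k) (w : point X -> 'I_q -> k)
    (F : set {mpoly k[q]}) : lin_on (pts X) u w -> F `<=` @homogeneous k q ->
    exists2 G : set {mpoly k[p]}, G `<=` @homogeneous k p &
      forall x, pts X x ->
        (forall f, F f -> f.@[w x] = 0) <-> (forall g, G g -> g.@[u x] = 0).
  move=> [M MP] hF.
  exists [set g | homogeneous g /\ exists2 f, F f &
      forall v, g.@[v] = f.@[fun j => \sum_i v i * M i j]].
    by move=> g [].
  move=> x /MP[c c0 wE]; split=> [h g [_ [f Ff ->]]|h f Ff].
    have [d hd] := hF f Ff; have := h f Ff.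
    rewrite (meval_eq _ wE) (meval_homog _ _ hd) => /eqP.
    by rewrite mulf_eq0 expf_eq0 (negPf c0) andbF => /eqP.
  have [d hd] := hF f Ff; have [g hg gE] := lin_on_eval M hd.
  rewrite (meval_eq _ wE) (meval_homog _ _ hd) -gE h ?mulr0 //.
  by split; [exists d | exists f].
move=> [l1 l2]; split=> -[F hF ->].
  have [G hG GP] := main _ _ _ _ F l2 hF; exists G => //.
  by apply/seteqP; split=> x [Xx hx]; split=> //; apply/(GP x Xx).
have [G hG GP] := main _ _ _ _ F l1 hF; exists G => //.
by apply/seteqP; split=> x [Xx hx]; split=> //; apply/(GP x Xx).
Qed.

Lemma zclosedU (X : projset k) (F G : set (point X)) :
  zclosed X F -> zclosed X G -> zclosed X (F `|` G).
Proof.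
move=> [P hP ->] [R hR ->]; exists [set p * r | p in P & r in R].
  move=> _ [p /hP[d hd]] [r /hR[e he]] <-; exists (d + e)%N; exact: dhomogM.
apply/seteqP; split=> x.
  case=> -[Xx h]; split=> // _ [p Pp] [r Rr] <-; rewrite mevalM.
    by rewrite h ?mul0r.
  by rewrite [X in _ * X]h ?mulr0.
case=> Xx h; have [?|nP] := pselect (forall p, P p -> p.@[hcoord x] = 0).
  by left.
right; split=> // r Rr; apply: contrapT => r0; apply: nP => p Pp.
have /eqP := h _ (ex_intro2 _ _ p Pp (ex_intro2 _ _ r Rr erefl)).
by rewrite mevalM mulf_eq0 => /orP[/eqP //|/eqP].
Qed.

End ProjectivelyLinear.

(** * Irreducible components of a finite union of linear subspaces *)

Section UnionOfLinearSpaces.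
Variables (k : closedFieldType) (X : projset k) (n : nat).
Variables (nu : point X -> 'I_n -> k) (C : finType).
Variable L : C -> set ('I_n -> k).
Hypothesis nuP : chart nu.
Hypothesis Llin : forall c, exists2 F : set {mpoly k[n]},
  F `<=` [set f | f \is 1.-homog] & L c = [set w | forall f, F f -> f.@[w] = 0].
Hypothesis nu_neq0 : forall x, pts X x -> exists i, nu x i != 0.
Hypothesis nu_cover : forall x, pts X x -> exists c, L c (nu x).
Hypothesis nu_onto : forall c w, L c w -> (exists i, w i != 0) ->
  exists2 x, pts X x & exists2 a, a != 0 & forall i, nu x i = a * w i.
Hypothesis L_neq0 : forall c, exists2 w, L c w & exists i, w i != 0.
Hypothesis L_incomparable : forall c d, L c `<=` L d -> L d `<=` L c.

Definition linear_piece c : set (point X) := [set x | pts X x /\ L c (nu x)].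

Lemma L_scale c a w : L c w -> L c (fun i => a * w i).
Proof.
have [F hF ->] := Llin c => h f Ff.
by rewrite (meval_homog _ _ (hF f Ff)) h ?mulr0.
Qed.

Lemma L_line c a u w : L c u -> L c w -> L c (fun i => u i + a * (w i - u i)).
Proof.
have [F hF ->] := Llin c => hu hw f Ff.
rewrite (@meval_lin _ _ _ a u (fun i => w i - u i) (hF f Ff)) hu // add0r.
rewrite (@meval_eq _ _ _ (fun i => w i + (-1) * u i)); last first.
  by move=> i; rewrite mulN1r.
by rewrite (meval_lin _ _ _ (hF f Ff)) hu // hw // add0r !mulr0.
Qed.

Lemma linear_piece_closed c : zclosed X (linear_piece c).
Proof.
apply/(chart_zclosed _ nuP); have [F hF Lc] := Llin c.
by exists F; [move=> f /hF ?; exists 1%N | rewrite /linear_piece Lc].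
Qed.

(** Restriction of p to the line through u (parameter 0) and w (parameter 1). *)
Definition line_poly (u w : 'I_n -> k) (p : {mpoly k[n]}) : {poly k} :=
  mmap polyC (fun i => (u i)%:P + 'X * (w i - u i)%:P) p.

Lemma line_polyE u w p a :
  (line_poly u w p).[a] = p.@[fun i => u i + a * (w i - u i)].
Proof.
rewrite /line_poly /mmap mevalE horner_sum; apply: eq_bigr => m _.
rewrite hornerM hornerC; congr (_ * _); rewrite /mmap1 horner_prod.
by apply: eq_bigr => i _; rewrite horner_exp !hornerE.
Qed.

(* Two points of the piece at which forms [p], [r] do not vanish span a line
   all but finitely many points of which have the same property. *)
Lemma linear_piece_irreducible c : irreducible X (linear_piece c).
Proof.
split=> [x [] //||F G].
  have [w Lw w0] := L_neq0 c; have [x Xx [a a0 e]] := nu_onto Lw w0.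
  by exists x; split=> //; have -> : nu x = fun i => a * w i; [apply/funext | apply: L_scale].
move=> /(chart_zclosed _ nuP)[P hP ->] /(chart_zclosed _ nuP)[R hR ->] hU.
have [h|nP] := pselect (forall x, linear_piece c x -> forall p, P p -> p.@[nu x] = 0).
  by left=> x cx; split; [case: cx | move=> p; apply: h].
have [h|nR] := pselect (forall x, linear_piece c x -> forall p, R p -> p.@[nu x] = 0).
  by right=> x cx; split; [case: cx | move=> p; apply: h].
exfalso.
have [x [[Xx Lx] [p Pp px]]] : exists x, linear_piece c x /\
    exists2 p, P p & p.@[nu x] != 0.
  apply: contrapT => h; apply: nP => x cx p Pp; apply: contrapT => px.
  by apply: h; exists x; split=> //; exists p => //; apply/eqP.
have [y [[Xy Ly] [r Rr ry]]] : exists y, linear_piece c y /\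
    exists2 r, R r & r.@[nu y] != 0.
  apply: contrapT => h; apply: nR => y cy r Rr; apply: contrapT => ry.
  by apply: h; exists y; split=> //; exists r => //; apply/eqP.
have [i xi] := nu_neq0 Xx.
pose g := line_poly (nu x) (nu y).
(* The factor for 'X_i keeps the chosen vector of the line nonzero, so that it is realised by a
   point of X. *)
have /closed_nonrootP[a] : g p * g r * g 'X_i != 0.
  have atx q : q.@[nu x] != 0 -> g q != 0.
    apply: contraNneq => q0; have := line_polyE (nu x) (nu y) q 0.
    rewrite -/(g q) q0 horner0 => ->; apply/eqP/meval_eq => j.
    by rewrite mul0r addr0.
  have gi : g 'X_i != 0 by apply: atx; rewrite mevalXU.
  suff gr : g r != 0 by rewrite mulf_neq0 // mulf_neq0 // atx.
  apply: contraNneq ry => q0; have := line_polyE (nu x) (nu y) r 1.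
  rewrite -/(g r) q0 horner0 => ->; apply/eqP/meval_eq => j.
  by rewrite mul1r addrC subrK.
rewrite /root !hornerM !mulf_eq0 !negb_or !line_polyE => /andP[/andP[pa ra]].
rewrite mevalXU => ia.
have Lw := L_line a Lx Ly; have [z Xz [b b0 zE]] := nu_onto Lw (ex_intro _ i ia).
have Lz : linear_piece c z.
  by split=> //; rewrite (_ : nu z = fun j => b * (nu x j + a * (nu y j - nu x j)));
    [apply: L_scale | apply/funext].
have kill q : homogeneous q -> q.@[nu z] = 0 ->
    q.@[fun j => nu x j + a * (nu y j - nu x j)] = 0.
  move=> [d hd] /eqP; rewrite (meval_eq _ zE) (meval_homog _ _ hd) mulf_eq0.
  by rewrite expf_eq0 (negPf b0) andbF => /eqP.
case: (hU z Lz) => -[_ h].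
  by move/eqP: pa; apply; apply: kill (h _ _) => //; apply: hP.
by move/eqP: ra; apply; apply: kill (h _ _) => //; apply: hR.
Qed.

Lemma irreducible_sub_piece Z : irreducible X Z -> exists c, Z `<=` linear_piece c.
Proof.
move=> [ZX Z0 Zirr].
(* The pieces are removed one at a time: irreducibility puts Z inside the head piece or inside the
   closed union of the others. *)
suff h (s : seq C) : Z `<=` (fun x => exists2 c, c \in s & linear_piece c x) ->
    exists c, Z `<=` linear_piece c.
  apply: (h (enum C)) => x Zx; have [c Lc] := nu_cover (ZX x Zx).
  by exists c; [rewrite mem_enum | split=> //; apply: ZX].
have cl (t : seq C) : zclosed X (fun x => exists2 c, c \in t & linear_piece c x).
  elim: t => [|c t IH].
    rewrite (_ : (fun _ => _) = set0); first exact: zclosed0.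
    by apply/seteqP; split=> x // [].
  rewrite (_ : (fun _ => _) =
      linear_piece c `|` (fun x => exists2 c, c \in t & linear_piece c x)).
    by apply: zclosedU IH; apply: linear_piece_closed.
  apply/seteqP; split=> x [].
  - move=> d; rewrite inE => /orP[/eqP->|dt] px; first by left.
    by right; exists d.
  - by move=> px; exists c; rewrite ?inE ?eqxx.
  - by move=> [d dt px]; exists d; rewrite ?inE ?dt ?orbT.
elim: s => [|c s IH] hs; first by have [x /hs[]] := Z0.
have [|zc|zs] := Zirr _ _ (linear_piece_closed c) (cl s).
- move=> x /hs[d]; rewrite inE => /orP[/eqP->|dt] px; first by left.
  by right; exists d.
- by exists c.
- exact: IH.
Qed.

Lemma irreducible_componentE Z :
  irreducible_component X Z <-> exists c, Z = linear_piece c.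
Proof.
(* [L c] is recovered from its nonzero vectors, which are realised by points of X; the zero vector
   lies in every [L d]. *)
have piece_sub c d : linear_piece c `<=` linear_piece d -> L c `<=` L d.
  move=> h w Lw; have [w0|/existsPn w0] := boolP [exists i, w i != 0].
    have [x Xx [a a0 xE]] := nu_onto Lw (existsP w0).
    have [] := h x; first by split=> //; rewrite (_ : nu x = fun i => a * w i);
      [apply: L_scale | apply/funext].
    move=> _ /(L_scale a^-1); congr (L d _); apply/funext => i.
    by rewrite xE mulKf.
  have [u Lu _] := L_neq0 d; move/(L_scale 0): Lu; congr (L d _).
  by apply/funext => i; rewrite mul0r; apply/esym/eqP; have := w0 i; rewrite negbK.
split=> [[irr maxZ]|[c ->]].
  have [c Zc] := irreducible_sub_piece irr; exists c.
  by rewrite (maxZ _ (linear_piece_irreducible c) Zc).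
split; first exact: linear_piece_irreducible.
move=> Z1 irr cZ; have [d Zd] := irreducible_sub_piece irr.
apply/seteqP; split=> // x /Zd[Xx Ld]; split=> //.
by apply: (L_incomparable (piece_sub c d _)) => // y /cZ/Zd.
Qed.

End UnionOfLinearSpaces.

Import passmx.

(** * Plücker coordinates in codimension one *)

Section PluckerChart.
Variable k : fieldType.

Definition vcoords (V : vectType k) : {linear V -> 'rV[k]_(\dim {: V})} :=
  rVof (vbasis {: V}).

Lemma sum_single p (u : 'I_p -> k) (i0 : 'I_p) (c : k) :
  \sum_i u i * (c *+ (i == i0)) = c * u i0.
Proof.
rewrite (bigD1 i0) //= eqxx mulr1n big1 ?addr0 1?mulrC // => i /negPf->.
by rewrite mulr0.
Qed.

(** Each signed minor is, up to sign, the Plücker coordinate of an increasing choice of rows, and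
    each Plücker coordinate is a constant times one signed minor. Both transition matrices have at
    most one nonzero entry per column. *)
Lemma plucker_chart (V : vectType k) (P : set {vspace V}) :
  (0 < \dim {: V})%N ->
  @chart k (restrict (grassmannian V (\dim {: V}).-1) P) _ (normal (vcoords V)).
Proof.
move=> V0.
have E U s : @plucker k V (\dim {: V}).-1 U s =
    \det (rowsub (enum_val s) (hyperplane_frame (vcoords V) U)).
  by rewrite /plucker; congr (\det (rowsub _ _)); apply/matrixP => i j; rewrite !mxE.
split.
  exists (fun s (x : 'I_(\dim {: V})) =>
    (-1) ^+ x *+ (s == enum_rank [ffun j : 'I_(\dim {: V}).-1 => lift x j])) => U _.
  exists 1; rewrite ?oner_neq0 // => x; rewrite mul1r sum_single /= E enum_rankK.
  congr (_ * \det _); apply/matrixP => i j; rewrite !mxE.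
  by rewrite ffunE.
have h (s : {ffun 'I_(\dim {: V}).-1 -> 'I_(\dim {: V})}) :
    {xc : 'I_(\dim {: V}) * k | forall F, \det (rowsub s F) = xc.2 * signed_minor F xc.1}.
  by apply: cid; have [x [c e]] := minor_rowsub k s V0; exists (x, c).
exists (fun x s => (sval (h (enum_val s))).2 *+ (x == (sval (h (enum_val s))).1)) => U _.
exists 1; rewrite ?oner_neq0 // => s; rewrite mul1r sum_single /= E.
by case: (h _) => -[x c] /= ->.
Qed.

Definition cV_coords n : {linear 'cV[k]_n -> 'rV[k]_n} := @trmx k n 1.

(** The origin of the signs in the equations: the coordinates of [hyperplanes] are unsigned minors,
    the coefficients of the form are cofactors. *)
Lemma hyperplane_coordE n (A : {vspace 'cV[k]_n}) x :
  hyperplane_coord A x = (-1) ^+ x * normal (cV_coords n) A x.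
Proof.
rewrite /normal /signed_minor mulrA -expr2 sqrr_sign mul1r.
by congr (\det _); apply/matrixP => i j; rewrite !mxE.
Qed.

Lemma hyperplane_chart n (P : set {vspace 'cV[k]_n}) :
  @chart k (restrict (hyperplanes k n) P) _ (normal (cV_coords n)).
Proof.
split; exists (fun i j : 'I_n => (-1) ^+ i *+ (i == j)) => A _.
  exists 1; rewrite ?oner_neq0 // => x; rewrite mul1r.
  under eq_bigr => i _ do rewrite /= hyperplane_coordE.
  rewrite (bigD1 x) //= eqxx mulr1n mulrAC -expr2 sqrr_sign mul1r.
  by rewrite big1 ?addr0 // => i /negPf->; rewrite mulr0.
exists 1; rewrite ?oner_neq0 // => x; rewrite mul1r /= hyperplane_coordE.
rewrite (bigD1 x) //= eqxx mulr1n mulrC.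
by rewrite big1 ?addr0 // => i /negPf->; rewrite mulr0.
Qed.

Definition hyperplane_functional (V : vectType k) (A : {vspace V}) : 'Hom(V, k^o) :=
  linfun (pairing (vcoords V) (normal (vcoords V) A)).

Lemma vcoordsK (V : vectType k) : cancel (vcoords V) (vecof (vbasis {: V})).
Proof. exact: (rVofK (vbasisP fullv)). Qed.

Lemma vecofvK (V : vectType k) : cancel (vecof (vbasis {: V})) (vcoords V).
Proof. exact: (vecofK (vbasisP fullv)). Qed.

Lemma lker_hyperplane_functional (V : vectType k) (A : {vspace V}) :
  (0 < \dim {: V})%N -> \dim A = (\dim {: V}).-1 ->
  lker (hyperplane_functional A) = A.
Proof. by move=> V0 dA; apply: (lker_normal (@vcoordsK V) (@vecofvK V)). Qed.

Lemma hyperplane_functional_unique (V : vectType k) (A : {vspace V}) (g : 'Hom(V, k^o)) :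
  (0 < \dim {: V})%N -> \dim A = (\dim {: V}).-1 -> g != 0 -> (A <= lker g)%VS ->
  exists2 c : k, c != 0 & forall v, hyperplane_functional A v = c * g v :> k.
Proof.
move=> V0 dA g0 le.
have [c c0 h] := normal_unique (@vcoordsK V) (@vecofvK V) erefl V0 dA g0 le.
by exists c => // v; rewrite lfunE; apply: h.
Qed.

End PluckerChart.

(** * Quotients of path algebras *)

Section Ideals.
Variable R : pzRingType.
Implicit Types (I J S : set R).

Lemma two_sided_sum I (T : Type) (r : seq T) (P : pred T) (F : T -> R) :
  two_sided_ideal I -> (forall i, P i -> I (F i)) -> I (\sum_(i <- r | P i) F i).
Proof. by move=> [I0 ID _] h; elim/big_ind: _. Qed.

Lemma ideal_gen_two_sided S : two_sided_ideal (ideal_gen S).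
Proof.
split=> [I []//|x y hx hy I TI SI|a x hx].
  by have [_ ID _] := TI; apply: ID; [apply: hx | apply: hy].
by split=> I TI SI; have [_ _ /(_ a x)] := TI; case=> //; apply: hx.
Qed.

Lemma sub_ideal_gen S : S `<=` ideal_gen S.
Proof. by move=> x Sx I _; apply. Qed.

Lemma ideal_gen_sub S I : two_sided_ideal I -> S `<=` I -> ideal_gen S `<=` I.
Proof. by move=> TI SI x; apply. Qed.

Lemma ideal_exp_two_sided I n : two_sided_ideal (ideal_exp I n).
Proof. by case: n => [|n]; [split | apply: ideal_gen_two_sided]. Qed.

Lemma ideal_exp_expr I n x : I x -> ideal_exp I n (x ^+ n).
Proof.
move=> Ix; elim: n => [//|n IH]; rewrite exprSr.
by apply: sub_ideal_gen; exists (x ^+ n) => //; exists x.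
Qed.

Lemma ideal_exp1 I : two_sided_ideal I -> ideal_exp I 1 `<=` I.
Proof.
move=> TI; apply: ideal_gen_sub => // _ [x _] [y Iy] <-.
by have [_ _ /(_ x y Iy)[]] := TI.
Qed.

End Ideals.

Section BilinearIdentity.
Variables (k : fieldType) (A : algType k) (F a b a' b' : {linear A -> k^o}).

(** Common shape of the product rules of [path_chi] and [path_eta], which can then be checked on
    pairs of paths. The rule of [path_chi] has one product, and [path_zero] fills the second. *)
Definition bilinear_id (f g : A) : Prop :=
  F (f * g) = (a f : k) * b g + (a' f : k) * b' g.

Lemma bilinear_id_Dl f f' g :
  bilinear_id f g -> bilinear_id f' g -> bilinear_id (f + f') g.
Proof.
by rewrite /bilinear_id mulrDl !linearD /= => -> ->; rewrite !mulrDl addrACA.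
Qed.

Lemma bilinear_id_Zl c f g : bilinear_id f g -> bilinear_id (c *: f) g.
Proof.
rewrite /bilinear_id -scalerAl !linearZ /= => ->.
by rewrite /GRing.scale /= mulrDr !mulrA.
Qed.

Lemma bilinear_id_Dr f g g' :
  bilinear_id f g -> bilinear_id f g' -> bilinear_id f (g + g').
Proof.
by rewrite /bilinear_id mulrDr !linearD /= => -> ->; rewrite !mulrDr addrACA.
Qed.

Lemma bilinear_id_Zr c f g : bilinear_id f g -> bilinear_id f (c *: g).
Proof.
rewrite /bilinear_id -scalerAr !linearZ /= => ->.
by rewrite /GRing.scale /= mulrDr [c * (_ * _)]mulrCA [c * (a' _ * _)]mulrCA.
Qed.

End BilinearIdentity.

Section Residual.
Variables (k : fieldType) (M : lmodType k) (T : finType).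
Variables (c : T -> {linear M -> k^o}) (e : T -> M).

(** Kills the [e i] when the [c i] are dual to them, and fixes every f on which all [c i] vanish. An
    f without such coefficients is thus its own residual, and membership of residuals in an ideal
    can be tested on paths. *)
Definition residual (f : M) : M := f - \sum_i (c i f : k) *: e i.

Lemma residual_linear : linear residual.
Proof.
move=> a f g; rewrite /residual scalerBr addrACA -opprD; congr (_ - _).
rewrite scaler_sumr -big_split; apply: eq_bigr => i _ /=.
by rewrite linearP /= scalerDl scalerA.
Qed.

HB.instance Definition _ := GRing.isLinear.Build k M M *:%R residual residual_linear.

Lemma residual0 f : (forall i, c i f = 0 :> k) -> residual f = f.
Proof.
move=> h; rewrite /residual big1 ?subr0 // => i _.
by rewrite [X in (X : k) *: _]h scale0r.
Qed.

Lemma residual_basis i : (forall j, c j (e i) = (j == i)%:R :> k) -> residual (e i) = 0.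
Proof.
move=> h; rewrite /residual (bigD1 i) //= [X in (X : k) *: _]h eqxx scale1r.
rewrite big1 ?addr0 ?subrr // => j /negPf ne.
by rewrite [X in (X : k) *: _]h ne scale0r.
Qed.

End Residual.

(** * Coefficients of a path algebra element at vertices and arrows *)

Section PathAlgebraTruncation.
Variables (k : fieldType) (Q : quiver).
Local Notation kQ := (path_algebra k Q).
Local Notation J := (arrow_ideal k Q).
Implicit Types (f g : kQ) (p : qpath Q) (v : vertex Q) (a : arrow Q).

Lemma path_ind (P : kQ -> Prop) :
  (forall f g, P f -> P g -> P (f + g)) -> (forall c f, P f -> P (c *: f)) ->
  (forall p, P (path_elt k p)) -> forall f, P f.
Proof.
move=> PD PZ PE f.
have [u _] := card_gt0P (vertex_gt0 Q).
have P0 : P 0 by rewrite -(scale0r (path_elt k (vertex_path u))); apply/PZ/PE.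
have -> : f = path_lift (path_elt k) f.
  apply: (@path_ext k Q _ idfun (path_lift (path_elt k))) => p /=.
  by rewrite path_lift_elt.
rewrite /path_lift.
by elim/big_ind: _ => // p _; apply/PZ/PE.
Qed.

Definition path_chi v : {linear kQ -> k^o} :=
  path_lift (fun p => (qpath_val p == (v, [::]))%:R : k^o).

(** The list of arrows alone suffices: the walk condition forces the start of a path of length
    one. *)
Definition path_eta a : {linear kQ -> k^o} :=
  path_lift (fun p => ((qpath_val p).2 == [:: a])%:R : k^o).

Definition path_zero : {linear kQ -> k^o} := path_lift (fun=> 0 : k^o).

Lemma path_zeroE f : path_zero f = 0 :> k.
Proof. by rewrite /= /path_lift big1 // => p _; rewrite scaler0. Qed.

Lemma path_chi_elt v p :
  path_chi v (path_elt k p) = (qpath_val p == (v, [::]))%:R :> k.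
Proof. by rewrite /= path_lift_elt. Qed.

Lemma path_eta_elt a p :
  path_eta a (path_elt k p) = ((qpath_val p).2 == [:: a])%:R :> k.
Proof. by rewrite /= path_lift_elt. Qed.

Lemma path_chi0 v : path_chi v 0 = 0 :> k.
Proof. by rewrite linear0. Qed.

Lemma path_eta0 a : path_eta a 0 = 0 :> k.
Proof. by rewrite linear0. Qed.

Lemma path_bilinear_id (F a b a' b' : {linear kQ -> k^o}) :
  (forall p q, bilinear_id F a b a' b' (path_elt k p) (path_elt k q)) ->
  forall f g, bilinear_id F a b a' b' f g.
Proof.
move=> h; apply: path_ind => [f f' hf hf' g|c f hf g|p].
- exact: bilinear_id_Dl.
- exact: bilinear_id_Zl.
apply: path_ind => [g g' hg hg'|c g hg|q //].
- exact: bilinear_id_Dr.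
- exact: bilinear_id_Zr.
Qed.

Lemma path_eltM p q : path_elt k p * path_elt k q = opath_elt k (qcomp p q).
Proof. exact: path_mul_elt. Qed.

(** A concatenation is the trivial path at v exactly when both factors are. *)
Lemma path_chiM v f g : path_chi v (f * g) = (path_chi v f : k) * path_chi v g.
Proof.
suff -> : path_chi v (f * g) = (path_chi v f : k) * path_chi v g +
    (path_zero f : k) * path_zero g by rewrite !path_zeroE mulr0 addr0.
apply: (path_bilinear_id (F := path_chi v)) => {f g} p q; rewrite /bilinear_id.
have z (f : kQ) : path_zero f = 0 :> k := path_zeroE f.
have := path_chi_elt v q; have := path_chi_elt v p; have := path_eltM p q.
move: (path_elt k p) (path_elt k q) => P P' -> eP eP'.
rewrite z [path_zero P']z mulr0 addr0 eP eP' -natrM mulnb.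
have [pq|npq] := eqVneq (qtarget p) (qsource q); last first.
  rewrite qcomp_None // [opath_elt _ _]/= path_chi0.
  rewrite [_ && _](_ : _ = false) //; apply/negbTE; apply: contraNN npq.
  by move=> /andP[/eqP pv /eqP qv]; rewrite /qtarget /qsource pv qv eqxx.
have [r -> rE] := qcompP pq; rewrite [opath_elt _ _]/= path_chi_elt rE; congr (_%:R).
move: pq; rewrite /qtarget /qsource /walk_end.
case: (qpath_val p) => u s; case: (qpath_val q) => w t /=.
case: s => [|b s] /=; first by move=> ->; case: t => [|d t]; rewrite ?andbb // andbC
  !xpair_eqE !andbF.
by move=> _; rewrite !xpair_eqE !andbF.
Qed.

(** The path of an arrow splits in two ways only: trivial path at its source followed by the arrow,
    or the arrow followed by the trivial path at its target. *)
Lemma path_etaM a f g : path_eta a (f * g) =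
  (path_chi (src a) f : k) * path_eta a g + (path_eta a f : k) * path_chi (tgt a) g.
Proof.
apply: (path_bilinear_id (F := path_eta a)) => {f g} p q; rewrite /bilinear_id.
have := path_chi_elt (tgt a) q; have := path_chi_elt (src a) p.
have := path_eta_elt a q; have := path_eta_elt a p; have := path_eltM p q.
move: (path_elt k p) (path_elt k q) => P P' -> -> -> -> ->.
rewrite -2!natrM -natrD 2!mulnb.
have [pq|npq] := eqVneq (qtarget p) (qsource q); last first.
  rewrite qcomp_None // [opath_elt _ _]/= path_eta0.
  rewrite [X in (X + _)%N](_ : _ = 0%N) ?[X in (_ + X)%N](_ : _ = 0%N) //.
    apply/eqP; rewrite eqb0; apply: contraNN npq.
    move: (qpath_valP p) (qpath_valP q); rewrite /qtarget /qsource /walk_end.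
    case: (qpath_val p) => u s; case: (qpath_val q) => w t /= sP tP.
    by move=> /andP[/eqP -> /eqP[-> _]].
  apply/eqP; rewrite eqb0; apply: contraNN npq.
  move: (qpath_valP p) (qpath_valP q); rewrite /qtarget /qsource /walk_end.
  case: (qpath_val p) => u s; case: (qpath_val q) => w t /= sP tP.
  by move=> /andP[/eqP[-> ->] /eqP tE]; move: tP; rewrite tE /= andbT eq_sym.
have [r -> rE] := qcompP pq; rewrite [opath_elt _ _]/= path_eta_elt rE; congr (_%:R).
move: pq (qpath_valP p) (qpath_valP q); rewrite /qtarget /qsource /walk_end.
case: (qpath_val p) => u s; case: (qpath_val q) => w t /=.
case: s => [|b s]; case: t => [|d t] //=; rewrite ?andbF ?cats0 ?andbT ?addn0 //.
- move=> -> _ /andP[/eqP <- _]; rewrite xpair_eqE.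
  by case: (eqVneq (d :: t) [:: a]) => [[-> _]|_]; rewrite ?eqxx ?andbF.
- move=> <- _ _; rewrite xpair_eqE.
  by case: (eqVneq (b :: s) [:: a]) => [[-> ->]|_]; rewrite ?eqxx.
- move=> _ _ _; rewrite !xpair_eqE !andbF !eqseq_cons.
  by case: s => [|? ?]; rewrite ?andbF.
Qed.

Lemma path_chi1 v : path_chi v 1 = 1 :> k.
Proof.
rewrite [X in path_chi v X](_ : _ = \sum_u path_elt k (vertex_path u)) //.
rewrite linear_sum (bigD1 v) //= [X in X + _]path_chi_elt /= eqxx.
rewrite big1 ?addr0 // => u /negPf ne; rewrite path_lift_elt /=.
by rewrite xpair_eqE ne.
Qed.

Lemma arrow_ideal_two_sided : two_sided_ideal J.
Proof. exact: ideal_gen_two_sided. Qed.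

Lemma arrow_ideal_cons v a w (h : walk v (a :: w)) :
  J (path_elt k (QPath (Q := Q) (qpath_val := (v, a :: w)) h)).
Proof.
have /andP[/eqP e hw] : (src a == v) && walk (tgt a) w by exact: h.
pose q := QPath (Q := Q) (qpath_val := (tgt a, w)) hw.
have [r rS rE] := @qcompP Q (arrow_path a) q erefl.
have -> : QPath (Q := Q) (qpath_val := (v, a :: w)) h = r.
  by apply: val_inj; rewrite /= rE /= /qsource /= e.
have := path_eltM (arrow_path a) q; rewrite rS /= => <-.
have [_ _ JM] := arrow_ideal_two_sided.
apply: (proj2 (JM _ _ _)); apply: sub_ideal_gen.
by exists a.
Qed.

Lemma two_sidedZ (A : algType k) (I : set A) c x : two_sided_ideal I -> I x -> I (c *: x).
Proof. by move=> [_ _ IM] /(IM (c%:A))[]; rewrite mulr_algl. Qed.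

Lemma path_chi_arrow_ideal v f : J f -> path_chi v f = 0 :> k.
Proof.
pose K : set kQ := [set f | forall v, path_chi v f = 0 :> k].
suff sub : J `<=` K by move=> /sub; apply.
apply: ideal_gen_sub => [|_ [a _ <-] u]; last first.
  by rewrite path_chi_elt xpair_eqE andbF.
split=> [u|x y hx hy u|x y hy]; first by rewrite linear0.
  by rewrite linearD /= hx hy addr0.
by split=> u; rewrite path_chiM hy ?mulr0 ?mul0r.
Qed.

Lemma path_residual (I : set kQ) (D : {linear kQ -> kQ}) : two_sided_ideal I ->
  (forall p, I (D (path_elt k p))) -> forall f, I (D f).
Proof.
move=> TI h; apply: path_ind => // [f g hf hg|c f hf].
  by rewrite linearD; case: TI => _ ID _; apply: ID.
by rewrite linearZ; apply: two_sidedZ.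
Qed.

Definition path_vertex v := path_elt k (vertex_path v).
Definition path_arrow a := path_elt k (arrow_path a).

Lemma path_chi_vertex v u : path_chi v (path_vertex u) = (v == u)%:R :> k.
Proof. by rewrite path_chi_elt /= xpair_eqE andbT eq_sym. Qed.

Lemma path_chi_arrow v a : path_chi v (path_arrow a) = 0 :> k.
Proof. by rewrite path_chi_elt /= xpair_eqE andbF. Qed.

Lemma path_eta_vertex a u : path_eta a (path_vertex u) = 0 :> k.
Proof. by rewrite path_eta_elt. Qed.

Lemma path_eta_arrow a b : path_eta a (path_arrow b) = (a == b)%:R :> k.
Proof. by rewrite path_eta_elt /= eqseq_cons andbT eq_sym. Qed.

Lemma path_trunc1 f : J (residual path_chi path_vertex f).
Proof.
have TJ := arrow_ideal_two_sided; have [J0 _ _] := TJ.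
apply: (path_residual (D := residual path_chi path_vertex) TJ) => p.
case: p => -[u [|a w]] /= h.
  rewrite (_ : QPath _ = vertex_path u); last exact: val_inj.
  by rewrite [residual _ _ _]residual_basis // => v; apply: path_chi_vertex.
rewrite residual0; first exact: arrow_ideal_cons.
by move=> v; rewrite path_chi_elt /= xpair_eqE andbF.
Qed.

Lemma arrow_idealE f : J f <-> forall v, path_chi v f = 0 :> k.
Proof.
split=> [Jf v|h]; first exact: path_chi_arrow_ideal.
by have := path_trunc1 f; rewrite residual0.
Qed.

(** The product rules make the common kernel an ideal containing all products of two elements of J.
    Conversely an element of that kernel equals what is left after removing its vertices and arrows,
    and a path of length at least two is an arrow times a path of positive length. *)
Lemma arrow_ideal2E f : ideal_exp J 2 f <->
  (forall v, path_chi v f = 0 :> k) /\ (forall a, path_eta a f = 0 :> k).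
Proof.
pose K : set kQ := [set f | (forall v, path_chi v f = 0 :> k) /\
  (forall a, path_eta a f = 0 :> k)].
split=> [|[h1 h2]].
  suff sub : ideal_exp J 2 `<=` K by move=> /sub.
  apply: ideal_gen_sub => [|_ [f' /(ideal_exp1 arrow_ideal_two_sided) Jf'] [g Jg] <-].
    split=> [|x y [x1 x2] [y1 y2]|x y [y1 y2]].
    - by split=> u; rewrite linear0.
    - by split=> u; rewrite linearD /= ?x1 ?y1 ?x2 ?y2 addr0.
    split; split=> u; rewrite ?path_chiM ?path_etaM ?y1 ?y2 ?mulr0 ?mul0r ?addr0 //.
  move: Jf' Jg; rewrite !arrow_idealE => f0 g0.
  split=> u; rewrite ?path_chiM ?path_etaM; first by rewrite f0 mul0r.
  by rewrite f0 g0 mul0r mulr0 addr0.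
pose D : {linear kQ -> kQ} :=
  residual path_eta path_arrow \o residual path_chi path_vertex.
suff main : ideal_exp J 2 (D f) by move: main; rewrite /= !residual0 // residual0.
have TJ := ideal_exp_two_sided J 2; have [J0 JD _] := TJ.
apply: (path_residual (D := D)) => // p; rewrite /D [_ (path_elt _ _)]/=.
case: p => -[u [|a [|b w]]] /= h.
- rewrite (_ : QPath _ = vertex_path u); last exact: val_inj.
  rewrite [residual path_chi _ _]residual_basis ?linear0 // => v.
  exact: path_chi_vertex.
- rewrite (_ : QPath _ = arrow_path a); last first.
    by apply: val_inj; move: h => /= /andP[/eqP ->].
  rewrite [residual path_chi _ _]residual0 => [|v]; last exact: path_chi_arrow.
  by rewrite [residual _ _ _]residual_basis // => b; apply: path_eta_arrow.
rewrite [residual path_chi _ _]residual0; last first.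
  by move=> v; rewrite path_chi_elt /= xpair_eqE andbF.
rewrite residual0; last first.
  by move=> d; rewrite path_eta_elt /= eqseq_cons andbF.
have /andP[/eqP e hw] : (src a == u) && walk (tgt a) (b :: w) by exact: h.
pose q := QPath (Q := Q) (qpath_val := (tgt a, b :: w)) hw.
have [r rS rE] := @qcompP Q (arrow_path a) q erefl.
have -> : QPath (Q := Q) (qpath_val := (u, [:: a, b & w])) h = r.
  by apply: val_inj; rewrite /= rE /= /qsource /= e.
have := path_eltM (arrow_path a) q; rewrite rS /= => <-.
apply: sub_ideal_gen; exists (path_elt k (arrow_path a)); last first.
  by exists (path_elt k q) => //; apply: arrow_ideal_cons.
(* [ideal_exp J 1] is the product of the whole ring with J, so the arrow enters as 1 times
   itself. *)
apply: sub_ideal_gen; exists 1 => //; exists (path_elt k (arrow_path a)).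
  by apply: sub_ideal_gen; exists a.
by rewrite mul1r.
Qed.

End PathAlgebraTruncation.

(* The coordinates of the class of an element of [B] in [B / J(B)^2], whose
   basis is given by the vertices and the arrows of the quiver of [B]. *)
Record truncation (k : fieldType) (Q : quiver) (B : falgType k)
    (E : vertex Q -> B) (X : arrow Q -> B) := Truncation {
  vcoef : vertex Q -> {linear B -> k^o};
  acoef : arrow Q -> {linear B -> k^o};
  vcoef1 : forall v, vcoef v 1 = 1 :> k;
  vcoefM : forall v x y, vcoef v (x * y) = (vcoef v x : k) * vcoef v y;
  acoefM : forall a x y, acoef a (x * y) =
    (vcoef (src a) x : k) * acoef a y + (acoef a x : k) * vcoef (tgt a) y;
  vcoef_vertex : forall v u, vcoef v (E u) = (v == u)%:R :> k;
  vcoef_arrow : forall v a, vcoef v (X a) = 0 :> k;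
  acoef_vertex : forall a u, acoef a (E u) = 0 :> k;
  acoef_arrow : forall a b, acoef a (X b) = (a == b)%:R :> k;
  sum_vertex : \sum_v E v = 1;
  memJ : forall x, x \in jacobson B <-> forall v, vcoef v x = 0 :> k;
  memJ2 : forall x, x \in (jacobson B * jacobson B)%VS <->
    (forall v, vcoef v x = 0 :> k) /\ forall a, acoef a x = 0 :> k;
  nilJ : forall x, x \in jacobson B -> exists l, x ^+ l = 0 }.

(** * The Jacobson radical of an admissible quotient *)

Section Quotient.
Variables (k : fieldType) (Q : quiver) (I : set (path_algebra k Q)).
Hypothesis admI : admissible I.
Variables (B : falgType k) (pi : {lrmorphism path_algebra k Q -> B}).
Hypothesis piP : is_quotient I pi.
Local Notation kQ := (path_algebra k Q).
Local Notation J := (arrow_ideal k Q).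

Definition section_of (b : B) : kQ := sval (cid (piP.1 b)).

Lemma section_ofK b : pi (section_of b) = b.
Proof. by rewrite /section_of; case: cid. Qed.

(** A linear map killing I does not see which preimage was chosen; this makes [descend] linear
    although [section_of] need not be. *)
Lemma section_of_pi (M : lmodType k) (F : {linear kQ -> M}) :
  (forall f, I f -> F f = 0) -> forall f, F (section_of (pi f)) = F f.
Proof.
move=> h f; apply/eqP; rewrite -subr_eq0 -linearB; apply/eqP/h/(piP.2 _).
by rewrite linearB /= section_ofK subrr.
Qed.

Definition descend (M : lmodType k) (F : {linear kQ -> M}) (b : B) : M :=
  F (section_of b).

Lemma descend_linear (M : lmodType k) (F : {linear kQ -> M}) :
  (forall f, I f -> F f = 0) -> linear (descend F).
Proof.
move=> h c x y; rewrite /descend -{1}[x]section_ofK -{1}[y]section_ofK.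
by rewrite -linearZ -linearD section_of_pi // linearP.
Qed.

Lemma descend_lin (M : lmodType k) (F : {linear kQ -> M}) :
  (forall f, I f -> F f = 0) -> {G : {linear B -> M} | forall f, G (pi f) = F f}.
Proof.
move=> h.
pose H := GRing.isLinear.Build k B M *:%R (descend F) (descend_linear h).
pose G : {linear B -> M} := HB.pack (descend F) H.
by exists G => f; apply: section_of_pi.
Qed.

Lemma descend_lrmorphism (A : algType k) (F : {lrmorphism kQ -> A}) :
  (forall f, I f -> F f = 0) ->
  exists G : {lrmorphism B -> A}, forall f, G (pi f) = F f.
Proof.
move=> h; have [G GE] := descend_lin h.
have mG : monoid_morphism G.
  split=> [|x y]; first by rewrite -(rmorph1 pi) GE rmorph1.
  by rewrite -[x]section_ofK -[y]section_ofK -rmorphM !GE rmorphM.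
pose H := GRing.isMonoidMorphism.Build B A G mG.
pose H' := GRing.isLinear.Build k B A *:%R G (GRing.linearP G).
pose G' : {lrmorphism B -> A} := HB.pack (G : B -> A) H H'.
by exists G'.
Qed.

Lemma admissible_chi v f : I f -> path_chi k v f = 0.
Proof. by case: admI => _ sub _ /sub/arrow_ideal2E[]. Qed.

Lemma admissible_eta a f : I f -> path_eta k a f = 0.
Proof. by case: admI => _ sub _ /sub/arrow_ideal2E[]. Qed.

Lemma subv_capvs (U : {vspace B}) (F : set {vspace B}) :
  (forall W, F W -> (U <= W)%VS) -> (U <= capvs F)%VS.
Proof. by move=> h; apply/subvP => x Ux; apply/memv_capvs => W /h/subvP; apply. Qed.

Lemma nilpotent_left_inverse (x : B) l : x ^+ l = 0 -> exists y, y * (1 - x) = 1.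
Proof.
move=> xl; exists (\sum_(i < l) x ^+ i).
have := subrX1 x l; rewrite xl sub0r => /(congr1 -%R); rewrite opprK -mulNr opprB => e.
rewrite [RHS]e.
apply: commr_sym; apply: commr_sum => i _; apply: commrX; apply: commr_sym.
by apply: commrB; [apply: commr1 | apply: commr_refl].
Qed.

(** The coefficients at vertices and arrows descend to B because I lies in the square of the arrow
    ideal. The radical is the common kernel K of the vertex coefficients: each of these is a
    character, whose kernel is a maximal left ideal, and K is nil since a power of the arrow ideal
    lies in I. *)
Lemma quotient_truncation :
  {D : truncation (vertex_elt pi) (arrow_elt pi) |
    (forall v f, vcoef D v (pi f) = path_chi k v f) /\
    (forall a f, acoef D a (pi f) = path_eta k a f)}.
Proof.
have hchi v := svalP (descend_lin (admissible_chi v)).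
have heta a := svalP (descend_lin (admissible_eta a)).
pose chi v := sval (descend_lin (admissible_chi v)).
pose eta a := sval (descend_lin (admissible_eta a)).
have sect b : exists f, b = pi f by have [f] := piP.1 b; exists f.
have chi1 v : chi v 1 = 1 :> k by rewrite -(rmorph1 pi) /chi hchi path_chi1.
have chiM v x y : chi v (x * y) = (chi v x : k) * chi v y.
  by have [f ->] := sect x; have [g ->] := sect y; rewrite -rmorphM /chi !hchi path_chiM.
have etaM a x y : eta a (x * y) =
    (chi (src a) x : k) * eta a y + (eta a x : k) * chi (tgt a) y.
  have [f ->] := sect x; have [g ->] := sect y.
  by rewrite -rmorphM /chi /eta !hchi !heta path_etaM.
have chi_v v u : chi v (vertex_elt pi u) = (v == u)%:R :> k.
  by rewrite /chi hchi; apply: path_chi_vertex.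
have chi_a v a : chi v (arrow_elt pi a) = 0 :> k.
  by rewrite /chi hchi; apply: path_chi_arrow.
have eta_v a u : eta a (vertex_elt pi u) = 0 :> k.
  by rewrite /eta heta; apply: path_eta_vertex.
have eta_a a b : eta a (arrow_elt pi b) = (a == b)%:R :> k.
  by rewrite /eta heta; apply: path_eta_arrow.
have sumE : \sum_v vertex_elt pi v = 1 by rewrite -(rmorph1 pi) -raddf_sum.
pose K := capvs [set lker (linfun (chi v)) | v in [set: vertex Q]].
have memK x : x \in K <-> forall v, chi v x = 0 :> k.
  split=> [/memv_capvs h v|h].
    have /h : [set lker (linfun (chi v)) | v in [set: vertex Q]] (lker (linfun (chi v))).
      by exists v.
    by rewrite memv_ker lfunE => /eqP.
  by apply/memv_capvs => _ [v _ <-]; rewrite memv_ker lfunE; apply/eqP/h.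
have nilK x : x \in K -> exists l, x ^+ l = 0.
  have [f ->] := sect x => /memK fK.
  have [_ _ [l _ hl]] := admI; exists l; rewrite -rmorphXn; apply/(piP.2 _)/hl.
  by apply: ideal_exp_expr; apply/arrow_idealE => v; rewrite -hchi; apply: fK.
have idlK b x : x \in K -> b * x \in K /\ x * b \in K.
  by move=> /memK xK; split; apply/memK => v; rewrite chiM xK ?mulr0 ?mul0r.
have jacK : jacobson B = K.
  apply/eqP; rewrite eqEsubv; apply/andP; split; last first.
    apply: subv_capvs => W [lW nW maxW].
    (* If W + K were everything, 1 - n would lie in W for some nilpotent n, and its left inverse
       would bring 1 into W. Otherwise maximality gives W + K = W. *)
    have [e|ne] := eqVneq (W + K)%VS fullv.
      case/negP: nW; have : 1 \in (W + K)%VS by rewrite e memvf.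
      case/memv_addP => w wW [n nK one].
      have [l /nilpotent_left_inverse[y y1]] := nilK n nK.
      have W1 : 1 \in W.
        rewrite -y1 one addrK; apply: (subvP lW); apply: memv_mul => //.
        exact: memvf.
      rewrite eqEsubv subvf; apply/subvP => b _; rewrite -[b]mulr1.
      by apply: (subvP lW); apply: memv_mul => //; apply: memvf.
    rewrite -(maxW _ _ (addvSl W K) ne) ?addvSr //.
    apply/prodvP => b x _ /memv_addP[w wW [n nK ->]]; rewrite mulrDr memv_add //.
      by apply: (subvP lW); apply: memv_mul => //; apply: memvf.
    by case: (idlK b n nK).
  apply: subv_capvs => _ [v _ <-]; apply/subvP => x /memv_capvs; apply.
  have nz : linfun (chi v) != 0.
    apply/eqP => /lfunP/(_ 1)/eqP; rewrite !lfunE /= chi1.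
    exact/negP/oner_neq0.
  have dimL := dim_lker_functional nz.
  split.
  - apply/prodvP => b y _; rewrite !memv_ker !lfunE /= => /eqP y0.
    by rewrite chiM y0 mulr0.
  - by apply/eqP => e; move: dimL; rewrite e => /eqP; rewrite eqn_leq ltnn.
  move=> W lW sW nW; apply/esym/eqP; rewrite eqEdim sW /= -ltnS dimL.
  by rewrite ltn_neqAle dimvS ?subvf // andbT; apply: contraNN nW => /eqP e;
    rewrite eqEdim subvf e leqnn.
have memJ x : x \in jacobson B <-> forall v, chi v x = 0 :> k by rewrite jacK.
have jacM : (fullv * jacobson B <= jacobson B)%VS.
  by apply/prodvP => b x _; rewrite jacK => /(idlK b)[].
have jacMr : (jacobson B * fullv <= jacobson B)%VS.
  by apply/prodvP => x b + _; rewrite jacK => /(idlK b)[].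
(* The square of the radical is pulled back to the path algebra, where the universal property of the
   generated ideal applies. *)
have J2_ideal : two_sided_ideal [set f : kQ | pi f \in (jacobson B * jacobson B)%VS].
  split=> [|x y /= xJ yJ|a x /= xJ].
  - suff : pi 0 \in (jacobson B * jacobson B)%VS by [].
    by rewrite (rmorph0 pi) mem0v.
  - suff : pi (x + y) \in (jacobson B * jacobson B)%VS by [].
    by rewrite (rmorphD pi) memvD.
  have l : pi (a * x) \in (jacobson B * jacobson B)%VS.
    by rewrite (rmorphM pi); apply: (subvP (prodvSl _ jacM)); rewrite -prodvA memv_mul ?memvf.
  have r : pi (x * a) \in (jacobson B * jacobson B)%VS.
    by rewrite (rmorphM pi); apply: (subvP (prodvSr _ jacMr)); rewrite prodvA memv_mul ?memvf.
  exact: (conj l r).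
have memJ2 x : x \in (jacobson B * jacobson B)%VS <->
    (forall v, chi v x = 0 :> k) /\ forall a, eta a x = 0 :> k.
  split=> [|[x1 x2]].
    pose T := capvs ([set lker (linfun (chi v)) | v in [set: vertex Q]] `|`
                     [set lker (linfun (eta a)) | a in [set: arrow Q]]).
    have sT : (jacobson B * jacobson B <= T)%VS.
      apply/prodvP => y z /memJ y0 /memJ z0; apply/memv_capvs => W.
      case=> -[u _ <-]; rewrite memv_ker lfunE /=; apply/eqP.
        by rewrite chiM y0 mul0r.
      by rewrite etaM y0 z0 mulr0 mul0r addr0.
    move=> /(subvP sT)/memv_capvs h; split=> u.
      have : x \in lker (linfun (chi u)) by apply: h; left; exists u.
      by rewrite memv_ker lfunE => /eqP.
    have : x \in lker (linfun (eta u)) by apply: h; right; exists u.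
    by rewrite memv_ker lfunE => /eqP.
  have [f fE] := sect x; rewrite fE.
  have : ideal_exp J 2 f.
    by apply/arrow_ideal2E; split=> u; [rewrite -hchi -fE x1 | rewrite -heta -fE x2].
  suff sub : ideal_exp J 2 `<=` [set f : kQ | pi f \in (jacobson B * jacobson B)%VS].
    by move=> /sub.
  apply: ideal_gen_sub => // _ [g /(ideal_exp1 (@arrow_ideal_two_sided k Q)) Jg] [h Jh] <- /=.
  rewrite rmorphM memv_mul //; apply/memJ => v; rewrite /chi hchi;
    exact: path_chi_arrow_ideal.
have nilJ x : x \in jacobson B -> exists l, x ^+ l = 0 by rewrite jacK; apply: nilK.
exists (@Truncation k Q B (vertex_elt pi) (arrow_elt pi) chi eta chi1 chiM etaM
  chi_v chi_a eta_v eta_a sumE memJ memJ2 nilJ).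
by split=> [v f|a f]; [apply: hchi | apply: heta].
Qed.

End Quotient.

Lemma admissible_arrow_ideal2 (k : fieldType) (Q : quiver) :
  admissible (ideal_exp (arrow_ideal k Q) 2).
Proof. by split; [apply: ideal_exp_two_sided | | exists 2%N]. Qed.

(** * Subalgebras of codimension one *)

Section CodimensionOne.
Variables (k : fieldType) (Q : quiver) (B : falgType k).
Variables (E : vertex Q -> B) (X : arrow Q -> B) (D : truncation E X).
Local Notation J := (jacobson B).
Local Notation J2 := (jacobson B * jacobson B)%VS.
Implicit Types (f : 'Hom(B, k^o)) (s t u v : vertex Q) (a : arrow Q).

Definition kills_J2 f : Prop := forall x, x \in J2 -> f x = 0 :> k.

Definition supported s t f : Prop :=
  (forall u, u != s -> u != t -> f (E u) = 0 :> k) /\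
  (forall a, ~~ arrow_from_to s t a -> f (X a) = 0 :> k).

Lemma mem_kernel f x : (x \in lker f) = (f x == 0 :> k).
Proof. by rewrite memv_ker. Qed.

Lemma functionalB f x y : f (x - y) = (f x : k) - (f y : k) :> k.
Proof. by rewrite linearB. Qed.

Lemma functionalZ f (c : k) x : f (c *: x) = c * (f x : k) :> k.
Proof. by rewrite linearZ. Qed.

Lemma truncation_rest x :
  x - \sum_v (vcoef D v x : k) *: E v - \sum_a (acoef D a x : k) *: X a \in J2.
Proof.
apply/(memJ2 D); split=> u.
  rewrite 2!linearB !(linear_sum (vcoef D u)) /= [X in _ - X]big1 => [|a _]; last first.
    by rewrite linearZ /= vcoef_arrow [_ *: _]mulr0.
  rewrite subr0 (bigD1 u) //= big1 => [|v /negPf ne].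
    by rewrite addr0 linearZ /= vcoef_vertex eqxx [_ *: _]mulr1 subrr.
  by rewrite linearZ /= vcoef_vertex eq_sym ne [_ *: _]mulr0.
rewrite 2!linearB !(linear_sum (acoef D u)) /= [X in _ - X - _]big1 => [|v _]; last first.
  by rewrite linearZ /= acoef_vertex [_ *: _]mulr0.
rewrite subr0 (bigD1 u) //= big1 => [|v /negPf ne].
  by rewrite addr0 linearZ /= acoef_arrow eqxx [_ *: _]mulr1 subrr.
by rewrite linearZ /= acoef_arrow eq_sym ne [_ *: _]mulr0.
Qed.

Lemma functionalE f x : kills_J2 f -> f x =
  \sum_v (vcoef D v x : k) * (f (E v) : k) + \sum_a (acoef D a x : k) * (f (X a) : k) :> k.
Proof.
move=> fJ; have := fJ _ (truncation_rest x); rewrite 2!linearB !(linear_sum f) /=.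
move/eqP; rewrite -addrA -opprD subr_eq0 => /eqP ->.
by congr (_ + _); apply: eq_bigr => i _; rewrite linearZ.
Qed.

Lemma functional_ext f g : kills_J2 f -> kills_J2 g ->
  (forall v, f (E v) = g (E v)) -> (forall a, f (X a) = g (X a)) -> f = g.
Proof.
move=> fJ gJ ev ea; apply/lfunP => x; rewrite [LHS](functionalE x fJ).
rewrite [RHS](functionalE x gJ).
by congr (_ + _); apply: eq_bigr => i _; rewrite ?ev ?ea.
Qed.

Lemma functional1 f : f 1 = \sum_v (f (E v) : k) :> k.
Proof. by rewrite -(sum_vertex D) linear_sum. Qed.

Lemma functional_vertexM f u v : kills_J2 f ->
  f (E u * E v) = (u == v)%:R * (f (E u) : k) :> k.
Proof.
move=> fJ; rewrite functionalE // [X in _ + X]big1 => [|a _]; last first.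
  by rewrite acoefM !acoef_vertex mulr0 !mul0r addr0 mul0r.
rewrite addr0 (bigD1 u) //= big1 => [|w /negPf ne].
  by rewrite vcoefM !vcoef_vertex eqxx mul1r addr0.
by rewrite vcoefM vcoef_vertex ne !mul0r.
Qed.

Lemma functional_vertex_arrow f u a : kills_J2 f ->
  f (E u * X a) = (src a == u)%:R * (f (X a) : k) :> k.
Proof.
move=> fJ; rewrite functionalE // [X in X + _]big1 => [|v _]; last first.
  by rewrite vcoefM vcoef_arrow mulr0 mul0r.
rewrite add0r (bigD1 a) //= big1 => [|b /negPf ne].
  by rewrite acoefM acoef_arrow acoef_vertex vcoef_vertex eqxx mul0r mulr1 !addr0.
by rewrite acoefM acoef_arrow acoef_vertex ne mul0r mulr0 addr0 mul0r.
Qed.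

Lemma functional_arrow_vertex f u a : kills_J2 f ->
  f (X a * E u) = (tgt a == u)%:R * (f (X a) : k) :> k.
Proof.
move=> fJ; rewrite functionalE // [X in X + _]big1 => [|v _]; last first.
  by rewrite vcoefM vcoef_arrow mul0r mul0r.
rewrite add0r (bigD1 a) //= big1 => [|b /negPf ne].
  by rewrite acoefM acoef_arrow acoef_vertex vcoef_vertex eqxx mulr0 mul1r add0r addr0.
by rewrite acoefM acoef_arrow acoef_vertex ne mul0r mulr0 addr0 mul0r.
Qed.

Lemma functional_arrowM f a b : kills_J2 f -> f (X a * X b) = 0 :> k.
Proof.
by move=> fJ; apply/fJ/memv_mul; apply/(memJ D) => v; apply: vcoef_arrow.
Qed.

Definition functional_of (x : vertex Q -> k) (y : arrow Q -> k) : 'Hom(B, k^o) :=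
  (\sum_v x v *: linfun (vcoef D v) + \sum_a y a *: linfun (acoef D a))%VF.

Lemma functional_of_evalE x y b : functional_of x y b =
  \sum_v x v * (vcoef D v b : k) + \sum_a y a * (acoef D a b : k) :> k.
Proof.
rewrite /functional_of add_lfunE !sum_lfunE.
by congr (_ + _); apply: eq_bigr => i _; rewrite scale_lfunE lfunE.
Qed.

Lemma functional_of_vertex x y v : functional_of x y (E v) = x v :> k.
Proof.
rewrite functional_of_evalE [X in _ + X]big1 ?addr0 => [|a _]; last first.
  by rewrite acoef_vertex mulr0.
rewrite (bigD1 v) //= big1 => [|u /negPf ne]; rewrite vcoef_vertex.
  by rewrite eqxx mulr1 addr0.
by rewrite ne mulr0.
Qed.

Lemma functional_of_arrow x y a : functional_of x y (X a) = y a :> k.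
Proof.
rewrite functional_of_evalE [X in X + _]big1 ?add0r => [|v _]; last first.
  by rewrite vcoef_arrow mulr0.
rewrite (bigD1 a) //= big1 => [|b /negPf ne]; rewrite acoef_arrow.
  by rewrite eqxx mulr1 addr0.
by rewrite ne mulr0.
Qed.

Lemma functional_of_J2 x y : kills_J2 (functional_of x y).
Proof.
move=> b /(memJ2 D)[b1 b2]; rewrite functional_of_evalE.
by rewrite !big1 ?addr0 // => i _; rewrite ?b1 ?b2 mulr0.
Qed.

(** Vanishing on the unit makes the values at s and t opposite when s and t differ, and forces the
    single remaining value to be 0 when s = t. *)
Lemma supported_sum f s t (c : vertex Q -> k) : f 1 = 0 :> k -> supported s t f ->
  \sum_v c v * (f (E v) : k) = (c s - c t) * (f (E s) : k).
Proof.
move=> f1 [fE _]; rewrite functional1 in f1.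
have [est|nst] := eqVneq s t.
  rewrite -est subrr mul0r.
  have fs : f (E s) = 0 :> k.
    rewrite -[RHS]f1 (bigD1 s) //= big1 ?addr0 // => v ne; apply: fE => //.
    by rewrite -est.
  apply: big1 => v _; have [->|ne] := eqVneq v s; first by rewrite [X in _ * X]fs mulr0.
  by rewrite [X in _ * X]fE ?mulr0 // -est.
have two (g : vertex Q -> k) : (forall v, v != s -> v != t -> g v = 0) ->
    \sum_v g v = g s + g t.
  move=> g0; rewrite (bigD1 s) //= (bigD1 t) /= 1?eq_sym //.
  by rewrite [X in _ + (_ + X)]big1 ?addr0 // => v /andP[? ?]; apply: g0.
have ft : f (E t) = - (f (E s) : k) :> k.
  apply/eqP; rewrite -addr_eq0 addrC -(two (fun v => f (E v) : k)) //.
  exact/eqP.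
rewrite (two (fun v => c v * (f (E v) : k))) => [|v vs vt]; last first.
  by rewrite [X in _ * X]fE ?mulr0.
by rewrite [X in _ + _ * X]ft; ring.
Qed.

(** On the vertex part this is the identity x_s y_s - x_t y_t = x_s (y_s - y_t) + (x_s - x_t) y_t;
    on the arrow part it is the product rule of the arrow coefficients, as only arrows from s to t
    contribute. *)
Lemma supported_derivation f s t x y : f 1 = 0 :> k -> kills_J2 f ->
  supported s t f ->
  f (x * y) = (vcoef D s x : k) * (f y : k) + (f x : k) * (vcoef D t y : k) :> k.
Proof.
move=> f1 fJ fst; have fA := fst.2.
rewrite (functionalE (x * y) fJ) (functionalE x fJ) (functionalE y fJ).
rewrite !(supported_sum _ f1 fst).
have arr : \sum_a (acoef D a (x * y) : k) * (f (X a) : k) =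
    (vcoef D s x : k) * \sum_a (acoef D a y : k) * (f (X a) : k) +
    (\sum_a (acoef D a x : k) * (f (X a) : k)) * (vcoef D t y : k).
  rewrite mulr_sumr mulr_suml -big_split; apply: eq_bigr => a _ /=.
  have [/andP[/eqP es /eqP et]|na] := boolP (arrow_from_to s t a); last first.
    by rewrite [f (X a) : k](fA _ na) !(mulr0, mul0r, addr0).
  rewrite acoefM es et; ring.
by rewrite arr !vcoefM; ring.
Qed.

Lemma kernel_subalgebra f s t : f 1 = 0 :> k -> kills_J2 f ->
  supported s t f -> subalgebra (lker f).
Proof.
move=> f1 fJ fst; split; first by rewrite memv_ker; apply/eqP.
apply/prodvP => x y; rewrite !memv_ker => /eqP x0 /eqP y0; apply/eqP.
by rewrite [LHS](supported_derivation x y f1 fJ fst) x0 y0 mulr0 mul0r addr0.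
Qed.

Lemma supported_formula f s t x : f 1 = 0 :> k -> kills_J2 f -> supported s t f ->
  f x = ((vcoef D s x : k) - vcoef D t x) * (f (E s) : k) +
        \sum_a (acoef D a x : k) * (f (X a) : k) :> k.
Proof.
by move=> f1 fJ fst; rewrite [LHS](functionalE x fJ) (supported_sum _ f1 fst).
Qed.

Lemma supported_vertex f s t u : f 1 = 0 :> k -> kills_J2 f -> supported s t f ->
  f (E u) = ((s == u)%:R - (t == u)%:R) * (f (E s) : k) :> k.
Proof.
move=> f1 fJ fst; rewrite (supported_formula _ f1 fJ fst) !vcoef_vertex.
by rewrite [X in _ + X]big1 ?addr0 // => a _; rewrite acoef_vertex mul0r.
Qed.

(** Two uses of the derivation rule, together with the vanishing of the vertex coefficients of x. *)
Lemma supported_conj f s t x b : f 1 = 0 :> k -> kills_J2 f -> supported s t f ->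
  x \in J -> f ((1 - x) * b * (1 + x)) =
    (f b : k) + (f x : k) * ((vcoef D s b : k) - vcoef D t b) :> k.
Proof.
move=> f1 fJ fst /(memJ D) xJ.
rewrite !(supported_derivation _ _ f1 fJ fst).
have chiB v (y : B) : vcoef D v (1 - y) = 1 - (vcoef D v y : k) :> k.
  by rewrite linearB /= vcoef1.
have chiD v (y : B) : vcoef D v (1 + y) = 1 + (vcoef D v y : k) :> k.
  by rewrite linearD /= vcoef1.
have fD y : f (1 + y) = f y :> k by rewrite linearD /= [X in X + _]f1 add0r.
rewrite fD functionalB f1 vcoefM chiB chiD !xJ; ring.
Qed.

Lemma vcoef_pair v s t : vcoef D v (E s + E t) = (v == s)%:R + (v == t)%:R :> k.
Proof. by rewrite linearD /= !vcoef_vertex. Qed.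

Lemma truncation_decomp x : exists2 r, r \in J2 &
  x = \sum_v (vcoef D v x : k) *: E v + \sum_a (acoef D a x : k) *: X a + r.
Proof.
eexists; first exact: (truncation_rest x).
by rewrite [RHS]addrC -[Y in _ = Y + _]addrA -opprD subrK.
Qed.

Lemma J2_sub_J x : x \in J2 -> x \in J.
Proof. by move/(memJ2 D) => [h _]; apply/(memJ D). Qed.

Lemma arrow_in_J a : X a \in J.
Proof. by apply/(memJ D) => v; apply: vcoef_arrow. Qed.

Section Classification.
Variable f : 'Hom(B, k^o).
Hypothesis f_neq0 : f != 0.
Hypothesis f_sub : subalgebra (lker f).

Lemma kernel_mul x y : f x = 0 :> k -> f y = 0 :> k -> f (x * y) = 0 :> k.
Proof.
move=> x0 y0; apply/eqP; rewrite -mem_kernel; case: f_sub => _ /subvP; apply.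
by apply: memv_mul; rewrite mem_kernel; apply/eqP.
Qed.

Lemma kernel_1 : f 1 = 0 :> k.
Proof. by case: f_sub => + _; rewrite mem_kernel => /eqP. Qed.

(* [B / ker f] is a one-dimensional bimodule over [ker f]. *)
Lemma kernel_mull e (a x : B) : f e = 1 :> k -> f a = 0 :> k ->
  f (a * x) = (f (a * e) : k) * (f x : k) :> k.
Proof.
move=> e1 a0; have : f (a * (x - (f x : k) *: e)) = 0 :> k.
  apply: kernel_mul => //; rewrite linearB linearZ /=.
  by rewrite [X in _ - X](_ : _ = (f x : k) * (f e : k)) // e1 mulr1 subrr.
rewrite mulrBr -scalerAr linearB linearZ /= => /eqP; rewrite subr_eq0 => /eqP ->.
by rewrite [LHS]mulrC.
Qed.

Lemma kernel_mulr e (a x : B) : f e = 1 :> k -> f a = 0 :> k ->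
  f (x * a) = (f (e * a) : k) * (f x : k) :> k.
Proof.
move=> e1 a0; have : f ((x - (f x : k) *: e) * a) = 0 :> k.
  apply: kernel_mul => //; rewrite linearB linearZ /=.
  by rewrite [X in _ - X](_ : _ = (f x : k) * (f e : k)) // e1 mulr1 subrr.
rewrite mulrBl -scalerAl linearB linearZ /= => /eqP; rewrite subr_eq0 => /eqP ->.
by rewrite [LHS]mulrC.
Qed.

Lemma exists_unit_value : exists e, f e = 1 :> k.
Proof.
have [e fe] : exists e, f e != 0.
  apply: contrapT => h; case/eqP: f_neq0; apply/lfunP => x; rewrite lfunE /=.
  by apply/eqP; apply: contrapT => /negP fx; apply: h; exists x.
exists ((f e : k)^-1 *: e); rewrite linearZ /=.
by rewrite [LHS](_ : _ = (f e : k)^-1 * (f e : k)) // mulVf.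
Qed.

(** If a acts on the line B / ker f by the scalar c, then f(a^n e) = c^n, so that c is nilpotent in
    k. *)
Lemma kernel_radical_mull (a x : B) : a \in J -> f a = 0 :> k -> f (a * x) = 0 :> k.
Proof.
move=> aJ a0; have [e e1] := exists_unit_value.
have [l al] := nilJ D aJ.
have powE n : f (a ^+ n * e) = (f (a * e) : k) ^+ n :> k.
  elim: n => [|n IH]; first by rewrite mul1r.
  by rewrite exprS -mulrA (kernel_mull (a ^+ n * e) e1 a0) IH exprS.
have := powE l; rewrite al mul0r linear0 => /esym/eqP.
rewrite expf_eq0 => /andP[_ /eqP ae].
by rewrite (kernel_mull x e1 a0) ae mul0r.
Qed.

Lemma kernel_radical_mulr (a x : B) : a \in J -> f a = 0 :> k -> f (x * a) = 0 :> k.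
Proof.
move=> aJ a0; have [e e1] := exists_unit_value.
have [l al] := nilJ D aJ.
have powE n : f (e * a ^+ n) = (f (e * a) : k) ^+ n :> k.
  elim: n => [|n IH]; first by rewrite mulr1.
  by rewrite exprSr mulrA (kernel_mulr (e * a ^+ n) e1 a0) IH exprS.
have := powE l; rewrite al mulr0 linear0 => /esym/eqP.
rewrite expf_eq0 => /andP[_ /eqP ae].
by rewrite (kernel_mulr x e1 a0) ae mul0r.
Qed.

Lemma radicalM x y : x \in J -> x * y \in J /\ y * x \in J.
Proof.
by move=> /(memJ D) h; split; apply/(memJ D) => v; rewrite vcoefM h ?mul0r ?mulr0.
Qed.

(** If f does not vanish on J, choose e in J with f(e) = 1. Modulo radical elements of the kernel, x
    and y are multiples of e, which reduces the claim to c = f(e^2) = 0. The same reduction gives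
    f(e^(n+1)) = c^n, and e is nilpotent. *)
Lemma kernel_kills_J2 : kills_J2 f.
Proof.
suff h x y : x \in J -> y \in J -> f (x * y) = 0 :> k.
  suff /subvP le : (J2 <= lker f)%VS.
    by move=> z /le; rewrite mem_kernel => /eqP.
  by apply/prodvP => x y xJ yJ; rewrite mem_kernel; apply/eqP/h.
move=> xJ yJ.
have [Jf|/existsNP[e0 /not_implyP[eJ0 /eqP fe0]]] :=
  pselect (forall z, z \in J -> f z = 0 :> k).
  by apply: Jf; case: (radicalM y xJ).
have [e eJ e1] : exists2 e, e \in J & f e = 1 :> k.
  exists ((f e0 : k)^-1 *: e0); first exact: rpredZ.
  by rewrite linearZ /= [LHS](_ : _ = (f e0 : k)^-1 * (f e0 : k)) // mulVf.
have redJ z : z \in J -> z - (f z : k) *: e \in J /\ f (z - (f z : k) *: e) = 0 :> k.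
  move=> zJ; split; first by rewrite rpredB // rpredZ.
  rewrite linearB linearZ /= [X in _ - X](_ : _ = (f z : k) * (f e : k)) //.
  by rewrite e1 mulr1 subrr.
have [l el] := nilJ D eJ.
pose c : k := f (e * e).
have powE n : f (e ^+ n.+1) = c ^+ n :> k.
  elim: n => [|n IH]; first by rewrite expr1.
  have [r1 r2] := redJ _ (proj1 (radicalM e eJ)).
  have := kernel_radical_mull (e ^+ n) r1 r2.
  have -> : (e * e - (f (e * e) : k) *: e) * e ^+ n = e ^+ n.+2 - c *: e ^+ n.+1.
    by rewrite mulrBl -scalerAl -mulrA !exprS.
  rewrite linearB linearZ /= [X in _ - X](_ : _ = c * (f (e ^+ n.+1) : k)) // IH.
  by move/eqP; rewrite subr_eq0 => /eqP ->; rewrite exprS.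
have c0 : c = 0.
  have := powE l; rewrite exprS el mulr0 linear0 => /esym/eqP.
  by rewrite expf_eq0 => /andP[_ /eqP].
have [x1 x0] := redJ _ xJ; have [y1 y0] := redJ _ yJ.
have := kernel_radical_mulr ((f x : k) *: e) y1 y0.
have := kernel_radical_mull y x1 x0.
rewrite mulrBl linearB /= => /eqP; rewrite subr_eq0 => /eqP ->.
rewrite mulrBr linearB /= => /eqP; rewrite subr_eq0 => /eqP ->.
rewrite -scalerAr -scalerAl 2!linearZ /=.
by rewrite [X in _ *: X](_ : _ = (f x : k) * c) // c0 mulr0 [LHS]mulr0.
Qed.

(** If f is nonzero on some arrow, the ends of that arrow serve as s and t; otherwise s and t are
    found among the vertices with nonzero value, of which there are at most two. *)
Lemma kernel_supported : exists s t, supported s t f.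
Proof.
have fJ := kernel_kills_J2.
have [[a0 /eqP y0]|noarr] := pselect (exists a, f (X a) <> 0 :> k).
  exists (src a0), (tgt a0); split.
    move=> v /negPf vs /negPf vt.
    (* c places E v - c X a0 in the kernel. In the square of this element f sees only E v, since v
       is neither end of a0. *)
    pose c := (f (E v) : k) / (f (X a0) : k).
    have z0 : f (E v - c *: X a0) = 0 :> k.
      by rewrite functionalB functionalZ /c divfK ?subrr.
    have := kernel_mul z0 z0.
    rewrite mulrBl !mulrBr -!scalerAl -!scalerAr !functionalB !functionalZ.
    rewrite !(functional_vertexM, functional_arrowM, functional_vertex_arrow,
      functional_arrow_vertex) //.
    by rewrite eqxx eq_sym vs eq_sym vt !(mul0r, mulr0, subr0) mul1r.
  move=> b nb.
  (* A radical element of the kernel. When b is not parallel to a0, multiplying z by the source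
     vertex on the left or by the target vertex on the right removes X b and leaves a multiple of X
     a0. *)
  pose z := (f (X b) : k) *: X a0 - (f (X a0) : k) *: X b.
  have XJ d : X d \in J by apply/(memJ D) => v; apply: vcoef_arrow.
  have zJ : z \in J by rewrite rpredB ?rpredZ.
  have z0 : f z = 0 :> k.
    by rewrite functionalB !functionalZ [X in _ - X]mulrC subrr.
  have := kernel_radical_mull (E (tgt a0)) zJ z0.
  have := kernel_radical_mulr (E (src a0)) zJ z0.
  rewrite mulrBr mulrBl -!scalerAl -!scalerAr !functionalB !functionalZ.
  rewrite !(functional_vertex_arrow, functional_arrow_vertex) // !eqxx !mul1r.
  rewrite /arrow_from_to in nb.
  have [e|ns] := eqVneq (src b) (src a0); last first.
    by rewrite mul0r mulr0 subr0 => /eqP;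
      rewrite mulf_eq0 (negPf y0) orbF => /eqP.
  have [e'|nt] := eqVneq (tgt b) (tgt a0); last first.
    by rewrite mul0r mulr0 subr0 => _ /eqP;
      rewrite mulf_eq0 (negPf y0) orbF => /eqP.
  by rewrite e e' !eqxx in nb.
have arr0 a : f (X a) = 0 :> k.
  by apply: contrapT => h; apply: noarr; exists a.
have [[s /eqP xs]|nov] := pselect (exists s, f (E s) <> 0 :> k); last first.
  have [u _] := card_gt0P (vertex_gt0 Q); exists u, u; split=> // v _ _.
  by apply: contrapT => h; apply: nov; exists v.
have [[t [nts /eqP xt]]|not_t] :=
  pselect (exists t, t != s /\ f (E t) <> 0 :> k); last first.
  exists s, s; split=> // v vs _; apply: contrapT => h; apply: not_t.
  by exists v.
exists s, t; split=> // u /negPf us /negPf ut; apply: contrapT => /eqP xu.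
(* With three vertices of nonzero value, (E s - c E u) (E s - d E t) would be a product of kernel
   elements on which f takes the value f(E s). *)
have kill v : f (E v) != 0 :> k ->
    f (E s - ((f (E s) : k) / (f (E v) : k)) *: E v) = 0 :> k.
  by move=> xv; rewrite functionalB functionalZ divfK // subrr.
have := kernel_mul (kill u xu) (kill t xt).
rewrite mulrBl !mulrBr -!scalerAl -!scalerAr !functionalB !functionalZ.
rewrite !functional_vertexM // eqxx mul1r us ut eq_sym (negPf nts).
by rewrite !(mul0r, mulr0, subr0) => /eqP; rewrite (negPf xs).
Qed.

End Classification.

End CodimensionOne.

(** * Algebras of radical square zero *)

Section RadicalSquareZero.
Variables (k : fieldType) (Q : quiver) (C : falgType k).
Variable rho : {lrmorphism path_algebra k Q -> C}.
Local Notation E := (vertex_elt rho).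
Local Notation X := (arrow_elt rho).
Variable D : truncation E X.
Local Notation J := (jacobson C).
Local Notation J2 := (jacobson C * jacobson C)%VS.
Implicit Types (f : 'Hom(C, k^o)) (s t u v : vertex Q) (a : arrow Q).

Lemma sub_lker (U : {vspace C}) f :
  (forall x, x \in U -> f x = 0 :> k) -> (U <= lker f)%VS.
Proof. by move=> h; apply/subvP => x /h fx; rewrite mem_kernel; apply/eqP. Qed.

Lemma mem_lker f x : x \in lker f -> f x = 0 :> k.
Proof. by rewrite mem_kernel => /eqP. Qed.

Lemma memv_vertices x :
  \sum_v (vcoef D v x : k) *: E v \in (\sum_w <[E w]>)%VS.
Proof. by apply: memv_sumr => v _; apply: memvZ; apply: memv_line. Qed.

(** Without arrow values, f is a nonzero multiple of the difference of the coefficients at s and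
    t. *)
Lemma alg_glue_kernel f s t : s != t -> f != 0 -> f 1 = 0 :> k -> kills_J2 f ->
  supported E X s t f -> (forall a, f (X a) = 0 :> k) -> alg_glue rho s t = lker f.
Proof.
move=> st f0 f1 fJ fst fX.
have fE x : f x = ((vcoef D s x : k) - vcoef D t x) * (f (E s) : k) :> k.
  rewrite (supported_formula D _ f1 fJ fst) [X in _ + X]big1 ?addr0 // => a _.
  by rewrite [X in _ * X]fX mulr0.
have fs : f (E s) != 0 :> k.
  apply: contraNneq f0 => fs; apply/eqP/lfunP => x; rewrite lfunE.
  by rewrite [LHS]fE [X in _ * X]fs mulr0.
apply/eqP; rewrite eqEsubv; apply/andP; split.
  rewrite !subv_add; apply/andP; split; first (apply/andP; split).
  - rewrite -memvE mem_kernel fE (vcoef_pair D) (vcoef_pair D).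
    by rewrite !eqxx [t == s]eq_sym (negPf st) addr0 add0r subrr mul0r.
  - apply/subv_sumP => w /andP[ws wt]; rewrite -memvE mem_kernel; apply/eqP.
    exact: fst.1.
  by apply: sub_lker => x /(memJ D) xJ; rewrite fE !xJ subrr mul0r.
apply/subvP => x /mem_lker /eqP; rewrite fE mulf_eq0 (negPf fs) orbF subr_eq0 => /eqP cst.
have [r rJ ->] := truncation_decomp D x; rewrite -addrA; apply: memv_add; last first.
  apply: memvD; last exact: (J2_sub_J D).
  by apply: memv_suml => a _; apply: memvZ; apply: (arrow_in_J D).
rewrite (bigD1 s) //= (bigD1 t) 1?eq_sym //= addrA -cst -scalerDr.
apply: memv_add; first by apply: memvZ; apply: memv_line.
by apply: memv_sumr => v _; apply: memvZ; apply: memv_line.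
Qed.

Lemma alg_arrow_kernel f s t : kills_J2 f -> supported E X s t f ->
  (forall u, f (E u) = 0 :> k) ->
  alg_arrow rho s t (arrow_span rho s t :&: lker f) = lker f.
Proof.
move=> fJ fst fE; apply/eqP; rewrite eqEsubv; apply/andP; split.
  rewrite !subv_add capvSr /= andbT; apply/andP; split; first (apply/andP; split).
  - by apply/subv_sumP => w _; rewrite -memvE mem_kernel; apply/eqP.
  - apply/subv_sumP => -[u w] ne; apply/subv_sumP => a /= /andP[/eqP su /eqP tw].
    rewrite -memvE mem_kernel; apply/eqP/fst.2; apply: contraNN ne.
    by rewrite /arrow_from_to su tw xpair_eqE.
  exact: sub_lker.
apply/subvP => x /mem_lker fx; have [r rJ xE] := truncation_decomp D x.
rewrite xE; apply: memv_add => //; rewrite (bigID (arrow_from_to s t)) /= addrA.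
apply: memv_add; first apply: memv_add; first exact: memv_vertices.
  have yS : \sum_(a | arrow_from_to s t a) (acoef D a x : k) *: X a \in arrow_span rho s t.
    by apply: memv_sumr => a _; apply: memvZ; apply: memv_line.
  rewrite memv_cap yS mem_kernel; apply/eqP; rewrite -[RHS]fx (functionalE D x fJ).
  rewrite [X in _ = X + _]big1 ?add0r => [|v _]; last by rewrite [X in _ * X]fE mulr0.
  rewrite [in RHS](bigID (arrow_from_to s t)) /= [X in _ = _ + X]big1 ?addr0 => [|a na].
    by rewrite (linear_sum f); apply: eq_bigr => a _; apply: functionalZ.
  by rewrite [X in _ * X](fst.2 _ na) mulr0.
apply: memv_suml => a na; apply: memvZ.
apply: (subvP (sumv_sup (src a, tgt a) _ (subvv _))); last first.
  apply: (subvP (sumv_sup a _ (subvv _))); last exact: memv_line.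
  by rewrite /arrow_from_to !eqxx.
by apply: contraNneq na => -[<- <-]; rewrite /arrow_from_to !eqxx.
Qed.

Hypothesis J2_0 : forall x, x \in J2 -> x = 0.

Lemma kills_J2_all f : kills_J2 f.
Proof. by move=> x /J2_0 ->; rewrite linear0. Qed.

(** In radical square zero x^2 = 0, hence the inverse of 1 + x is 1 - x. *)
Lemma innerE x y : x \in J -> inner (1 + x) y = (1 + x) * y * (1 - x).
Proof.
move=> xJ; have xx : x * x = 0 by apply: J2_0; apply: memv_mul.
have l : (1 - x) * (1 + x) = 1.
  by rewrite mulrDr mulr1 mulrBl mul1r xx subr0 subrK.
have r : (1 + x) * (1 - x) = 1.
  by rewrite mulrBr mulr1 mulrDl mul1r xx addr0 addrK.
have u : 1 + x \is a GRing.unit by apply/unitrP; exists (1 - x).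
have -> : 1 - x = (1 + x)^-1 by apply: (mulrI u); rewrite r divrr.
by rewrite /inner comp_lfunE /amulr /amull !lfunE.
Qed.

Lemma inner_conjK x y : x \in J -> (1 - x) * ((1 + x) * y * (1 - x)) * (1 + x) = y.
Proof.
move=> xJ; have xx : x * x = 0 by apply: J2_0; apply: memv_mul.
have l : (1 - x) * (1 + x) = 1.
  by rewrite mulrDr mulr1 mulrBl mul1r xx subr0 subrK.
by rewrite -!mulrA l mulr1 mulrA l mul1r.
Qed.

Lemma inner_lker f (g : 'Hom(C, k^o)) x : x \in J ->
  (forall y, g y = f ((1 - x) * y * (1 + x)) :> k) ->
  (inner (1 + x) @: lker f)%VS = lker g.
Proof.
move=> xJ gE; apply/eqP; rewrite eqEsubv; apply/andP; split; apply/subvP => y.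
  case/memv_imgP => z /mem_lker fz ->; rewrite mem_kernel gE innerE //.
  by rewrite inner_conjK // fz.
move/mem_lker; rewrite gE => fy; apply/memv_imgP.
exists ((1 - x) * y * (1 + x)); first by rewrite mem_kernel; apply/eqP.
rewrite innerE // -[y in LHS](@inner_conjK (- x)) ?rpredN //.
by rewrite opprK.
Qed.

(** U is enlarged by a complement of the arrow span to a hyperplane H of C. A form with kernel H,
    kept on the arrows from s to t and replaced by 0 on the other arrows and on the vertices, cuts
    out U in the arrow span. *)
Lemma arrow_hyperplane_functional s t U : arrow_hyperplanes rho s t U ->
  exists2 f, [/\ supported E X s t f, forall u, f (E u) = 0 :> k
      & exists a, f (X a) != 0 :> k]
    & U = (arrow_span rho s t :&: lker f)%VS.
Proof.
move=> [US dimU]; set S := arrow_span rho s t.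
have n0 : (0 < \dim {: C})%N.
  by rewrite lt0n dimv_eq0 -subv0; apply/negP => /subvP/(_ 1 (memvf _));
    rewrite memv0 oner_eq0.
pose H := (U + S^C)%VS.
have US0 : (U :&: S^C = 0)%VS.
  by apply/eqP; rewrite -subv0 -(capv_compl S) capvS.
have dimH : (\dim H).+1 = \dim {: C}.
  by rewrite /H dimv_disjoint_sum // dimv_compl -addSn dimU subnKC // dimvS ?subvf.
have SH : (S :&: H)%VS = U.
  apply/esym/eqP; rewrite eqEdim subv_cap US addvSl /=.
  have SHf : (S + H)%VS = fullv.
    by apply/eqP; rewrite eqEsubv subvf -(addv_complf S) addvS // addvSr.
  have := dimv_sum_cap S H; rewrite SHf -dimH -dimU !addSn => -[].
  by rewrite [(\dim U + _)%N]addnC => /addnI ->.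
have dimH' : \dim H = (\dim {: C}).-1 by rewrite -dimH.
pose g := hyperplane_functional H.
have kerg : lker g = H by apply: lker_hyperplane_functional.
pose f := functional_of D (fun=> 0) (fun a => if arrow_from_to s t a then g (X a) else 0).
have fS x : x \in S -> f x = g x.
  suff /subvP le : (S <= lker (f - g))%VS.
    move=> /le; rewrite memv_ker add_lfunE opp_lfunE subr_eq0 => /eqP.
    exact.
  apply/subv_sumP => a st; rewrite -memvE memv_ker add_lfunE opp_lfunE subr_eq0.
  by apply/eqP; rewrite [LHS](functional_of_arrow D) st.
have capE : (S :&: lker f)%VS = U.
  rewrite -SH -kerg; apply/vspaceP => x; rewrite !memv_cap.
  by case xS : (x \in S) => //=; rewrite !memv_ker fS.
exists f => //; split.
- split=> [u _ _|a /negPf na]; first exact: functional_of_vertex.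
  by rewrite [LHS]functional_of_arrow na.
- by move=> u; rewrite [LHS]functional_of_vertex.
apply: contrapT => h.
have SU : (S <= U)%VS.
  rewrite -capE subv_cap subvv /=; apply/subv_sumP => a st; rewrite -memvE memv_ker.
  by apply/negPn/negP => fa; apply: h; exists a.
by have := dimvS SU; rewrite -dimU ltnn.
Qed.

Lemma functional_arrow_hyperplane f s t a : arrow_from_to s t a -> f (X a) != 0 :> k ->
  arrow_hyperplanes rho s t (arrow_span rho s t :&: lker f)%VS.
Proof.
move=> st fa; split; first exact: capvSl.
have aS : X a \in arrow_span rho s t.
  by apply: (subvP (sumv_sup a _ (subvv _))) => //; apply: memv_line.
have := limg_ker_dim f (arrow_span rho s t); rewrite -addn1 => <-; congr (_ + _)%N.
apply/esym/eqP; rewrite eqn_leq; apply/andP; split.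
  by apply: leq_trans (dimvS (subvf _)) _; rewrite dimvf.
rewrite lt0n dimv_eq0; apply: contraNneq fa => e.
by have := memv_img f aS; rewrite e memv0.
Qed.

Lemma orbit_unionP s t A : orbit_union rho s t A <->
  exists f, [/\ f 1 = 0 :> k, supported E X s t f,
    exists a, f (X a) != 0 :> k & A = lker f].
Proof.
split=> [[U hU [_ [x xJ <-] <-]]|[f [f1 fst [a fa] ->]]].
  have [f [fst fE fX] UE] := arrow_hyperplane_functional hU.
  have fJ := @kills_J2_all f.
  have f1 : f 1 = 0 :> k by rewrite (functional1 D) big1.
  rewrite UE (alg_arrow_kernel fJ fst fE).
  pose g : 'Hom(C, k^o) := (f \o (amulr (1 + x) \o amull (1 - x)))%VF.
  have gE y : g y = f ((1 - x) * y * (1 + x)) :> k.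
    by rewrite /g comp_lfunE comp_lfunE /amulr /amull !lfunE.
  have gE' y : g y = (f y : k) + (f x : k) * ((vcoef D s y : k) - vcoef D t y) :> k.
    by rewrite gE (supported_conj D y f1 fJ fst xJ).
  exists g; split.
  - by rewrite gE' f1 !vcoef1 subrr mulr0 addr0.
  - split=> [u us ut|b nb].
      rewrite gE' fE !vcoef_vertex [s == u]eq_sym [t == u]eq_sym (negPf us) (negPf ut).
      by rewrite subrr mulr0 addr0.
    by rewrite gE' fst.2 // !vcoef_arrow subrr mulr0 addr0.
  - by have [b fb] := fX; exists b; rewrite gE' !vcoef_arrow subrr mulr0 addr0.
  exact: inner_lker.
have fJ := @kills_J2_all f.
have ast : arrow_from_to s t a by apply: contraNT fa => /fst.2 ->.
(* Scaled so that f(x) = f(E s): by [supported_vertex], the conjugate g then vanishes on every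
   vertex. *)
pose x := ((f (E s) : k) / (f (X a) : k)) *: X a.
have xJ : x \in J by apply: memvZ; apply: (arrow_in_J D).
have fx : f x = f (E s) :> k by rewrite functionalZ divfK.
pose g : 'Hom(C, k^o) := (f \o (amulr (1 - x) \o amull (1 + x)))%VF.
have gE y : g y = f ((1 + x) * y * (1 - x)) :> k.
  by rewrite /g comp_lfunE comp_lfunE /amulr /amull !lfunE.
have gE' y : g y = (f y : k) - (f x : k) * ((vcoef D s y : k) - vcoef D t y) :> k.
  have nxJ : - x \in J by rewrite rpredN.
  have := supported_conj D y f1 fJ fst nxJ; rewrite opprK linearN mulNr => <-.
  exact: gE.
have gX b : g (X b) = f (X b) :> k.
  rewrite gE' (vcoef_arrow D s b) (vcoef_arrow D t b) subrr mulr0.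
  exact: subr0.
have gV u : g (E u) = 0 :> k.
  by rewrite gE' (supported_vertex D _ f1 fJ fst) fx !vcoef_vertex mulrC subrr.
have gst : supported E X s t g.
  by split=> [u _ _|b nb]; [exact: gV | rewrite gX fst.2].
exists (arrow_span rho s t :&: lker g)%VS.
  by apply: (functional_arrow_hyperplane ast); rewrite gX.
exists (inner (1 + x)); first by exists x.
rewrite (alg_arrow_kernel (@kills_J2_all g) gst gV); apply: inner_lker => // y.
rewrite gE [in RHS]mulrA; congr (f _).
have xx : x * x = 0 by apply: J2_0; apply: memv_mul.
have r : (1 + x) * (1 - x) = 1.
  by rewrite mulrBr mulr1 mulrDl mul1r xx addr0 addrK.
by rewrite -!mulrA r mulr1 mulrA r mul1r.
Qed.

End RadicalSquareZero.

(** * The ideal of the union of the pieces *)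

Section MultivariatePolynomials.

(** Multiplication by one variable at a time is the form of induction suited to ideal membership and
    to substitutions. *)
Lemma mpoly_ind (R : comNzRingType) n (P : {mpoly R[n]} -> Prop) :
  (forall c, P c%:MP) -> (forall f g, P f -> P g -> P (f + g)) ->
  (forall i f, P f -> P ('X_i * f)) -> forall f, P f.
Proof.
move=> PC PD PX; elim/mpolyind => [|c m p _ _ IH]; first by rewrite -mpolyC0.
apply: PD => //; elim: {m}(mdeg m) {-2}m (erefl (mdeg m)) => [|d IHd] m.
  by move/eqP; rewrite mdeg_eq0 => /eqP ->; rewrite mpolyX0 alg_mpolyC.
move=> md; have [i mi] : exists i, m i != 0%N.
  apply/existsP; rewrite -negb_forall; apply/negP => /forallP h.
  suff m0 : m = 0%MM by rewrite m0 mdeg0 in md.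
  by apply/mnmP => i; rewrite mnmE; apply/eqP/h.
have U : (U_(i) <= m)%MM by rewrite lep1mP.
have -> : c *: 'X_[m] = 'X_i * (c *: 'X_[m - U_(i)]) :> {mpoly R[n]}.
  by rewrite -scalerAr -mpolyXD addmC submK.
apply/PX/IHd; rewrite -{1}(submK U) mdegD mdeg1 addn1 in md.
by case: md.
Qed.

Lemma mpoly_morph_ext (R : comNzRingType) n m
    (F G : {mpoly R[n]} -> {mpoly R[m]}) :
  (forall c, F c%:MP = G c%:MP) -> {morph F : x y / x + y} ->
  {morph G : x y / x + y} -> {morph F : x y / x * y} -> {morph G : x y / x * y} ->
  (forall i, F 'X_i = G 'X_i) -> F =1 G.
Proof.
move=> FC FD GD FM GM FX; apply: mpoly_ind => // [f g hf hg|i f hf].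
  by rewrite FD GD hf hg.
by rewrite FM GM FX hf.
Qed.

(** Uniqueness of digits in base D, by comparing remainders and quotients. *)
Lemma base_expansion_inj n D (e e' : 'I_n -> nat) :
  (forall i, e i < D)%N -> (forall i, e' i < D)%N ->
  (\sum_i e i * D ^ i = \sum_i e' i * D ^ i)%N -> e =1 e'.
Proof.
elim: n e e' => [|n IH] e e' he he'; first by move=> _ [].
have D0 : (0 < D)%N by apply: leq_trans (he ord0).
rewrite !big_ord_recl !expn0 !muln1.
have E (g : 'I_n.+1 -> nat) : (\sum_(i < n) g (lift ord0 i) * D ^ lift ord0 i =
    (\sum_(i < n) g (lift ord0 i) * D ^ i) * D)%N.
  rewrite big_distrl; apply: eq_bigr => i _ /=.
  by rewrite /bump leq0n add1n expnSr mulnA.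
rewrite !E ![(_ ord0 + _)%N]addnC => h.
have h0 : e ord0 = e' ord0.
  by have := congr1 (modn^~ D) h; rewrite !modnMDl !modn_small.
have hS : forall i, e (lift ord0 i) = e' (lift ord0 i).
  apply: (IH (fun i => e (lift ord0 i)) (fun i => e' (lift ord0 i))) => //.
  have := congr1 (divn^~ D) h.
  by rewrite !divnMDl // !divn_small // !addn0.
by move=> i; have [j ->|->] := unliftP ord0 i.
Qed.

(* Substituting 'X^(D^i) for the i-th variable, with D larger than all
   exponents, separates the monomials. *)
Lemma mpoly_eq0_eval (k : closedFieldType) n (f : {mpoly k[n]}) :
  (forall u, f.@[u] = 0) -> f = 0.
Proof.
move=> f0; apply/mpolyP => m; rewrite mcoeff0.
have [mf|/memN_msupp_eq0 //] := boolP (m \in msupp f).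
pose D := (\max_(p <- msupp f) mdeg p).+1.
pose e (p : 'X_{1..n}) := (\sum_i p i * D ^ i)%N.
pose g : {poly k} := \sum_(p <- msupp f) f@_p *: 'X^(e p).
have g0 : g = 0.
  apply: contrapT => /eqP/closed_nonrootP[t]; apply/negP/negPn; rewrite /root /g.
  rewrite horner_sum -[X in _ == X](f0 (fun i => t ^+ (D ^ i))) mevalE.
  apply/eqP/eq_bigr => p _; rewrite hornerZ hornerXn; congr (_ * _).
  by rewrite /e -prodrXr; apply: eq_bigr => i _; rewrite -exprM mulnC.
have bound p : p \in msupp f -> forall i, (p i < D)%N.
  move=> pf i; rewrite ltnS; apply: leq_trans (leq_bigmax_seq _ pf isT).
  by rewrite mdegE (bigD1 i) //= leq_addr.
have := congr1 (fun q : {poly k} => q`_(e m)) g0.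
rewrite /g coef_sum coef0 (bigD1_seq m) //= ?msupp_uniq // coefZ coefXn eqxx mulr1.
rewrite big_seq_cond big1 ?addr0 // => p /andP[pf pm].
rewrite coefZ coefXn; case: eqP => [h|_]; last by rewrite mulr0.
case/negP: pm; apply/eqP/mnmP => i; apply/esym.
by move: i; apply: (base_expansion_inj (bound m mf) (bound p pf)).
Qed.

End MultivariatePolynomials.

Lemma ideal_add_two_sided (R : pzRingType) (I J : set R) :
  two_sided_ideal I -> two_sided_ideal J -> two_sided_ideal (ideal_add I J).
Proof.
move=> [I0 ID IM] [J0 JD JM]; split=> [|x y|a x].
- by exists 0 => //; exists 0; rewrite ?addr0.
- move=> [i Ii [j Jj <-]] [i' Ii' [j' Jj' <-]].
  by exists (i + i'); [apply: ID | exists (j + j'); [apply: JD | rewrite addrACA]].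
move=> [i Ii [j Jj <-]]; have [] := IM a i Ii; have [] := JM a j Jj => ? ? ? ?.
by split; [exists (a * i) => //; exists (a * j); rewrite ?mulrDr
          | exists (i * a) => //; exists (j * a); rewrite ?mulrDl].
Qed.

Lemma ideal_addl (R : pzRingType) (I J : set R) :
  two_sided_ideal J -> I `<=` ideal_add I J.
Proof. by move=> [J0 _ _] x Ix; exists x => //; exists 0; rewrite ?addr0. Qed.

Lemma ideal_addr (R : pzRingType) (I J : set R) :
  two_sided_ideal I -> J `<=` ideal_add I J.
Proof. by move=> [I0 _ _] x Jx; exists 0 => //; exists x; rewrite ?add0r. Qed.

Lemma ideal_add_sub (R : pzRingType) (I J K : set R) :
  two_sided_ideal K -> I `<=` K -> J `<=` K -> ideal_add I J `<=` K.
Proof. by move=> [_ KD _] IK JK _ [x /IK Kx [y /JK Ky <-]]; apply: KD. Qed.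

Lemma product_difference (S : comPzRingType) (e x y p q : S) :
  e * (x * p - y * q) = x * (e * (p - q)) + q * (e * (x - y)).
Proof. ring. Qed.

Section UnionIdeal.
Variables (k : closedFieldType) (Q : quiver) (n0 n1 : nat).
Variables (v : 'I_n0.+1 -> vertex Q) (a : 'I_n1 -> arrow Q).
Local Notation R := {mpoly k[n0 + n1]}.
Local Notation X := (X_ideal k v a).
Local Notation V := (vvar k n1).
Local Notation A := (avar k n0).
Local Notation pv := (pvertex v).
Implicit Types (s t : vertex Q) (w u : 'I_(n0 + n1) -> k).

(* The coordinate of [v_0] is determined by the vanishing on the unit. *)
Definition xcoord w (i : 'I_n0.+1) : k :=
  if unlift ord0 i is Some j then w (lshift n1 j) else - \sum_j w (lshift n1 j).

Definition on_piece s t w : Prop :=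
  (forall i, v i != s -> v i != t -> xcoord w i = 0) /\
  (forall i, ~~ arrow_from_to s t (a i) -> w (rshift n0 i) = 0).

(** Passes between the unsigned minors, in which X is written, and the values of the functional, in
    which the pieces are described; it is its own inverse. *)
Definition alternate w : 'I_(n0 + n1) -> k := fun i => (-1) ^+ i * w i.

Lemma xcoord_lift w j : xcoord w (lift ord0 j) = w (lshift n1 j).
Proof. by rewrite /xcoord liftK. Qed.

Lemma xcoord0 w : xcoord w ord0 = - \sum_j w (lshift n1 j).
Proof. by rewrite /xcoord unlift_none. Qed.

Lemma xcoord_sum w : \sum_i xcoord w i = 0.
Proof.
rewrite big_ord_recl xcoord0 addrC; apply/eqP; rewrite subr_eq0; apply/eqP.
by apply: eq_bigr => j _; rewrite xcoord_lift.
Qed.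

Lemma X_two_sided : two_sided_ideal X.
Proof.
by apply: ideal_add_two_sided; [apply: ideal_add_two_sided|]; apply: ideal_gen_two_sided.
Qed.

Lemma X_zero_sub : @X_zero k n0 n1 `<=` X.
Proof.
by move=> f f0; do 2 (apply: ideal_addl; first exact: ideal_gen_two_sided).
Qed.

Lemma X_half_sub : @X_half k Q n0 n1 v a `<=` X.
Proof.
move=> f f0; apply: ideal_addl; first exact: ideal_gen_two_sided.
by apply: ideal_addr; first exact: ideal_gen_two_sided.
Qed.

Lemma X_one_sub : @X_one k Q n0 n1 a `<=` X.
Proof.
move=> f f0; apply: ideal_addr => //.
by apply: ideal_add_two_sided; apply: ideal_gen_two_sided.
Qed.

Lemma X_vv (i j : 'I_n0) : (i < j)%N ->
  X (V i ^+ 2 * V j - (-1) ^+ (j - i - 1) * V i * V j ^+ 2).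
Proof. by move=> ij; apply: X_zero_sub; apply: sub_ideal_gen; left; exists i, j. Qed.

Lemma X_vvv (i j l : 'I_n0) : (i < j < l)%N -> X (V i * V j * V l).
Proof. by move=> ij; apply: X_zero_sub; apply: sub_ideal_gen; right; exists i, j, l. Qed.

Lemma X_av i j : pv j != src (a i) -> pv j != tgt (a i) -> X (A i * V j).
Proof.
move=> js jt; apply: X_half_sub; apply: sub_ideal_gen; left; left; exists i, j.
by rewrite js jt.
Qed.

Lemma X_vva (j l : 'I_n0) i : (j < l)%N ->
  arrow_from_to (pv j) (pv l) (a i) || arrow_from_to (pv l) (pv j) (a i) ->
  X ((V l - (-1) ^+ (l - j - 1) * V j) * A i).
Proof.
by move=> jl h; apply: X_half_sub; apply: sub_ideal_gen; left; right; exists j, l, i.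
Qed.

Lemma X_loop j i : arrow_from_to (pv j) (pv j) (a i) -> X (V j * A i).
Proof. by move=> h; apply: X_half_sub; apply: sub_ideal_gen; right; exists j, i. Qed.

Lemma X_aa i j : ~~ parallel (a i) (a j) -> X (A i * A j).
Proof. by move=> h; apply: X_one_sub; apply: sub_ideal_gen; exists i, j. Qed.

(** Symmetric form of the sign in the generators: with v_i = (-1)^i x_i, the cubic binomials become
    x_i x_j (x_i + x_j) and the quadratic ones (x_l + x_j) times an arrow, up to sign. *)
Lemma sign_pred (S : comPzRingType) (i j : nat) : (i < j)%N ->
  (-1) ^+ (j - i - 1) = - ((-1) ^+ i * (-1) ^+ j) :> S.
Proof.
move=> ij; rewrite -subnDA addn1 -[in RHS](subnK ij) addnS exprS exprD mulN1r mulrN opprK.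
by rewrite mulrCA -expr2 sqrr_sign mulr1.
Qed.

Hypothesis v_inj : injective v.

Lemma pv_inj : injective pv.
Proof. by move=> i j /v_inj/lift_inj. Qed.

Lemma xcoord_two w i j : i != j ->
  (forall l, l != i -> l != j -> xcoord w l = 0) -> xcoord w i + xcoord w j = 0.
Proof.
move=> ij h; rewrite -[RHS](xcoord_sum w) (bigD1 i) //= (bigD1 j) 1?eq_sym //=.
by rewrite big1 ?addr0 // => l /andP[? ?]; apply: h.
Qed.

Lemma on_piece_opposite s t w i j : on_piece s t w -> i != j ->
  xcoord w i != 0 -> xcoord w j != 0 -> xcoord w i = - xcoord w j.
Proof.
move=> [h _] ij xi xj; apply/eqP; rewrite -addr_eq0; apply/eqP/xcoord_two => // l li lj.
have inst m : xcoord w m != 0 -> (v m == s) || (v m == t).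
  by apply: contraNT; rewrite negb_or => /andP[ms mt]; apply/eqP/h.
have vij : v i != v j by rewrite (inj_eq v_inj).
apply: h; apply/eqP => e; move: li lj vij (inst i xi) (inst j xj);
  rewrite -!(inj_eq v_inj) e => /negPf li /negPf lj.
  rewrite ![_ == s]eq_sym li lj /= => /eqP vij /eqP ei /eqP ej.
  by case: vij; rewrite ei ej.
rewrite ![_ == t]eq_sym li lj !orbF /= => /eqP vij /eqP ei /eqP ej.
by case: vij; rewrite ei ej.
Qed.

Lemma on_piece_single s t w i : on_piece s t w -> s = t -> xcoord w i = 0.
Proof.
move=> [h _] st; have [/eqP e|ne] := boolP (v i == s); last by apply: h; rewrite -?st.
rewrite -[RHS](xcoord_sum w) (bigD1 i) //= big1 ?addr0 // => j ji.
by apply: h; rewrite -?st -e (inj_eq v_inj).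
Qed.

Lemma on_piece_zero s t u f : on_piece s t (alternate u) -> X f -> f.@[u] = 0.
Proof.
move=> pst; have [hv ha] := pst.
have xE j : xcoord (alternate u) (lift ord0 j) = (-1) ^+ j * u (lshift n1 j).
  by rewrite xcoord_lift.
have uE j : u (lshift n1 j) = (-1) ^+ j * xcoord (alternate u) (lift ord0 j).
  by rewrite xE mulrA -expr2 sqrr_sign mul1r.
have opp i j : i != j -> u (lshift n1 i) != 0 -> u (lshift n1 j) != 0 ->
    u (lshift n1 i) = - ((-1) ^+ i * (-1) ^+ j) * u (lshift n1 j).
  move=> ij ui uj; rewrite uE (on_piece_opposite pst (j := lift ord0 j)).
  - by rewrite xE mulrN mulNr mulrA.
  - by rewrite (inj_eq lift_inj).
  - by rewrite xE mulf_neq0 ?signr_eq0.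
  - by rewrite xE mulf_neq0 ?signr_eq0.
have arr i : u (rshift n0 i) != 0 -> arrow_from_to s t (a i).
  apply: contraNT => /ha; rewrite /alternate => /eqP.
  by rewrite mulf_eq0 signr_eq0.
have inst j : u (lshift n1 j) != 0 -> (pv j == s) || (pv j == t).
  apply: contraNT; rewrite negb_or => /andP[js jt]; apply/eqP.
  by rewrite uE /pvertex hv ?mulr0.
pose K : set R := [set f | f.@[u] = 0].
suff sub : X `<=` K by move/sub.
have TK : two_sided_ideal K.
  split=> [|x y|b x]; rewrite /K /= ?meval0 ?mevalD ?mevalM //.
    by move=> -> ->; rewrite addr0.
  by move=> ->; rewrite mulr0 mul0r.
have K0 x y : (x != 0 -> y != 0 -> x * y = 0) -> x * y = 0 :> k.
  have [->|x0] := eqVneq x 0; first by rewrite mul0r.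
  by have [->|y0] := eqVneq y 0; [rewrite mulr0 | apply].
apply: ideal_add_sub => //; first apply: ideal_add_sub => //.
- apply: ideal_gen_sub => // g [[i [j [ij ->]]]|[i [j [l [/andP[ij jl] ->]]]]];
    rewrite /K /=.
    rewrite sign_pred // mevalB !mevalM mevalN mevalM !rmorph_sign ?rmorphXn /= !mevalXU.
    set p := u _; set q := u _.
    have this : p * q = 0 \/ p = - ((-1) ^+ i * (-1) ^+ j) * q.
      have [->|p0] := eqVneq p 0; first by left; rewrite mul0r.
      have [->|q0] := eqVneq q 0; first by left; rewrite mulr0.
      by right; apply: opp => //; rewrite -(inj_eq val_inj) neq_ltn ij.
    have E : (p * q) * (p + (-1) ^+ i * (-1) ^+ j * q) = 0.
      by case: this => [->|->]; [rewrite mul0r | rewrite mulNr addNr mulr0].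
    by rewrite -[RHS]E; ring.
  rewrite !mevalM !mevalXU; apply: (K0) => /[swap] ul /[dup].
  rewrite mulf_eq0 negb_or => /andP[ui uj] _.
  have := inst i ui; have := inst j uj; have := inst l ul.
  have ni : pv i != pv j by rewrite (inj_eq pv_inj) -(inj_eq val_inj) neq_ltn ij.
  have nj : pv j != pv l by rewrite (inj_eq pv_inj) -(inj_eq val_inj) neq_ltn jl.
  have nl : pv i != pv l.
    by rewrite (inj_eq pv_inj) -(inj_eq val_inj) neq_ltn (ltn_trans ij jl).
  move=> /orP[]/eqP el /orP[]/eqP ej /orP[]/eqP ei;
    by move: ni nj nl; rewrite el ej ei eqxx.
- apply: ideal_gen_sub => // g [[[i [j [/andP[js jt] ->]]]|[j [l [i [jl ar ->]]]]]|
      [j [i [ar ->]]]]; rewrite /K /=.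
  + rewrite mevalM !mevalXU; apply: K0 => /arr/andP[/eqP es /eqP et] /inst.
    by rewrite -es -et (negPf js) (negPf jt).
  + rewrite mevalM; apply: K0 => _; rewrite mevalXU => /arr/andP[/eqP es /eqP et].
    rewrite sign_pred // mevalB !mevalM mevalN mevalM !rmorph_sign /= !mevalXU.
    have nl : l != j by rewrite -(inj_eq val_inj) neq_ltn jl orbT.
    have : xcoord (alternate u) (lift ord0 l) + xcoord (alternate u) (lift ord0 j) = 0.
      apply: xcoord_two => [|m]; first by rewrite (inj_eq lift_inj).
      rewrite -!(inj_eq v_inj) => ml mj; apply: hv; rewrite -?es -?et.
        by case/orP: ar => /andP[/eqP e1 /eqP e2]; rewrite ?e1 ?e2.
      by case/orP: ar => /andP[/eqP e1 /eqP e2]; rewrite ?e1 ?e2.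
    rewrite !xE => /(congr1 ( *%R ((-1) ^+ l))).
    rewrite mulr0 mulrDr mulrA -expr2 sqrr_sign mul1r => e.
    by rewrite [X in X * _](_ : _ = 0) ?mul0r // -[RHS]e; ring.
  rewrite mevalM !mevalXU; apply: K0 => uj /arr/andP[/eqP es /eqP et].
  rewrite uE (on_piece_single _ pst) ?mulr0 ?mul0r //.
  by move: ar => /andP[/eqP e1 /eqP e2]; rewrite -es -et e1 e2.
apply: ideal_gen_sub => // g [i [j [np ->]]]; rewrite /K /= mevalM !mevalXU.
apply: K0 => /arr/andP[/eqP es /eqP et] /arr/andP[/eqP es' /eqP et'].
by case/negP: np; rewrite /parallel es es' et et' !eqxx.
Qed.

Lemma sign_homog n m : (-1) ^+ m \is [in k[n], 0.-homog].
Proof.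
elim: m => [|m IH]; first exact: dhomog1.
rewrite exprS -[0%N]/(0 + 0)%N; apply: dhomogM => //.
by rewrite dhomogN dhomog1.
Qed.

Lemma var_homog i : ('X_i : R) \is 1.-homog.
Proof. by rewrite dhomogX /= mdeg1. Qed.

(** The generators are homogeneous, of degree 2 or 3. This reconciles X with [zclosed] and
    [vanishing_ideal], which are phrased in terms of forms. *)
Lemma X_sub (K : set R) : two_sided_ideal K ->
  (forall f, X f -> homogeneous f -> K f) -> X `<=` K.
Proof.
move=> TK h.
have V1 j : V j \is 1.-homog := var_homog _.
have A1 j : A j \is 1.-homog := var_homog _.
apply: ideal_add_sub => //; first apply: ideal_add_sub => //.
- apply: ideal_gen_sub => // g [[i [j [ij ->]]]|[i [j [l [ijl ->]]]]].
    apply: h; [exact: X_vv | exists 3%N; apply: rpredB].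
      by rewrite -[3%N]/(1 * 2 + 1)%N; apply: dhomogM => //; apply: dhomogMn.
    rewrite -[3%N]/(0 + 1 + 1 * 2)%N; apply: dhomogM; last exact: dhomogMn.
    by apply: dhomogM => //; apply: sign_homog.
  apply: h; [exact: X_vvv | exists (1 + 1 + 1)%N].
  by apply: dhomogM => //; apply: dhomogM.
- apply: ideal_gen_sub => // g [[[i [j [/andP[js jt] ->]]]|[j [l [i [jl ar ->]]]]]|
      [j [i [ar ->]]]].
  + by apply: h; [apply: X_av | exists (1 + 1)%N; apply: dhomogM].
  + apply: h; [exact: X_vva | exists (1 + 1)%N; apply: dhomogM => //].
    apply: rpredB => //; rewrite -[1%N]/(0 + 1)%N; apply: dhomogM => //.
    exact: sign_homog.
  + by apply: h; [apply: X_loop | exists (1 + 1)%N; apply: dhomogM].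
apply: ideal_gen_sub => // g [i [j [np ->]]].
by apply: h; [apply: X_aa | exists (1 + 1)%N; apply: dhomogM].
Qed.

Hypothesis v_surj : forall s, exists i, v i = s.

(** A nonzero arrow coordinate determines the pair, and the generators of [X_half] and [X_one] then
    confine everything else to it. Without one, [X_zero] leaves at most two nonzero vertex
    variables; if there is just one, v_0 is the other vertex of the pair. *)
Lemma on_piece_of_zero u : (forall f, X f -> f.@[u] = 0) ->
  exists s t, on_piece s t (alternate u).
Proof.
move=> h; have [x xdef] : exists x : 'I_n0 -> k,
    forall j, x j = alternate u (lshift n1 j) by eexists.
have xE j : xcoord (alternate u) (lift ord0 j) = x j by rewrite xcoord_lift xdef.
have uE j : u (lshift n1 j) = (-1) ^+ j * x j.
  by rewrite xdef /alternate mulrA -expr2 sqrr_sign mul1r.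
have signK (i : nat) (y : k) : (-1) ^+ i * y = 0 -> y = 0.
  by move=> /eqP; rewrite mulf_eq0 signr_eq0 => /eqP.
have F1 (i j : 'I_n0) : (i < j)%N -> x i * x j * (x i + x j) = 0.
  move=> ij; apply: (signK j); have := h _ (X_vv ij).
  rewrite sign_pred // mevalB !mevalM mevalN mevalM !rmorph_sign ?rmorphXn /= !mevalXU.
  rewrite !uE => <-; have si := sqrr_sign k i; have sj := sqrr_sign k j.
  ring: si sj.
have F1' i j : i != j -> x i != 0 -> x j != 0 -> x i + x j = 0.
  move=> ij xi xj; have e : x i * x j * (x i + x j) = 0.
    case: (ltngtP i j) => [|ji|/val_inj e]; first exact: F1.
      by rewrite (mulrC (x i)) (addrC (x i)) F1.
    by rewrite e eqxx in ij.
  by apply/eqP; move/eqP: e; rewrite !mulf_eq0 (negPf xi) (negPf xj).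
have F2 (i j l : 'I_n0) : (i < j)%N -> (j < l)%N -> x i * x j * x l = 0.
  move=> ij jl; have ijl : (i < j < l)%N by rewrite ij.
  have := h _ (X_vvv ijl); rewrite !mevalM !mevalXU !uE => e.
  apply: (signK i); apply: (signK j); apply: (signK l); rewrite -[RHS]e.
  ring.
have F2' i j l : i != j -> x i != 0 -> x j != 0 -> l != i -> l != j -> x l = 0.
  move=> ij xi xj li lj.
  have xij : x i * x j != 0 by rewrite mulf_neq0.
  have E : x i * x j * x l = 0.
    case: (ltngtP i j) ij => [ij _|ji _|/val_inj->]; last by rewrite eqxx.
      case: (ltngtP l i) li => [l_i _|i_l _|/val_inj->]; last by rewrite eqxx.
        by rewrite mulrC mulrA F2.
      case: (ltngtP l j) lj => [l_j _|j_l _|/val_inj->]; last by rewrite eqxx.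
        by rewrite mulrAC F2.
      exact: F2.
    case: (ltngtP l j) lj => [l_j _|j_l _|/val_inj->]; last by rewrite eqxx.
      by rewrite mulrC [x i * _]mulrC mulrA F2.
    case: (ltngtP l i) li => [l_i _|i_l _|/val_inj->]; last by rewrite eqxx.
      by rewrite [x i * _]mulrC mulrAC F2.
    by rewrite [x i * _]mulrC F2.
  by move/eqP: E; rewrite mulf_eq0 (negPf xij) => /eqP.
pose y i := u (rshift n0 i).
have F3 i j : y i != 0 -> pv j != src (a i) -> pv j != tgt (a i) -> x j = 0.
  move=> yi js jt; have := h _ (X_av js jt); rewrite mevalM !mevalXU => e.
  apply/eqP; have /eqP : y i * u (lshift n1 j) = 0 by apply: e.
  by rewrite mulf_eq0 (negPf yi) uE mulf_eq0 signr_eq0.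
have F4 i j l : y i != 0 -> j != l ->
    arrow_from_to (pv j) (pv l) (a i) || arrow_from_to (pv l) (pv j) (a i) ->
    x j + x l = 0.
  suff F (j' l' : 'I_n0) : (j' < l')%N -> y i != 0 ->
    arrow_from_to (pv j') (pv l') (a i) || arrow_from_to (pv l') (pv j') (a i) ->
    x j' + x l' = 0.
    move=> yi; case: (ltngtP j l) => [jl|lj|/val_inj->]; last by rewrite eqxx.
      by move=> _ /F; apply.
    by move=> _; rewrite orbC addrC => /F; apply.
  move=> jl yi ar; have := h _ (X_vva jl ar).
  rewrite sign_pred // mevalM mevalB mevalM mevalN mevalM !rmorph_sign /= !mevalXU !uE => e.
  have /eqP : (-1) ^+ l' * (x j' + x l') * y i = 0.
    rewrite -[RHS]e; have sj := sqrr_sign k j'; have sl := sqrr_sign k l'.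
    by rewrite /y; ring: sj sl.
  by rewrite !mulf_eq0 signr_eq0 (negPf yi) orbF => /eqP.
have F5 i j : y i != 0 -> arrow_from_to (pv j) (pv j) (a i) -> x j = 0.
  move=> yi ar; have := h _ (X_loop ar); rewrite mevalM !mevalXU => e.
  apply/eqP; have /eqP : u (lshift n1 j) * y i = 0 by apply: e.
  by rewrite mulf_eq0 (negPf yi) uE mulf_eq0 signr_eq0 orbF.
have F6 i j : y i != 0 -> ~~ parallel (a i) (a j) -> y j = 0.
  move=> yi np; have := h _ (X_aa np); rewrite mevalM !mevalXU => e.
  apply/eqP; have /eqP : y i * y j = 0 by apply: e.
  by rewrite mulf_eq0 (negPf yi).
(* The value at v_0 is minus the sum of the others, so it vanishes once the values on a set
   containing all nonzero ones cancel. *)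
have x00 (P : 'I_n0 -> bool) : (forall j, ~~ P j -> x j = 0) ->
    \sum_(j | P j) x j = 0 -> xcoord (alternate u) ord0 = 0.
  move=> hP hS; rewrite xcoord0 -(eq_bigr _ (fun j _ => xdef j)) (bigID P) /= hS.
  by rewrite big1 ?addr0 ?oppr0 // => j /hP.
have [[i /eqP yi]|noy] := pselect (exists i, y i <> 0).
  exists (src (a i)), (tgt (a i)); split; last first.
    move=> j nj; rewrite /alternate [u _](F6 _ _ yi) ?mulr0 //.
    by apply: contraNN nj => /andP[/eqP-> /eqP->]; rewrite /arrow_from_to !eqxx.
  move=> l; have [j ->|->] := unliftP ord0 l.
    by rewrite xE => js jt; apply: F3 yi js jt.
  move=> vs vt.
  pose P j := (pv j == src (a i)) || (pv j == tgt (a i)).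
  apply: (x00 P).
    by move=> j; rewrite negb_or => /andP[js jt]; apply: F3 yi js jt.
  have lifted s : v ord0 != s -> exists j, pv j = s.
    have [m <-] := v_surj s; have [j ->|->] := unliftP ord0 m; last by rewrite eqxx.
    by exists j.
  have [j js] := lifted _ vs; have [m mt] := lifted _ vt.
  (* j = m exactly when the arrow is a loop: then [F5] kills the value at its vertex, otherwise [F4]
     makes the two values opposite. *)
  have [jm|jm] := eqVneq j m; last first.
    rewrite (bigD1 j) /=; last by rewrite /P js eqxx.
    rewrite (bigD1 m) /=; last by rewrite /P mt eqxx orbT eq_sym.
    rewrite big1 ?addr0 => [|r /andP[/andP[Pr rj] rm]].
      by apply: (F4 i) => //; rewrite js mt /arrow_from_to !eqxx.
    by move: Pr; rewrite /P -js -mt !(inj_eq pv_inj) (negPf rj) (negPf rm).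
  rewrite big1 // => r; rewrite /P -js -mt -jm orbb (inj_eq pv_inj) => /eqP->.
  by apply: (F5 i) => //; rewrite /arrow_from_to -js -mt -jm eqxx.
have yall s t i : ~~ arrow_from_to s t (a i) -> alternate u (rshift n0 i) = 0.
  move=> _; rewrite /alternate -/(y i); apply: contrapT => h0; apply: noy.
  by exists i => yi; apply: h0; rewrite yi mulr0.
have [[j /eqP xj]|nox] := pselect (exists j, x j <> 0); last first.
  have x0 j : x j = 0 by apply: contrapT => h0; apply: nox; exists j.
  exists (v ord0), (v ord0); split; last exact: yall.
  move=> l; have [j ->|->] := unliftP ord0 l; last by rewrite eqxx.
  by rewrite xE x0.
have [[l [lj /eqP xl]]|nol] := pselect (exists l, l != j /\ x l <> 0); last first.
  exists (v ord0), (pv j); split; last exact: yall.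
  move=> i; have [l ->|->] := unliftP ord0 i; last by rewrite eqxx.
  rewrite /pvertex !(inj_eq v_inj) (inj_eq lift_inj) xE => _ lj.
  by apply: contrapT => xl; apply: nol; exists l.
have jl : j != l by rewrite eq_sym.
exists (pv j), (pv l); split; last exact: yall.
move=> i; have [m ->|->] := unliftP ord0 i.
  by rewrite !(inj_eq pv_inj) xE => mj ml; apply: F2' jl xj xl mj ml.
move=> _ _; apply: (x00 (fun m => (m == j) || (m == l))).
  by move=> m; rewrite negb_or => /andP[mj ml]; apply: F2' jl xj xl mj ml.
rewrite (bigD1 j) /= ?eqxx // (bigD1 l) /= ?eqxx ?orbT //.
rewrite big1 ?addr0 => [|m /andP[/andP[]]]; first exact: F1'.
by case/orP => /eqP->; rewrite eqxx.
Qed.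

(** * Retractions of the coordinate ring onto the pieces *)

Definition split_fun (T : Type) (fv : 'I_n0 -> T) (fa : 'I_n1 -> T) (i : 'I_(n0 + n1)) : T :=
  match split i with inl j => fv j | inr j => fa j end.

Lemma split_funl T (fv : 'I_n0 -> T) fa j : split_fun fv fa (lshift n1 j) = fv j.
Proof. by rewrite /split_fun (unsplitK (inl j)). Qed.

Lemma split_funr T (fv : 'I_n0 -> T) fa j : split_fun fv fa (rshift n0 j) = fa j.
Proof. by rewrite /split_fun (unsplitK (inr j)). Qed.

Definition subst (lq : 'I_(n0 + n1) -> R) (f : R) : R :=
  f \mPo [tuple lq i | i < n0 + n1].

Section Subst.
Variable lq : 'I_(n0 + n1) -> R.
Lemma substC c : subst lq c%:MP = c%:MP. Proof. exact: comp_mpolyC. Qed.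
Lemma subst0 : subst lq 0 = 0. Proof. exact: rmorph0. Qed.
Lemma substD : {morph subst lq : x y / x + y}. Proof. exact: rmorphD. Qed.
Lemma substB : {morph subst lq : x y / x - y}. Proof. exact: rmorphB. Qed.
Lemma substM : {morph subst lq : x y / x * y}. Proof. exact: rmorphM. Qed.
Lemma subst_sum (T : Type) (r : seq T) (P : pred T) (F : T -> R) :
  subst lq (\sum_(i <- r | P i) F i) = \sum_(i <- r | P i) subst lq (F i).
Proof. exact: rmorph_sum. Qed.
Lemma substXU i : subst lq 'X_i = lq i.
Proof. by rewrite /subst comp_mpolyXU -tnth_nth tnth_mktuple. Qed.
Lemma subst_eval f u : (subst lq f).@[u] = f.@[fun i => (lq i).@[u]].
Proof. by rewrite comp_mpoly_meval; apply: meval_eq => i; rewrite tnth_mktuple. Qed.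
End Subst.

Lemma subst_subst lq lr f : (forall i, subst lq (lr i) = lr i) ->
  subst lq (subst lr f) = subst lr f.
Proof.
move=> h; move: f; apply: mpoly_morph_ext => [c|x y|x y|x y|x y|i].
- by rewrite !substC.
- by rewrite !substD.
- exact: substD.
- by rewrite !substM.
- exact: substM.
- by rewrite !substXU.
Qed.

Definition kill_arrows : 'I_(n0 + n1) -> R := split_fun V (fun=> 0).
Local Notation kappa := (subst kill_arrows).

Definition diff_sign s t (r : vertex Q) : k := (r == s)%:R - (r == t)%:R.

Definition primary s t : vertex Q := if s == v ord0 then t else s.

(* The points of the piece of [(s, t)] have vertex coordinates proportional to
   [diff_sign s t]; [piece_subst true s t] retracts the coordinate ring onto
   that of the piece, using the vertex [primary s t] distinct from [v_0] as
   parameter, and [piece_subst false s t] onto that of its line. *)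
Definition piece_subst (b : bool) s t : 'I_(n0 + n1) -> R :=
  split_fun
    (fun j => ((-1) ^+ j * diff_sign s t (pv j) * diff_sign s t (primary s t)) *:
       \sum_(l | pv l == primary s t) (-1) ^+ l *: V l)
    (fun i => if b && arrow_from_to s t (a i) then A i else 0).

Lemma diff_sign_sum s t : \sum_i diff_sign s t (v i) = 0.
Proof.
have one r : \sum_i (v i == r)%:R = 1 :> k.
  have [m <-] := v_surj r; rewrite (bigD1 m) //= eqxx big1 ?addr0 // => i ne.
  by rewrite (inj_eq v_inj) (negPf ne).
by rewrite sumrB !one subrr.
Qed.

(** A polynomial vanishing on the piece therefore becomes, after the substitution, a polynomial with
    zero values everywhere, that is 0. *)
Lemma piece_subst_on_piece b s t u :
  on_piece s t (alternate (fun i => (piece_subst b s t i).@[u])).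
Proof.
pose z := diff_sign s t (primary s t) *
  \sum_(l | pv l == primary s t) (-1) ^+ l * u (lshift n1 l).
have xj j : alternate (fun i => (piece_subst b s t i).@[u]) (lshift n1 j) =
    diff_sign s t (pv j) * z.
  rewrite /alternate /piece_subst split_funl mevalZ raddf_sum /=.
  under eq_bigr => l _ do rewrite mevalZ mevalXU.
  by rewrite -/z !mulrA -expr2 sqrr_sign mul1r -mulrA.
have xi i : xcoord (alternate (fun i => (piece_subst b s t i).@[u])) i =
    diff_sign s t (v i) * z.
  have [j ->|->] := unliftP ord0 i; first by rewrite xcoord_lift xj.
  rewrite xcoord0 (eq_bigr _ (fun j _ => xj j)) -mulr_suml -mulNr; congr (_ * _).
  apply/eqP; rewrite eq_sym -addr_eq0 -[X in _ == X](diff_sign_sum s t).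
  by rewrite big_ord_recl.
split=> i.
  by rewrite xi /diff_sign => /negPf-> /negPf->; rewrite subrr mul0r.
move=> /negPf na; rewrite /alternate /piece_subst split_funr na andbF meval0.
by rewrite mulr0.
Qed.

Lemma piece_substV b s t m l : pv m = primary s t ->
  piece_subst b s t (lshift n1 l) =
  ((-1) ^+ l * (-1) ^+ m * diff_sign s t (pv l) * diff_sign s t (pv m)) *: V m.
Proof.
move=> e; rewrite /piece_subst split_funl -e (big_pred1 m); last first.
  by move=> l'; rewrite /= (inj_eq pv_inj).
by rewrite scalerA; congr (_ *: _); ring.
Qed.

Lemma piece_substA b s t i : piece_subst b s t (rshift n0 i) =
  if b && arrow_from_to s t (a i) then A i else 0.
Proof. by rewrite /piece_subst split_funr. Qed.

Lemma X_mull f g : X f -> X (g * f).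
Proof. by case: X_two_sided => _ _ /[apply] /(_ g)[]. Qed.

Lemma X_add f g : X f -> X g -> X (f + g).
Proof. by case: X_two_sided => _ + _; apply. Qed.

Lemma X_0 : X 0.
Proof. by case: X_two_sided. Qed.

Lemma subst_id f : subst (fun i => 'X_i) f = f.
Proof. exact: comp_mpoly_id. Qed.

(** Substitutions that agree on the variables modulo X after multiplication by e agree so on all
    polynomials; [product_difference] is the Leibniz-type identity behind the induction step. *)
Lemma X_subst_congr e lq lr : (forall i, X (e * (lq i - lr i))) ->
  forall f, X (e * (subst lq f - subst lr f)).
Proof.
move=> h; apply: mpoly_ind => [c|f g hf hg|i f hf].
- by rewrite !substC subrr mulr0; apply: X_0.
- rewrite (substD lq f g) (substD lr f g) opprD addrACA mulrDr.
  exact: X_add hf hg.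
rewrite !substM !substXU.
rewrite product_difference.
by apply: X_add; apply: X_mull.
Qed.

Lemma signMsign (i : nat) : (-1) ^+ i * (-1) ^+ i = 1 :> k.
Proof. by rewrite -expr2 sqrr_sign. Qed.

Lemma X_vva_sym i j l : j != l -> arrow_from_to (pv j) (pv l) (a i) ||
    arrow_from_to (pv l) (pv j) (a i) ->
  X (A i * (V j + ((-1) ^+ j * (-1) ^+ l) *: V l)).
Proof.
move=> jl ar; case: (ltngtP j l) => [lt|lt|/val_inj e]; last by rewrite e eqxx in jl.
  have := X_mull ((-1) ^+ j * (-1) ^+ l)%:MP (X_vva lt ar); congr (X _).
  rewrite sign_pred // -mul_mpolyC rmorphM !rmorph_sign.
  have sj := sqrr_sign R j; have sl := sqrr_sign R l; ring: sj sl.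
rewrite orbC in ar; have := X_vva lt ar; congr (X _).
rewrite sign_pred // -mul_mpolyC rmorphM !rmorph_sign; ring.
Qed.

Lemma diff_signK s t r : s != t -> (r == s) || (r == t) ->
  diff_sign s t r * diff_sign s t r = 1.
Proof.
move=> st /orP[]/eqP->; rewrite /diff_sign eqxx ?(negPf st) ?[t == s]eq_sym ?(negPf st).
  by rewrite subr0 mulr1.
by rewrite sub0r mulrNN mulr1.
Qed.

Lemma diff_signN s t : s != t -> diff_sign s t s * diff_sign s t t = -1.
Proof.
move=> st; rewrite /diff_sign !eqxx (negPf st) [t == s]eq_sym (negPf st).
by rewrite subr0 sub0r mul1r.
Qed.

Lemma primary_lift s t : s != t -> exists m, pv m = primary s t.
Proof.
move=> st; rewrite /primary; case: eqP => [s0|/eqP s0].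
  have [i it] := v_surj t; have [j ij|i0] := unliftP ord0 i.
    by exists j; rewrite -it ij.
  by rewrite s0 -it i0 eqxx in st.
have [i it] := v_surj s; have [j ij|i0] := unliftP ord0 i.
  by exists j; rewrite -it ij.
by rewrite -it i0 eqxx in s0.
Qed.

(** Checked on variables. Arrows not parallel to [a i] are killed by [X_one], vertices other than s
    and t by the first generators of [X_half], the vertex of a loop by the third ones; the second
    ones express one end through the other when both are variables. *)
Lemma X_arrow_subst s t i f : arrow_from_to s t (a i) ->
  X (A i * (f - subst (piece_subst true s t) f)).
Proof.
move=> ar; rewrite -{1}[f]subst_id; apply: X_subst_congr => {f} l.
case: (split_ordP l) => [j ->|j ->]; last first.
  rewrite piece_substA; case: ifPn => /= arj.
    by rewrite subrr mulr0; apply: X_0.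
  rewrite subr0; apply: X_aa; apply: contraNN arj => /andP[/eqP es /eqP et].
  by rewrite /arrow_from_to -es -et.
have [/eqP es /eqP et] := andP ar.
have [st|st] := eqVneq s t.
  rewrite /piece_subst split_funl {1}/diff_sign -st subrr mulr0 mul0r scale0r subr0.
  have [js|js] := eqVneq (pv j) s.
    by rewrite mulrC; apply: X_loop; rewrite js {2}st.
  by apply: X_av; rewrite ?es ?et -?st.
have [m mp] := primary_lift st; rewrite (piece_substV _ _ mp).
have pst : (primary s t == s) || (primary s t == t).
  by rewrite /primary; case: ifP; rewrite eqxx ?orbT.
have [jp|jp] := eqVneq (pv j) (primary s t).
  have -> : j = m by apply: pv_inj; rewrite jp mp.
  rewrite signMsign mul1r diff_signK ?mp // scale1r subrr mulr0; exact: X_0.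
have [jst|] := boolP ((pv j == s) || (pv j == t)); last first.
  rewrite negb_or => /andP[js jt]; rewrite /diff_sign (negPf js) (negPf jt) subrr.
  by rewrite mulr0 mul0r scale0r subr0; apply: X_av; rewrite ?es ?et.
have jm : j != m by rewrite -(inj_eq pv_inj) mp.
have dN : diff_sign s t (pv j) * diff_sign s t (pv m) = -1.
  rewrite mp in jp *; case/orP: jst pst jp => /eqP-> /orP[]/eqP->; rewrite ?eqxx //.
    by rewrite diff_signN.
  by rewrite mulrC diff_signN.
rewrite -mulrA dN mulrN1 scaleNr opprK; apply: X_vva_sym => //.
move: jp jst pst; rewrite -mp /arrow_from_to es et => /[swap] /orP[]/eqP->.
  by move=> /negPf sm /orP[/eqP e|/eqP ->]; [rewrite e eqxx in sm | rewrite !eqxx].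
by move=> /negPf sm /orP[/eqP -> |/eqP e]; [rewrite !eqxx orbT | rewrite e eqxx in sm].
Qed.

Lemma kill_arrowsV j : kill_arrows (lshift n1 j) = V j.
Proof. exact: split_funl. Qed.

Lemma kill_arrowsA i : kill_arrows (rshift n0 i) = 0.
Proof. exact: split_funr. Qed.

Lemma X_vvv_sym (i j l : 'I_n0) : (i < j)%N -> l != i -> l != j ->
  X (V i * V j * V l).
Proof.
move=> ij li lj; case: (ltngtP l i) => [lt_li|lt_il|/val_inj e]; last by rewrite e eqxx in li.
  rewrite mulrC mulrA; apply: X_vvv; first by rewrite lt_li.
case: (ltngtP l j) => [lt_lj|lt_jl|/val_inj e]; last by rewrite e eqxx in lj.
  by rewrite mulrAC; apply: X_vvv; rewrite lt_il.
by apply: X_vvv; rewrite ij.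
Qed.

Lemma pv_neq0 j : (pv j == v ord0) = false.
Proof. by rewrite /pvertex (inj_eq v_inj). Qed.

(** Checked on variables. A third vertex is killed by the cubic monomials of [X_zero], and the cubic
    binomial exchanges v_j for a multiple of v_i. *)
Lemma X_vertex_subst (i j : 'I_n0) f : (i < j)%N ->
  X (V i * V j * (kappa f - subst (piece_subst false (pv i) (pv j)) f)).
Proof.
move=> ij; apply: X_subst_congr => {f} l.
case: (split_ordP l) => [m ->|m ->]; last first.
  by rewrite kill_arrowsA piece_substA subrr mulr0; apply: X_0.
have nij : pv i != pv j by rewrite (inj_eq pv_inj) -(inj_eq val_inj) neq_ltn ij.
have ip : pv i = primary (pv i) (pv j) by rewrite /primary pv_neq0.
rewrite kill_arrowsV (piece_substV _ _ ip).
have [->|mi] := eqVneq m i.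
  rewrite signMsign mul1r diff_signK ?eqxx // scale1r subrr mulr0; exact: X_0.
have [->|mj] := eqVneq m j; last first.
  rewrite /diff_sign !(inj_eq pv_inj) (negPf mi) (negPf mj) subrr mulr0 mul0r scale0r.
  by rewrite subr0; apply: X_vvv_sym.
rewrite -mulrA [diff_sign _ _ _ * _]mulrC diff_signN // mulrN1 scaleNr opprK.
have := X_mull ((-1) ^+ j * (-1) ^+ i)%:MP (X_vv ij); congr (X _).
rewrite sign_pred // -mul_mpolyC rmorphM !rmorph_sign.
have sj := sqrr_sign R j; have si := sqrr_sign R i.
by move: ((-1) ^+ i) ((-1) ^+ j) (V i) (V j) si sj => x y p q si sj; ring: si sj.
Qed.

Lemma arrow_expansion f : exists g : 'I_n1 -> R, f - kappa f = \sum_i A i * g i.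
Proof.
elim/mpoly_ind: f => [c|f h [g fE] [g' hE]|l f [g fE]].
- by exists (fun=> 0); rewrite substC subrr big1 // => i _; rewrite mulr0.
- exists (fun i => g i + g' i); rewrite (substD _ f h) opprD addrACA fE hE -big_split.
  by apply: eq_bigr => i _; rewrite mulrDr.
rewrite substM substXU; case: (split_ordP l) => [j ->|j ->].
  exists (fun i => V j * g i); rewrite kill_arrowsV -mulrBr fE mulr_sumr.
  by apply: eq_bigr => i _; rewrite mulrCA.
exists (fun i => if i == j then f else 0); rewrite kill_arrowsA mul0r subr0.
rewrite (bigD1 j) //= eqxx big1 ?addr0 // => i /negPf->.
by rewrite mulr0.
Qed.

(** The coefficients pass through [kappa] because [X_vertex_subst] compares a polynomial with its
    restriction to a line only after the arrows are removed. *)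
Definition quadratic (f : R) : Prop := exists g : 'I_n0 -> 'I_n0 -> R,
  f = \sum_(i < n0) \sum_(j < n0 | (i < j)%N) V i * V j * kappa (g i j).

Lemma quadratic0 : quadratic 0.
Proof.
by exists (fun _ _ => 0); rewrite big1 // => i _; rewrite big1 // => j _; rewrite subst0 mulr0.
Qed.

Lemma quadraticD f h : quadratic f -> quadratic h -> quadratic (f + h).
Proof.
move=> [g ->] [g' ->]; exists (fun i j => g i j + g' i j).
rewrite -big_split; apply: eq_bigr => i _; rewrite -big_split; apply: eq_bigr => j _.
by rewrite (substD _ (g i j)) mulrDr.
Qed.

Lemma quadraticV l f : quadratic f -> quadratic (V l * f).
Proof.
move=> [g ->]; exists (fun i j => V l * g i j).
rewrite mulr_sumr; apply: eq_bigr => i _; rewrite mulr_sumr; apply: eq_bigr => j _.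
by rewrite (substM _ (V l)) substXU kill_arrowsV mulrCA.
Qed.

Lemma quadratic_pair (i j : 'I_n0) h : i != j -> quadratic (V i * V j * kappa h).
Proof.
suff main (i' j' : 'I_n0) : (i' < j')%N -> quadratic (V i' * V j' * kappa h).
  case: (ltngtP i j) => [lt _|lt _|/val_inj->]; [exact: main | | by rewrite eqxx].
  by rewrite (mulrC (V i)); apply: main.
move=> lt; exists (fun x y => if (x == i') && (y == j') then h else 0).
rewrite (bigD1 i') //= [X in _ + X]big1 ?addr0 => [|x /negPf nx]; last first.
  by rewrite big1 // => y _; rewrite nx subst0 mulr0.
rewrite (bigD1 j') //= !eqxx [X in _ + X]big1 ?addr0 // => y /andP[_ /negPf ny].
by rewrite ny subst0 mulr0.
Qed.

(** The line of e_0 - e_j is the axis of the variable v_j, since v_0 has no variable; the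
    substitution sets all other variables to 0. *)
Definition axis_subst j := piece_subst false (v ord0) (pv j).
Local Notation sigma j := (subst (axis_subst j)).

Lemma axis_substV j l : axis_subst j (lshift n1 l) = if l == j then V j else 0.
Proof.
have jp : pv j = primary (v ord0) (pv j) by rewrite /primary eqxx.
rewrite /axis_subst (piece_substV _ _ jp).
have nj : v ord0 != pv j by rewrite eq_sym pv_neq0.
have [->|lj] := eqVneq l j.
  by rewrite signMsign mul1r diff_signK ?eqxx ?orbT // scale1r.
by rewrite /diff_sign pv_neq0 (inj_eq pv_inj) (negPf lj) subrr mulr0 mul0r scale0r.
Qed.

Lemma axis_substA j i : axis_subst j (rshift n0 i) = 0.
Proof. exact: piece_substA. Qed.

Lemma kill_axis j f : kappa (sigma j f) = sigma j f.
Proof.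
apply: subst_subst => l; case: (split_ordP l) => [m ->|m ->].
  by rewrite axis_substV; case: ifP => _; rewrite ?subst0 // substXU kill_arrowsV.
by rewrite axis_substA subst0.
Qed.

Definition cst (f : R) : R := (f.@[fun=> 0])%:MP.

Lemma cstD f h : cst (f + h) = cst f + cst h.
Proof. by rewrite /cst mevalD mpolyCD. Qed.

Lemma cst_var l f : cst ('X_l * f) = 0.
Proof. by rewrite /cst mevalM mevalXU mul0r mpolyC0. Qed.

Lemma axis_expansion j f : exists h, sigma j f - cst f = V j * kappa h.
Proof.
elim/mpoly_ind: f => [c|f h [g fE] [g' hE]|l f [g fE]].
- by exists 0; rewrite /cst substC mevalC subrr subst0 mulr0.
- by exists (g + g'); rewrite (substD _ f) cstD opprD addrACA fE hE (substD _ g) mulrDr.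
rewrite cst_var subr0 substM substXU; case: (split_ordP l) => [m ->|m ->].
  rewrite axis_substV; case: ifP => _; last by exists 0; rewrite subst0 mulr0 mul0r.
  exists (sigma j f); rewrite (kill_axis j f); reflexivity.
by exists 0; rewrite axis_substA subst0 mulr0 mul0r.
Qed.

(** What remains of f without arrows, constant term and pure powers of single vertices: the
    monomials in at least two distinct vertices. *)
Definition cross_part (f : R) : R :=
  kappa f - cst f - \sum_j (sigma j f - cst f).

Lemma cross_part_quadratic f : quadratic (cross_part f).
Proof.
elim/mpoly_ind: f => [c|f h qf qh|l f qf].
- rewrite /cross_part substC {1}/cst mevalC subrr big1 ?subr0; first exact: quadratic0.
  by move=> j _; rewrite substC /cst mevalC subrr.
- have -> : cross_part (f + h) = cross_part f + cross_part h.
    rewrite /cross_part (substD _ f) cstD opprD addrACA.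
    rewrite (eq_bigr (fun j => (sigma j f - cst f) + (sigma j h - cst h))).
      by rewrite big_split opprD; apply: addrACA.
    by move=> j _; rewrite (substD _ f) ?opprD addrACA.
  exact: quadraticD.
rewrite /cross_part cst_var substM substXU; under eq_bigr => j _ do
  rewrite substM substXU subr0.
case: (split_ordP l) => [m ->|m ->]; last first.
  rewrite kill_arrowsA mul0r subrr big1 ?subr0; first exact: quadratic0.
  by move=> j _; rewrite axis_substA mul0r.
have z : \sum_j axis_subst j (lshift n1 m) * sigma j f = V m * sigma m f.
  rewrite (bigD1 m) //= axis_substV eqxx big1 ?addr0 // => j jm.
  by rewrite axis_substV eq_sym (negPf jm) mul0r.
rewrite kill_arrowsV subr0 z.
(* Multiplication by V m turns the pure powers of the other vertices into mixed monomials, which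
   join the cross part. *)
have -> : V m * kappa f - V m * sigma m f =
    V m * cross_part f + \sum_(j | j != m) V m * (sigma j f - cst f).
  rewrite -mulr_sumr -mulrDr -mulrBr /cross_part (bigD1 m) //= opprD addrA subrK.
  by rewrite opprB addrA subrK.
apply: quadraticD; first exact: quadraticV.
elim/big_ind: _ => [||j jm]; [exact: quadratic0 | exact: quadraticD |].
have [h ->] := axis_expansion j f.
by rewrite mulrA; apply: quadratic_pair; rewrite eq_sym.
Qed.

Lemma X_complete f :
  (forall u, (exists s t, on_piece s t (alternate u)) -> f.@[u] = 0) -> X f.
Proof.
move=> h.
have piece0 b s t : subst (piece_subst b s t) f = 0.
  apply: mpoly_eq0_eval => u; rewrite subst_eval; apply: h.
  by exists s, t; apply: piece_subst_on_piece.
(* The zero vector lies on every piece. *)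
have cst0 : cst f = 0.
  rewrite /cst h ?mpolyC0 //; exists (v ord0), (v ord0); split=> i _.
    move=> _; rewrite /xcoord; case: unlift => [j|].
      by rewrite /alternate mulr0.
    by rewrite big1 ?oppr0 // => j _; rewrite /alternate mulr0.
  by rewrite /alternate mulr0.
have Xk : X (kappa f).
  have [g kE] := cross_part_quadratic f.
  move: (kE); rewrite /cross_part cst0 big1 ?subr0; last first.
    by move=> j _; rewrite subr0; apply: piece0.
  move=> kfE; rewrite kfE; apply: two_sided_sum X_two_sided _ => i _.
  apply: two_sided_sum X_two_sided _ => j ij.
  have tk p : subst (piece_subst false (pv i) (pv j)) (kappa p) =
      subst (piece_subst false (pv i) (pv j)) p.
    move: p; apply: mpoly_morph_ext => [c|x y|x y|x y|x y|l].
    - by rewrite !substC.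
    - by rewrite !substD.
    - exact: substD.
    - by rewrite !substM.
    - exact: substM.
    rewrite !substXU; case: (split_ordP l) => [m ->|m ->].
      by rewrite kill_arrowsV substXU.
    by rewrite kill_arrowsA subst0 piece_substA.
  (* Restricting the expansion of [kappa f] to the line of the pair leaves only the term of i and j,
     namely a nonzero constant times (V i)^2 times the restriction of [g i j], and the polynomial
     ring is a domain. *)
  suff g0 : subst (piece_subst false (pv i) (pv j)) (g i j) = 0.
    by have := X_vertex_subst (g i j) ij; rewrite g0 subr0.
  have ip : pv i = primary (pv i) (pv j) by rewrite /primary pv_neq0.
  have nij : pv i != pv j by rewrite (inj_eq pv_inj) -(inj_eq val_inj) neq_ltn ij.
  have tV l : subst (piece_subst false (pv i) (pv j)) (V l) =
      ((-1) ^+ l * (-1) ^+ i * diff_sign (pv i) (pv j) (pv l) *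
       diff_sign (pv i) (pv j) (pv i)) *: V i.
    by rewrite substXU (piece_substV _ _ ip).
  have tV0 l : l != i -> l != j -> subst (piece_subst false (pv i) (pv j)) (V l) = 0.
    move=> li lj; rewrite tV /diff_sign !(inj_eq pv_inj) (negPf li) (negPf lj).
    by rewrite subrr mulr0 mul0r scale0r.
  have := tk f; rewrite piece0 kfE subst_sum.
  rewrite (bigD1 i) //= [X in _ + X]big1 ?addr0 => [|l li]; last first.
    rewrite subst_sum big1 // => m lm; rewrite !substM.
    have [lj|lj] := eqVneq l j; last by rewrite tV0 ?mul0r.
    rewrite [X in _ * X * _]tV0 ?mulr0 ?mul0r //.
      by rewrite -(inj_eq val_inj) neq_ltn (ltn_trans ij) ?orbT // -lj.
    by rewrite -lj -(inj_eq val_inj) neq_ltn lm orbT.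
  rewrite subst_sum (bigD1 j) //= [X in _ + X]big1 ?addr0 => [|m /andP[im mj]]; last first.
    rewrite !substM [X in _ * X * _]tV0 ?mulr0 ?mul0r //.
    by rewrite -(inj_eq val_inj) neq_ltn im orbT.
  rewrite !substM tk !tV => /eqP.
  rewrite mulf_eq0 => /orP[|/eqP //]; rewrite -scalerAl -scalerAr !scaler_eq0.
  have c0 l : (l == i) || (l == j) -> ((-1) ^+ l * (-1) ^+ i *
      diff_sign (pv i) (pv j) (pv l) * diff_sign (pv i) (pv j) (pv i) == 0 :> k) = false.
    move=> lij; apply/negbTE; rewrite !mulf_neq0 ?signr_eq0 //.
      have := @diff_signK (pv i) (pv j) (pv l) nij; rewrite !(inj_eq pv_inj) => /(_ lij) e.
      by apply: contraNneq (oner_neq0 k) => z; rewrite -e z mul0r.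
    have := @diff_signK (pv i) (pv j) (pv i) nij; rewrite eqxx => /(_ isT) e.
    by apply: contraNneq (oner_neq0 k) => z; rewrite -e z mul0r.
  rewrite !c0 ?eqxx ?orbT //= mulf_eq0 orbb => /eqP V0.
  have := congr1 (fun p : R => p.@[fun=> 1]) V0; rewrite mevalXU meval0 => /eqP.
  by rewrite oner_eq0.
have [g gE] := arrow_expansion f.
rewrite -(subrK (kappa f) f); apply: X_add => //.
have pk b s t : subst (piece_subst b s t) (kappa f) = subst (piece_subst false s t) f.
  move: f {h piece0 cst0 Xk g gE}; apply: mpoly_morph_ext => [c|x y|x y|x y|x y|l].
  - by rewrite !substC.
  - by rewrite !substD.
  - exact: substD.
  - by rewrite !substM.
  - exact: substM.
  rewrite !substXU; case: (split_ordP l) => [m ->|m ->].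
    by rewrite kill_arrowsV substXU /piece_subst !split_funl.
  by rewrite kill_arrowsA subst0 piece_substA.
have pg s t : subst (piece_subst true s t) (\sum_i A i * g i) = 0.
  by rewrite -gE substB pk !piece0 subrr.
have cl i : A i * g i - A i * subst (piece_subst true (src (a i)) (tgt (a i))) (g i) =
    A i * (g i - subst (piece_subst true (src (a i)) (tgt (a i))) (g i)).
  by rewrite mulrBr.
have Xi i : X (A i * g i - A i * subst (piece_subst true (src (a i)) (tgt (a i))) (g i)).
  by rewrite cl; apply: X_arrow_subst; rewrite /arrow_from_to !eqxx.
(* The restricted terms need not vanish one by one: those with a common pair (s, t) add up to the
   restriction of f - kappa f to that piece, which is 0. *)
suff E : \sum_i A i * subst (piece_subst true (src (a i)) (tgt (a i))) (g i) = 0.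
  rewrite gE -[\sum_i _]subr0 -[Y in _ - Y]E -sumrB.
  by apply: two_sided_sum X_two_sided _ => i _; apply: Xi.
rewrite (partition_big (fun i => (src (a i), tgt (a i))) predT) //=.
apply: big1 => -[s t] _; rewrite -[RHS](pg s t) subst_sum.
rewrite [RHS](bigID (fun i => (src (a i), tgt (a i)) == (s, t))) /=.
rewrite [X in _ = _ + X]big1 ?addr0 => [|i ne].
  apply: eq_bigr => i /eqP[es et]; rewrite substM substXU piece_substA.
  by rewrite /arrow_from_to es et !eqxx.
rewrite substM substXU piece_substA /= /arrow_from_to -xpair_eqE (negPf ne).
by rewrite mul0r.
Qed.

(* When there is no arrow from [s] to [t] but there is one from [t] to [s], the
   piece of [(s, t)] is contained in that of [(t, s)]. *)
Definition maximal_piece (p : vertex Q * vertex Q) : bool :=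
  [exists b, arrow_from_to p.1 p.2 b] ||
  (p.1 != p.2) && ~~ [exists b, arrow_from_to p.2 p.1 b].

Lemma on_piece_swap s t w : (forall i, ~~ arrow_from_to s t (a i)) ->
  on_piece s t w -> on_piece t s w.
Proof.
move=> na [hv ha]; split=> i; first by move=> ? ?; apply: hv.
by move=> _; apply: ha.
Qed.

(** A pair fails to be maximal either because s = t carries no loop, and then its piece is zero, or
    because arrows go from t to s only, and then its piece lies in that of (t, s). *)
Lemma maximal_piece_exists s t w : on_piece s t w -> (exists i, w i != 0) ->
  exists2 p, maximal_piece p & on_piece p.1 p.2 w.
Proof.
move=> pw [i wi]; have [m|] := boolP (maximal_piece (s, t)); first by exists (s, t).
rewrite negb_or negb_exists => /andP[/forallP nst]; rewrite negb_and 2!negbK /=.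
have ar0 j : w (rshift n0 j) = 0 by apply: pw.2.
case/orP => [/eqP st|ex]; last first.
  exists (t, s); first by rewrite /maximal_piece ex.
  by apply: on_piece_swap pw => j; apply: nst.
case/eqP: wi; case: (split_ordP i) => [j ->|j ->]; last exact: ar0.
by rewrite -xcoord_lift; apply: on_piece_single pw st.
Qed.

Definition diff_point s t : 'I_(n0 + n1) -> k :=
  split_fun (fun j => diff_sign s t (pv j)) (fun=> 0).

Lemma xcoord_diff_point s t i : xcoord (diff_point s t) i = diff_sign s t (v i).
Proof.
have [j ->|->] := unliftP ord0 i; first by rewrite xcoord_lift /diff_point split_funl.
rewrite xcoord0; apply/eqP; rewrite eq_sym -addr_eq0 -[X in _ == X](diff_sign_sum s t).
rewrite big_ord_recl; apply/eqP; congr (_ + _).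
by apply: eq_bigr => j _; rewrite /diff_point split_funl.
Qed.

Lemma diff_point_on_piece s t : on_piece s t (diff_point s t).
Proof.
split=> i; last by rewrite /diff_point split_funr.
by rewrite xcoord_diff_point /diff_sign => /negPf-> /negPf->; rewrite subrr.
Qed.

Definition arrow_point (i : 'I_n1) : 'I_(n0 + n1) -> k :=
  split_fun (fun=> 0) (fun j => (j == i)%:R).

Lemma arrow_point_on_piece s t i : arrow_from_to s t (a i) -> on_piece s t (arrow_point i).
Proof.
move=> st; split=> j.
  move=> _ _; rewrite /xcoord; case: unlift => [m|]; first by rewrite /arrow_point split_funl.
  by rewrite big1 ?oppr0 // => m _; rewrite /arrow_point split_funl.
move=> na; rewrite /arrow_point split_funr; case: eqP => // e.
by rewrite e st in na.
Qed.

Hypothesis a_surj : forall b, exists i, a i = b.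

Lemma maximal_piece_neq0 p : maximal_piece p ->
  exists2 w, on_piece p.1 p.2 w & exists i, w i != 0.
Proof.
case: p => s t /orP[/existsP[b]|/andP[/= st _]].
  have [i <-] := a_surj b => ar; exists (arrow_point i); first exact: arrow_point_on_piece.
  by exists (rshift n0 i); rewrite /arrow_point split_funr eqxx oner_neq0.
exists (diff_point s t); first exact: diff_point_on_piece.
have [m mp] := primary_lift st; exists (lshift n1 m).
rewrite /diff_point split_funl mp; apply/negP => /eqP z.
have pst : (primary s t == s) || (primary s t == t).
  by rewrite /primary; case: ifP; rewrite eqxx ?orbT.
by have := diff_signK st pst; rewrite z mul0r => /eqP; rewrite eq_sym oner_eq0.
Qed.

(** An arrow point lies only on pieces of the pair of its arrow. Without arrows from s to t,
    [diff_point] forces {s', t'} = {s, t}, and the two orders give the same piece because no arrow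
    goes from t to s either. *)
Lemma maximal_piece_incomparable p q : maximal_piece p -> maximal_piece q ->
  (forall w, on_piece p.1 p.2 w -> on_piece q.1 q.2 w) ->
  forall w, on_piece q.1 q.2 w -> on_piece p.1 p.2 w.
Proof.
case: p q => s t [s' t'] /= mp mq sub.
have [/existsP[b]|na] := boolP [exists b, arrow_from_to s t b].
  have [i <-] := a_surj b => ar; have /sub[_ /(_ i)] := arrow_point_on_piece ar.
  rewrite /arrow_point split_funr eqxx => h.
  have ar' : arrow_from_to s' t' (a i).
    by apply: contraT => /h /eqP; rewrite oner_eq0.
  by move: ar ar' => /andP[/eqP <- /eqP <-] /andP[/eqP <- /eqP <-].
move: mp; rewrite /maximal_piece (negPf na) /= => /andP[st nb].
have in' r : diff_sign s t r != 0 -> (r == s') || (r == t').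
  have [i <-] := v_surj r; apply: contraNT; rewrite negb_or => /andP[rs rt].
  have [h _] := sub _ (diff_point_on_piece s t).
  by rewrite -xcoord_diff_point h.
have ds : (s == s') || (s == t').
  by apply: in'; rewrite /diff_sign eqxx (negPf st) subr0 oner_neq0.
have dt : (t == s') || (t == t').
  by apply: in'; rewrite /diff_sign eqxx [t == s]eq_sym (negPf st) sub0r oppr_eq0 oner_neq0.
move/orP: ds => [/eqP es|/eqP es]; move/orP: dt => [/eqP et|/eqP et].
- by rewrite es et eqxx in st.
- by rewrite -es -et.
- move=> w; rewrite -es -et; apply: on_piece_swap => i.
  by move: nb; rewrite negb_exists => /forallP; apply.
by rewrite es et eqxx in st.
Qed.

Definition xform (i : 'I_n0.+1) : R :=
  if unlift ord0 i is Some j then V j else - \sum_j V j.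

Lemma xformE i w : (xform i).@[w] = xcoord w i.
Proof.
rewrite /xform /xcoord; case: unlift => [j|]; first by rewrite mevalXU.
rewrite mevalN; congr (- _); rewrite raddf_sum /=.
by apply: eq_bigr => j _; rewrite mevalXU.
Qed.

Lemma on_piece_linear s t : exists2 F : set R, F `<=` [set f | f \is 1.-homog] &
  on_piece s t = [set w | forall f, F f -> f.@[w] = 0].
Proof.
exists ([set xform i | i in [set i | v i != s /\ v i != t]] `|`
        [set A i | i in [set i | ~~ arrow_from_to s t (a i)]]).
  move=> f [[i _ <-]|[i _ <-]] /=; last exact: var_homog.
  rewrite /xform; case: unlift => [j|]; first exact: var_homog.
  by rewrite rpredN; apply: rpred_sum => j _; apply: var_homog.
apply/seteqP; split=> w.
  move=> [hv ha] f [[i [is_ it] <-]|[i na <-]]; first by rewrite xformE hv.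
  by rewrite mevalXU ha.
move=> h; split=> i.
  by move=> is_ it; rewrite -xformE; apply: h; left; exists i.
by move=> na; have := h (A i); rewrite mevalXU; apply; right; exists i.
Qed.

End UnionIdeal.

(** * Coordinates of codimension-one subalgebras *)

Section AlgebraChart.
Variables (k : closedFieldType) (Q : quiver) (B : falgType k).
Variables (E : vertex Q -> B) (X : arrow Q -> B) (D : truncation E X).
Variables (n0 n1 : nat) (v : 'I_n0.+1 -> vertex Q) (a : 'I_n1 -> arrow Q).
Hypotheses (v_bij : bijective v) (a_bij : bijective a).
Local Notation AG := (alg_gr B (\dim {: B}).-1).
Local Notation hf := (@hyperplane_functional k B).
Implicit Types (f g : 'Hom(B, k^o)) (A : {vspace B}) (s t : vertex Q).

Lemma dim_algebra_gt0 : (0 < \dim {: B})%N.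
Proof.
rewrite lt0n dimv_eq0 -subv0; apply/negP => /subvP/(_ 1 (memvf _)).
by rewrite memv0 oner_eq0.
Qed.

(** Their kernels are exactly the subalgebras of codimension one; this is the dictionary between
    points and functionals. *)
Definition alg_functional f : Prop :=
  [/\ f != 0, f 1 = 0 :> k, kills_J2 f & exists s t, supported E X s t f].

Lemma alg_functional_pts f : alg_functional f -> pts AG (lker f).
Proof.
move=> [f0 f1 fJ [s [t fst]]]; split.
  by have := dim_lker_functional f0; case: (\dim _) => [|n] //; move=> <-.
exact: (kernel_subalgebra D f1 fJ fst).
Qed.

Lemma pts_lker A : pts AG A -> lker (hf A) = A.
Proof. by move=> [dA _]; apply: lker_hyperplane_functional dim_algebra_gt0 dA. Qed.

Lemma pts_alg_functional A : pts AG A -> alg_functional (hf A).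
Proof.
move=> pA; have [dA sA] := pA; have kA := pts_lker pA.
have f0 : hf A != 0.
  apply: contraTneq dim_algebra_gt0 => z; move: kA; rewrite z => e.
  have Af : A = fullv.
    by rewrite -e; apply/vspaceP => x; rewrite memv_ker lfunE eqxx memvf.
  by move: dA; rewrite Af; case: (\dim _) => // n /eqP; rewrite eqn_leq ltnn.
have sub : subalgebra (lker (hf A)) by rewrite kA.
split=> //; first exact: kernel_1 sub.
  exact: (kernel_kills_J2 D f0 sub).
exact: (kernel_supported D f0 sub).
Qed.

Lemma hf_lker f : f != 0 -> exists2 c : k, c != 0 & forall b, hf (lker f) b = c * f b :> k.
Proof.
move=> f0; apply: (hyperplane_functional_unique dim_algebra_gt0 _ f0 (subvv _)).
by have := dim_lker_functional f0; case: (\dim _) => [|n] //; move=> <-.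
Qed.

Definition functional_coords f : 'I_(n0 + n1) -> k :=
  split_fun (fun j => f (E (v (lift ord0 j)))) (fun i => f (X (a i))).

Definition alg_coords A := functional_coords (hf A).

Lemma functional_coords_scale f g c : (forall b, g b = c * f b :> k) ->
  forall i, functional_coords g i = c * functional_coords f i.
Proof.
move=> h i; rewrite /functional_coords.
by case: (split_ordP i) => j ->; rewrite ?split_funl ?split_funr.
Qed.

Lemma sum_over_vertices (F : vertex Q -> k) :
  \sum_u F u = F (v ord0) + \sum_j F (v (lift ord0 j)).
Proof.
rewrite (reindex v) /=; last exact: onW_bij.
by rewrite big_ord_recl.
Qed.

Lemma functional_xcoord f i : f 1 = 0 :> k -> xcoord (functional_coords f) i = f (E (v i)).
Proof.
move=> f1; have [j ->|->] := unliftP ord0 i.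
  by rewrite xcoord_lift /functional_coords split_funl.
rewrite xcoord0; move: f1; rewrite (functional1 D) sum_over_vertices => /eqP.
rewrite addr_eq0 => /eqP ->; congr (- _); apply: eq_bigr => j _.
by rewrite /functional_coords split_funl.
Qed.

Lemma functional_on_piece f s t : f 1 = 0 :> k ->
  on_piece v a s t (functional_coords f) <-> supported E X s t f.
Proof.
move=> f1; split=> -[h1 h2]; split.
- move=> u us ut; have [g _ gK] := v_bij.
  by rewrite -[u]gK -functional_xcoord // h1 ?gK.
- move=> b nb; have [g _ gK] := a_bij.
  have := h2 (g b); rewrite gK /functional_coords split_funr gK; exact.
- by move=> i is_ it; rewrite functional_xcoord // h1.
by move=> i na; rewrite /functional_coords split_funr h2.
Qed.

Lemma functional_coords_inj f g : f 1 = 0 :> k -> g 1 = 0 :> k -> kills_J2 f ->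
  kills_J2 g -> functional_coords f =1 functional_coords g -> f = g.
Proof.
move=> f1 g1 fJ gJ e; apply: (functional_ext D fJ gJ) => u.
  have [h _ hK] := v_bij; rewrite -[u]hK -!functional_xcoord //.
  by congr (xcoord _ _); apply/funext.
have [h _ hK] := a_bij; have := e (rshift n0 (h u)).
by rewrite /functional_coords !split_funr hK.
Qed.

Lemma functional_coords_neq0 f : f != 0 -> f 1 = 0 :> k -> kills_J2 f ->
  exists i, functional_coords f i != 0.
Proof.
move=> f0 f1 fJ; apply: contrapT => h; case/eqP: f0.
apply: functional_coords_inj => //.
- by rewrite lfunE.
- by move=> x _; rewrite lfunE.
move=> i; rewrite [RHS](_ : _ = 0).
  by apply/eqP/negPn/negP => nz; apply: h; exists i.
by rewrite /functional_coords /split_fun; case: split => j; rewrite lfunE.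
Qed.

Lemma functional_of_coords s t w : on_piece v a s t w -> (exists i, w i != 0) ->
  exists f, [/\ alg_functional f, supported E X s t f & functional_coords f =1 w].
Proof.
move=> pw [i wi]; have [g vK gK] := v_bij; have [h aK hK] := a_bij.
pose f := functional_of D (fun u => xcoord w (g u)) (fun b => w (rshift n0 (h b))).
have fc : functional_coords f =1 w.
  move=> x; rewrite /functional_coords; case: (split_ordP x) => j ->.
    by rewrite split_funl functional_of_vertex vK xcoord_lift.
  by rewrite split_funr functional_of_arrow aK.
have f1 : f 1 = 0 :> k.
  rewrite (functional1 D) sum_over_vertices -[RHS](xcoord_sum w) big_ord_recl.
  rewrite functional_of_vertex vK; congr (_ + _); apply: eq_bigr => j _.
  by rewrite functional_of_vertex vK.
have fst : supported E X s t f.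
  by apply/functional_on_piece => //; rewrite (_ : functional_coords f = w) //; apply/funext.
exists f; split=> //; split=> //; last by exists s, t.
  apply/eqP => f0; move: wi; rewrite -fc f0 /functional_coords /split_fun.
  by case: split => j; rewrite lfunE eqxx.
exact: functional_of_J2.
Qed.

Lemma alg_coords_neq0 A : pts AG A -> exists i, alg_coords A i != 0.
Proof. by move=> /pts_alg_functional[f0 f1 fJ _]; apply: functional_coords_neq0. Qed.

Lemma alg_coords_cover A : pts AG A -> exists s t, on_piece v a s t (alg_coords A).
Proof.
move=> /pts_alg_functional[f0 f1 fJ [s [t fst]]]; exists s, t.
exact/functional_on_piece.
Qed.

Lemma alg_coords_lker f : f != 0 ->
  exists2 c : k, c != 0 & forall i, alg_coords (lker f) i = c * functional_coords f i.
Proof.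
by move=> /hf_lker[c c0 h]; exists c => // i; apply: functional_coords_scale.
Qed.

Lemma alg_coords_onto s t w : on_piece v a s t w -> (exists i, w i != 0) ->
  exists2 A, pts AG A & exists2 c : k, c != 0 & forall i, alg_coords A i = c * w i.
Proof.
move=> pw w0; have [f [fa fst fw]] := functional_of_coords pw w0.
exists (lker f); first exact: alg_functional_pts.
have [c c0 h] := alg_coords_lker (let: And4 f0 _ _ _ := fa in f0).
by exists c => // i; rewrite h fw.
Qed.

Lemma alg_coords_inj A A' (c : k) : pts AG A -> pts AG A' -> c != 0 ->
  (forall i, alg_coords A i = c * alg_coords A' i) -> A = A'.
Proof.
move=> pA pA' c0 h; rewrite -(pts_lker pA) -(pts_lker pA').
have [f0 f1 fJ _] := pts_alg_functional pA; have [g0 g1 gJ _] := pts_alg_functional pA'.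
have -> : hf A = c *: hf A'.
  apply: functional_coords_inj => //.
  - by rewrite scale_lfunE g1 [LHS]mulr0.
  - by move=> x /gJ gx; rewrite scale_lfunE gx [LHS]mulr0.
  move=> i; rewrite [LHS]h; apply/esym/functional_coords_scale => b.
  by rewrite scale_lfunE.
by apply/vspaceP => x; rewrite !memv_ker scale_lfunE scaler_eq0 (negPf c0).
Qed.

(** The values of the functional on vertices and arrows are linear in its coefficients in the basis
    of B. Conversely a coefficient is a value of the functional, expanded over vertices and arrows
    because the square of the radical is killed. *)
Lemma alg_chart : @chart k AG _ alg_coords.
Proof.
have [pc1 pc2] := @plucker_chart k B [set A | \dim A = (\dim {: B}).-1 /\ subalgebra A]
  dim_algebra_gt0.
have hfE A b : hf A b = \sum_x normal (vcoords B) A x * vcoords B b 0 x :> k.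
  by rewrite lfunE /= /pairing; apply: eq_bigr => x _; rewrite mulrC.
split.
  apply: lin_on_trans pc1 _.
  exists (fun x i => split_fun (fun j => vcoords B (E (v (lift ord0 j))) 0 x)
    (fun i => vcoords B (X (a i)) 0 x) i) => A _.
  exists 1; rewrite ?oner_neq0 // => i; rewrite mul1r /alg_coords /functional_coords.
  case: (split_ordP i) => j ->; rewrite ?split_funl ?split_funr hfE.
    by apply: eq_bigr => x _; rewrite split_funl.
  by apply: eq_bigr => x _; rewrite split_funr.
apply: lin_on_trans _ pc2.
pose e x := vecof (vbasis {: B}) (delta_mx 0 x).
(* The difference of coefficients eliminates v_0, whose value is minus the sum of the other vertex
   values. *)
exists (fun i x => split_fun
  (fun j => (vcoef D (v (lift ord0 j)) (e x) : k) - vcoef D (v ord0) (e x))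
  (fun j => acoef D (a j) (e x) : k) i) => A pA.
exists 1; rewrite ?oner_neq0 // => x; rewrite mul1r.
have [f0 f1 fJ _] := pts_alg_functional pA.
have -> : normal (vcoords B) A x = hf A (e x).
  by rewrite lfunE /= (pairing_psi (@vecofvK k B)).
rewrite (functionalE D (e x) fJ) big_split_ord /=; congr (_ + _).
  rewrite sum_over_vertices -functional_xcoord // xcoord0 mulrN mulr_sumr -sumrN -big_split /=.
  apply: eq_bigr => j _; rewrite /alg_coords !split_funl /functional_coords split_funl.
  by rewrite mulrBr addrC [X in X + _]mulrC [X in _ - X]mulrC.
have [g aK gK] := a_bij; rewrite (reindex a) /=; last exact: onW_bij.
apply: eq_bigr => j _; rewrite /alg_coords !split_funr /functional_coords split_funr.
by rewrite mulrC.
Qed.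

End AlgebraChart.

(** * The embedding in projective space *)

Section Hyperplanes.
Variables (k : fieldType) (n : nat).
Hypothesis n_gt0 : (0 < n)%N.
Local Notation nrm := (normal (cV_coords k n)).
Implicit Types (w : 'I_n -> k) (H : {vspace 'cV[k]_n}).

Definition hyperplane_of w : {vspace 'cV[k]_n} :=
  lker (linfun (pairing (cV_coords k n) w)).

Lemma dim_cV : \dim {: 'cV[k]_n} = n.
Proof. by rewrite dimvf /dim /= muln1. Qed.

Lemma cV_coordsK : cancel (cV_coords k n) (@trmx k 1 n).
Proof. exact: trmxK. Qed.

Lemma trmx_cV_coords : cancel (@trmx k 1 n) (cV_coords k n).
Proof. exact: trmxK. Qed.

Lemma hyperplane_of_dim w : (exists i, w i != 0) -> \dim (hyperplane_of w) = n.-1.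
Proof.
move=> /(pairing_neq0 trmx_cV_coords)/dim_lker_functional h.
exact: (congr1 predn (etrans h dim_cV)).
Qed.

Lemma normal_hyperplane_of w : (exists i, w i != 0) ->
  exists2 c : k, c != 0 & forall i, nrm (hyperplane_of w) i = c * w i.
Proof.
move=> w0; have nz := pairing_neq0 trmx_cV_coords w0.
have [c c0 h] := normal_unique cV_coordsK trmx_cV_coords dim_cV n_gt0
  (hyperplane_of_dim w0) nz (subvv _).
exists c => // i; have := h (trmx (delta_mx 0 i)).
by rewrite lfunE /= !(pairing_psi trmx_cV_coords).
Qed.

Lemma hyperplane_of_normal H w (c : k) : \dim H = n.-1 -> c != 0 ->
  (forall i, w i = c * nrm H i) -> hyperplane_of w = H.
Proof.
move=> dH c0 wE.
rewrite -[RHS](lker_normal cV_coordsK trmx_cV_coords dim_cV n_gt0 dH).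
apply/vspaceP => x; rewrite !memv_ker !lfunE /= /pairing.
under eq_bigr => i _ do rewrite wE mulrCA.
by rewrite -mulr_sumr mulf_eq0 (negPf c0).
Qed.

Lemma normal_hyperplane_neq0 H : \dim H = n.-1 -> exists i, nrm H i != 0.
Proof. exact: (normal_neq0 cV_coordsK n_gt0). Qed.

End Hyperplanes.

Section Embedding.
Variables (k : closedFieldType) (Q : quiver) (B : falgType k).
Variables (E : vertex Q -> B) (X : arrow Q -> B) (D : truncation E X).
Variables (n0 n1 : nat) (v : 'I_n0.+1 -> vertex Q) (a : 'I_n1 -> arrow Q).
Hypotheses (v_bij : bijective v) (a_bij : bijective a).
Hypothesis arrow_gt0 : (0 < #|arrow Q|)%N.
Local Notation AG := (alg_gr B (\dim {: B}).-1).
Local Notation crd := (alg_coords E X v a).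
Local Notation nrm := (normal (cV_coords k (n0 + n1))).
Local Notation HP := (hyperplanes k (n0 + n1)).

Let v_inj : injective v := bij_inj v_bij.
Let v_surj s : exists i, v i = s.
Proof. by have [g _ gK] := v_bij; exists (g s). Qed.
Let a_surj b : exists i, a i = b.
Proof. by have [g _ gK] := a_bij; exists (g b). Qed.

Definition alg_piece (p : vertex Q * vertex Q) : set {vspace B} :=
  [set A | pts AG A /\ on_piece v a p.1 p.2 (crd A)].

Lemma alg_componentE Z : irreducible_component AG Z <->
  exists2 p, maximal_piece p & Z = alg_piece p.
Proof.
(* Indexing by maximal pairs is what makes the incomparability hypothesis hold. *)
pose C := {p : vertex Q * vertex Q | maximal_piece p}.
pose L (c : C) : set ('I_(n0 + n1) -> k) := on_piece v a (val c).1 (val c).2.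
rewrite (@irreducible_componentE k AG _ crd C L).
- split=> [[[p mp] ->]|[p mp ->]]; first by exists p.
  by exists (exist _ p mp).
- exact: (alg_chart D v_bij a_bij).
- by move=> c; apply: on_piece_linear.
- by move=> A; apply: (alg_coords_neq0 D v_bij a_bij).
- move=> A pA; have [s [t pst]] := alg_coords_cover D v_bij a_bij pA.
  have [p mp pp] := maximal_piece_exists v_inj pst (alg_coords_neq0 D v_bij a_bij pA).
  by exists (exist _ p mp).
- by move=> c w; apply: (alg_coords_onto D v_bij a_bij).
- by move=> [p mp]; apply: (maximal_piece_neq0 k v_inj v_surj a_surj mp).
move=> [p mp] [q mq] sub w.
by apply: (maximal_piece_incomparable v_inj v_surj a_surj mp mq) => u; apply: sub.
Qed.

Lemma coords_gt0 : (0 < n0 + n1)%N.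
Proof.
have [b _] := card_gt0P arrow_gt0; have [i _] := a_surj b.
by rewrite addn_gt0 (leq_trans _ (ltn_ord i)) ?orbT.
Qed.

(** The kernel of the functional of A restricted to the span of the arrows and of the vertices other
    than v_0. *)
Definition embedding (A : {vspace B}) : {vspace 'cV[k]_(n0 + n1)} :=
  hyperplane_of (crd A).

Lemma embedding_pts A : pts AG A -> pts HP (embedding A).
Proof. by move=> /(alg_coords_neq0 D v_bij a_bij)/hyperplane_of_dim. Qed.

Lemma embedding_normal A : pts AG A ->
  exists2 c : k, c != 0 & forall i, nrm (embedding A) i = c * crd A i.
Proof.
by move=> /(alg_coords_neq0 D v_bij a_bij); apply: (normal_hyperplane_of coords_gt0).
Qed.

Lemma on_piece_scale s t w w' (c : k) : c != 0 -> (forall i, w' i = c * w i) ->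
  on_piece v a s t w -> on_piece v a s t w'.
Proof.
have [F hF ->] := on_piece_linear k v a s t => c0 e h f Ff.
by rewrite (meval_eq _ e) (meval_homog _ _ (hF f Ff)) h ?mulr0.
Qed.

Lemma embedding_piece p : embedding @` alg_piece p =
  [set H | pts HP H /\ on_piece v a p.1 p.2 (nrm H)].
Proof.
apply/seteqP; split=> H.
  move=> [A [pA pp] <-]; split; first exact: embedding_pts.
  have [c c0 h] := embedding_normal pA; exact: on_piece_scale h pp.
move=> [dH pp]; have nH := normal_hyperplane_neq0 coords_gt0 dH.
have [A pA [c c0 h]] := alg_coords_onto D v_bij a_bij pp nH.
exists A; first by split=> //; apply: on_piece_scale h pp.
exact: (hyperplane_of_normal coords_gt0 dH c0 h).
Qed.

Lemma embedding_image : embedding @` pts AG =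
  [set H | pts HP H /\ exists s t, on_piece v a s t (nrm H)].
Proof.
apply/seteqP; split=> H.
  move=> [A pA <-]; split; first exact: embedding_pts.
  have [s [t pst]] := alg_coords_cover D v_bij a_bij pA; exists s, t.
  have [c c0 h] := embedding_normal pA; exact: on_piece_scale h pst.
move=> [dH [s [t pp]]]; have /seteqP[_ /(_ H) sub] := embedding_piece (s, t).
by have [|A [pA _] <-] := sub; [split | exists A].
Qed.

Lemma alternate_hcoord H : alternate (@hcoord k HP H) = nrm H.
Proof.
apply/funext => i; rewrite /alternate /= hyperplane_coordE mulrA -expr2.
by rewrite sqrr_sign mul1r.
Qed.

Lemma embedding_image_zeros : embedding @` pts AG = zeros HP (X_ideal k v a).
Proof.
rewrite embedding_image; apply/seteqP; split=> H [dH h]; split=> //.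
  move=> f Xf; have [s [t]] := h; rewrite -alternate_hcoord => pst.
  exact: (on_piece_zero v_inj pst Xf).
have [s [t pst]] := on_piece_of_zero v_inj v_surj h.
by exists s, t; rewrite -alternate_hcoord.
Qed.

Lemma embedding_image_closed : zclosed HP (embedding @` pts AG).
Proof.
exists [set f | X_ideal k v a f /\ homogeneous f]; first by move=> f [].
rewrite embedding_image_zeros; apply/seteqP; split=> H [dH h]; split=> //.
  by move=> f [Xf _]; apply: h.
pose K : set {mpoly k[n0 + n1]} := [set f | f.@[@hcoord k HP H] = 0].
suff sub : X_ideal k v a `<=` K by move=> f /sub.
apply: X_sub => [|f Xf hf]; last exact: h.
split=> [|x y|b x]; rewrite /K /= ?meval0 ?mevalD ?mevalM //.
  by move=> -> ->; rewrite addr0.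
by move=> ->; rewrite mulr0 mul0r.
Qed.

(** An inverse by choice; the default [fullv] is taken only off the image. *)
Definition unembedding (H : {vspace 'cV[k]_(n0 + n1)}) : {vspace B} :=
  xget fullv [set A | pts AG A /\ embedding A = H].

Lemma unembeddingP H : (embedding @` pts AG) H ->
  pts AG (unembedding H) /\ embedding (unembedding H) = H.
Proof.
move=> [A pA eA].
exact: (@xgetI _ fullv [set A' | pts AG A' /\ embedding A' = H] A).
Qed.

Lemma embedding_inj A A' : pts AG A -> pts AG A' -> embedding A = embedding A' -> A = A'.
Proof.
move=> pA pA' e; have [c c0 h] := embedding_normal pA.
have [c' c0' h'] := embedding_normal pA'.
have cc : c^-1 * c' != 0 by rewrite mulf_neq0 ?invr_eq0.
apply: (alg_coords_inj D v_bij a_bij pA pA' cc) => i.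
by rewrite -mulrA -h' -e h mulKf.
Qed.

Lemma embedding_isomorphism :
  isomorphism AG (restrict HP (embedding @` pts AG)) embedding.
Proof.
have cA := alg_chart D v_bij a_bij.
have cH := @hyperplane_chart k (n0 + n1) (embedding @` pts AG).
split.
  apply: (morphism_chart cA cH) => A pA; first by exists A.
  exact: embedding_normal.
exists unembedding; split.
- apply: (morphism_chart cH cA) => H /unembeddingP[pU eU] //.
  have [c c0 h] := embedding_normal pU; exists c^-1; first by rewrite invr_eq0.
  by move=> i; rewrite -[X in normal _ X]eU h mulKf.
- move=> A pA; have [|pU eU] := @unembeddingP (embedding A); first by exists A.
  exact: embedding_inj.
by move=> H /unembeddingP[].
Qed.

Lemma embedding_linear Z : irreducible_component AG Z ->
  linear_subspace HP (embedding @` Z).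
Proof.
move=> /alg_componentE[p mp ->]; rewrite embedding_piece.
have [F hF FE] := on_piece_linear k v a p.1 p.2.
exists [set g | g \is 1.-homog /\ exists2 f, F f & forall u, g.@[u] = f.@[alternate u]].
  by move=> g [].
apply/seteqP; split=> H [dH h]; split=> //.
  move=> g [_ [f Ff gE]]; rewrite gE alternate_hcoord.
  by move: h; rewrite FE; apply.
rewrite FE => f Ff; rewrite -alternate_hcoord.
have [g hg gE] := lin_on_eval (fun i j : 'I_(n0 + n1) => (-1) ^+ i *+ (i == j)) (hF f Ff).
have gE' u : g.@[u] = f.@[alternate u].
  rewrite gE; apply: meval_eq => j; rewrite (bigD1 j) //= eqxx mulr1n mulrC.
  by rewrite big1 ?addr0 // => i /negPf->; rewrite mulr0.
by rewrite -gE'; apply: h; split=> //; exists f.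
Qed.

Lemma embedding_image_neq0 : exists H, (embedding @` pts AG) H.
Proof.
have [b _] := card_gt0P arrow_gt0.
have mp : maximal_piece (src b, tgt b).
  by apply/orP; left; apply/existsP; exists b; rewrite /arrow_from_to !eqxx.
have [w pw w0] := maximal_piece_neq0 k v_inj v_surj a_surj mp.
by have [A pA _] := alg_coords_onto D v_bij a_bij pw w0; exists (embedding A); exists A.
Qed.

Lemma embedding_vanishing_ideal :
  vanishing_ideal HP (embedding @` pts AG) = X_ideal k v a.
Proof.
apply/seteqP; split.
  apply: ideal_gen_sub; first exact: X_two_sided.
  move=> f [[d hd] f0]; apply: (X_complete v_inj v_surj) => u [s [t pst]].
  have [w0|/existsPn w0] := boolP [exists i, alternate u i != 0]; last first.
    (* The zero vector is not a projective point. Writing it as 0 times the coordinates of a point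
       of the image handles every degree, constants included. *)
    have [H iH] := embedding_image_neq0.
    have -> : u = fun i => 0 * @hcoord k HP H i.
      apply/funext => i; rewrite mul0r; apply/eqP; have := w0 i.
      by rewrite negbK /alternate mulf_eq0 signr_eq0.
    by rewrite (meval_homog _ _ hd) f0 ?mulr0.
  have nz := existsP w0.
  pose H := hyperplane_of (alternate u).
  have [c c0 h] := normal_hyperplane_of coords_gt0 nz.
  have iH : (embedding @` pts AG) H.
    rewrite embedding_image; split; first exact: hyperplane_of_dim.
    by exists s, t; apply: on_piece_scale h pst.
  have uE i : u i = c^-1 * @hcoord k HP H i.
    rewrite /= hyperplane_coordE h /alternate mulrCA mulKf // mulrA -expr2.
    by rewrite sqrr_sign mul1r.
  by rewrite (meval_eq _ uE) (meval_homog _ _ hd) f0 ?mulr0.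
apply: X_sub; first exact: ideal_gen_two_sided.
move=> f Xf hf; apply: sub_ideal_gen; split=> // H.
by rewrite embedding_image_zeros => -[_ /(_ f Xf)].
Qed.

End Embedding.

(** * Passage to the quotient by the square of the radical *)

Section Transfer.
Variables (k : closedFieldType) (Q : quiver) (B C : falgType k).
Variables (EB : vertex Q -> B) (XB : arrow Q -> B) (DB : truncation EB XB).
Variables (EC : vertex Q -> C) (XC : arrow Q -> C) (DC : truncation EC XC).
Variable q : {lrmorphism B -> C}.
Hypothesis q_vertex : forall u, q (EB u) = EC u.
Hypothesis q_arrow : forall b, q (XB b) = XC b.
Hypothesis q_surj : forall c, exists b, q b = c.
Hypothesis q_ker : forall b, q b = 0 <-> b \in (jacobson B * jacobson B)%VS.
Variables (n0 n1 : nat) (v : 'I_n0.+1 -> vertex Q) (a : 'I_n1 -> arrow Q).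
Hypotheses (v_bij : bijective v) (a_bij : bijective a).
Local Notation AB := (alg_gr B (\dim {: B}).-1).
Local Notation AC := (alg_gr C (\dim {: C}).-1).
Local Notation fB := (alg_functional EB XB).
Local Notation fC := (alg_functional EC XC).

Lemma comp_quotientE (g : 'Hom(C, k^o)) b : (g \o linfun q)%VF b = g (q b).
Proof. by rewrite comp_lfunE lfunE. Qed.

Lemma pull_functional (g : 'Hom(C, k^o)) : fC g -> fB (g \o linfun q)%VF.
Proof.
move=> [g0 g1 gJ [s [t gst]]].
have E := comp_quotientE g.
split.
- apply: contraNneq g0 => z; apply/eqP/lfunP => c; have [b <-] := q_surj c.
  by rewrite -E z !lfunE.
- by rewrite E rmorph1.
- by move=> x /q_ker qx; rewrite E qx linear0.
exists s, t; split=> [u us ut|b nb]; rewrite E ?q_vertex ?q_arrow.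
  exact: gst.1.
exact: gst.2.
Qed.

(** The functional on C is built from the values of f on vertices and arrows; composed with q it
    gives back f, as both kill the square of the radical. *)
Lemma push_functional (f : 'Hom(B, k^o)) : fB f ->
  exists2 g, fC g & forall b, g (q b) = f b.
Proof.
move=> [f0 f1 fJ [s [t fst]]].
pose g := functional_of DC (fun u => f (EB u) : k) (fun b => f (XB b) : k).
have gq b : g (q b) = f b.
  rewrite -comp_quotientE.
  congr (fun_of_lfun _ b); apply: (functional_ext DB) => //.
  - by move=> x /q_ker qx; rewrite comp_quotientE qx linear0.
  - by move=> u; rewrite comp_quotientE q_vertex [LHS]functional_of_vertex.
  by move=> u; rewrite comp_quotientE q_arrow [LHS]functional_of_arrow.
exists g => //; split.
- apply: contraNneq f0 => z; apply/eqP/lfunP => b.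
  by rewrite -gq z !lfunE.
- by rewrite -(rmorph1 q) gq.
- exact: functional_of_J2.
exists s, t; split=> [u us ut|b nb]; rewrite -?q_vertex -?q_arrow gq.
  exact: fst.1.
exact: fst.2.
Qed.

Lemma limg_lker (f : 'Hom(B, k^o)) (g : 'Hom(C, k^o)) : (forall b, g (q b) = f b) ->
  (linfun q @: lker f)%VS = lker g.
Proof.
move=> gq; apply/eqP; rewrite eqEsubv; apply/andP; split; apply/subvP => c.
  by case/memv_imgP => b; rewrite !memv_ker => /eqP fb ->; rewrite lfunE /= gq fb.
rewrite memv_ker; have [b <-] := q_surj c; rewrite gq => fb; apply/memv_imgP.
by exists b; rewrite ?memv_ker // lfunE.
Qed.

Lemma lpreim_lker (g : 'Hom(C, k^o)) :
  (linfun q @^-1: lker g)%VS = lker (g \o linfun q).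
Proof. by apply/vspaceP => b; rewrite -memv_preim !memv_ker comp_lfunE. Qed.

Local Notation toC := (fun A => (linfun q @: A)%VS).
Local Notation crdB := (alg_coords EB XB v a).
Local Notation crdC := (alg_coords EC XC v a).

Lemma image_functional A : pts AB A -> exists2 g, fC g &
  toC A = lker g /\ functional_coords EC XC v a g =1 crdB A.
Proof.
move=> pA; have [g fg gq] := push_functional (pts_alg_functional DB pA).
exists g => //; split; first by rewrite -(limg_lker gq) (pts_lker pA).
move=> i; rewrite /alg_coords /functional_coords.
by case: (split_ordP i) => j ->; rewrite ?split_funl ?split_funr -?q_vertex -?q_arrow gq.
Qed.

Lemma image_pts A : pts AB A -> pts AC (toC A).
Proof. by move=> /image_functional[g fg [-> _]]; apply: (alg_functional_pts DC). Qed.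

Lemma image_coords A : pts AB A ->
  exists2 c : k, c != 0 & forall i, crdC (toC A) i = c * crdB A i.
Proof.
move=> /image_functional[g fg [-> gc]]; have [g0 _ _ _] := fg.
have [c c0 h] := alg_coords_lker EC XC v a g0.
by exists c => // i; rewrite h gc.
Qed.

Lemma preimage_functional A : pts AC A -> exists2 f, fB f &
  (linfun q @^-1: A)%VS = lker f /\ functional_coords EB XB v a f =1 crdC A.
Proof.
move=> pA; have fg := pts_alg_functional DC pA.
exists (hyperplane_functional A \o linfun q)%VF; first exact: pull_functional.
split; first by rewrite -lpreim_lker (pts_lker pA).
move=> i; rewrite /alg_coords /functional_coords.
by case: (split_ordP i) => j ->; rewrite ?split_funl ?split_funr comp_quotientE
  ?q_vertex ?q_arrow.
Qed.

Lemma preimage_pts A : pts AC A -> pts AB (linfun q @^-1: A)%VS.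
Proof. by move=> /preimage_functional[f ff [-> _]]; apply: (alg_functional_pts DB). Qed.

Lemma preimage_coords A : pts AC A ->
  exists2 c : k, c != 0 & forall i, crdB (linfun q @^-1: A)%VS i = c * crdC A i.
Proof.
move=> /preimage_functional[f ff [-> fc]]; have [f0 _ _ _] := ff.
have [c c0 h] := alg_coords_lker EB XB v a f0.
by exists c => // i; rewrite h fc.
Qed.

Lemma preimageK A : toC (linfun q @^-1: A)%VS = A.
Proof.
apply/vspaceP => c; apply/memv_imgP/idP => [[b]|cA].
  by rewrite -memv_preim => bA ->.
have [b qb] := q_surj c; exists b; last by rewrite lfunE.
by rewrite -memv_preim lfunE /= qb.
Qed.

Lemma imageK A : pts AB A -> (linfun q @^-1: toC A)%VS = A.
Proof.
move=> pA; have [_ _ fJ _] := pts_alg_functional DB pA.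
apply/vspaceP => b; rewrite -memv_preim; apply/idP/idP => [|bA]; last exact: memv_img.
case/memv_imgP => b' bA'; rewrite !lfunE /= => /eqP; rewrite -subr_eq0 -linearB.
move=> /eqP/q_ker/fJ d0; rewrite -[b](subrK b'); apply: memvD => //.
by rewrite -(pts_lker pA) mem_kernel; apply/eqP.
Qed.

Lemma image_isomorphism : isomorphism AB AC toC.
Proof.
have cB := alg_chart DB v_bij a_bij; have cC := alg_chart DC v_bij a_bij.
split; first exact: (morphism_chart cB cC image_pts image_coords).
exists (fun A => (linfun q @^-1: A)%VS); split.
- exact: (morphism_chart cC cB preimage_pts preimage_coords).
- exact: imageK.
by move=> A _; apply: preimageK.
Qed.

Lemma image_piece p : toC @` alg_piece EB XB v a p = alg_piece EC XC v a p.
Proof.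
apply/seteqP; split=> A'.
  move=> [A [pA pp] <-]; split; first exact: image_pts.
  have [c c0 h] := image_coords pA; exact: on_piece_scale h pp.
move=> [pA pp]; exists (linfun q @^-1: A')%VS; last exact: preimageK.
split; first exact: preimage_pts.
have [c c0 h] := preimage_coords pA; exact: on_piece_scale h pp.
Qed.

End Transfer.

(** * The linear pieces as sets of subalgebras of T_2Q *)

Section PiecesOfTruncation.
Variables (k : closedFieldType) (Q : quiver) (C : falgType k).
Variable rho : {lrmorphism path_algebra k Q -> C}.
Local Notation E := (vertex_elt rho).
Local Notation X := (arrow_elt rho).
Variable D : truncation E X.
Hypothesis J2_0 : forall x, x \in (jacobson C * jacobson C)%VS -> x = 0.
Variables (n0 n1 : nat) (v : 'I_n0.+1 -> vertex Q) (a : 'I_n1 -> arrow Q).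
Hypotheses (v_bij : bijective v) (a_bij : bijective a).
Local Notation AC := (alg_gr C (\dim {: C}).-1).
Local Notation piece := (alg_piece E X v a).

Lemma pieceP s t A : piece (s, t) A <->
  exists f : 'Hom(C, k^o), [/\ f != 0, f 1 = 0 :> k, supported E X s t f & A = lker f].
Proof.
split=> [[pA pp]|[f [f0 f1 fst ->]]].
  have [f0 f1 fJ _] := pts_alg_functional D pA.
  exists (hyperplane_functional A); split=> //; last by rewrite (pts_lker pA).
  exact/(functional_on_piece D v_bij a_bij s t f1).
have fa : alg_functional E X f.
  by split=> //; [apply: kills_J2_all | exists s, t].
split; first exact: (alg_functional_pts D fa).
have [c c0 h] := alg_coords_lker E X v a f0.
apply: on_piece_scale h _ => //.
exact/(functional_on_piece D v_bij a_bij s t f1).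
Qed.

Lemma orbit_union_sub_piece s t : orbit_union rho s t `<=` piece (s, t).
Proof.
move=> A /(orbit_unionP D J2_0)[f [f1 fst [b fb] ->]]; apply/pieceP; exists f; split=> //.
by apply: contraNneq fb => ->; rewrite lfunE.
Qed.

Lemma alg_glue_piece s t : s != t -> piece (s, t) (alg_glue rho s t).
Proof.
move=> st.
pose f := functional_of D (fun u => (u == s)%:R - (u == t)%:R) (fun=> 0).
have fE u : f (E u) = (u == s)%:R - (u == t)%:R :> k by apply: functional_of_vertex.
have fX b : f (X b) = 0 :> k by apply: functional_of_arrow.
have f1 : f 1 = 0 :> k.
  rewrite (functional1 D); under eq_bigr => u _ do rewrite fE.
  have one r : \sum_(u : vertex Q) (u == r)%:R = 1 :> k.
    by rewrite (bigD1 r) //= eqxx big1 ?addr0 // => u /negPf->.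
  by rewrite sumrB !one subrr.
have f0 : f != 0.
  apply/eqP => z; have := fE s; rewrite z lfunE eqxx (negPf st) subr0 => /esym/eqP.
  by rewrite oner_eq0.
have fst : supported E X s t f.
  by split=> [u /negPf us /negPf ut|b _]; [rewrite fE us ut subrr | apply: fX].
apply/pieceP; exists f; split=> //.
exact: (alg_glue_kernel D st f0 f1 (kills_J2_all J2_0 _) fst fX).
Qed.

(** A functional of the pair either kills all arrows, and its kernel is the glued algebra, or is
    nonzero on some arrow, and its kernel lies in one of the orbits. *)
Lemma piece_neq s t : s != t ->
  piece (s, t) = orbit_union rho s t `|` [set alg_glue rho s t].
Proof.
move=> st; apply/seteqP; split=> A; last first.
  by case=> [/orbit_union_sub_piece //|->]; apply: alg_glue_piece.
move=> /pieceP[f [f0 f1 fst ->]].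
have [fX|/existsNP[b /eqP fb]] := pselect (forall b, f (X b) = 0 :> k).
  right; apply/esym.
  exact: (alg_glue_kernel D st f0 f1 (kills_J2_all J2_0 _) fst fX).
by left; apply/(orbit_unionP D J2_0); exists f; split=> //; exists b.
Qed.

(** For s = t the vertex part of [supported_formula] is zero, so a nonzero functional cannot kill
    all arrows and no glued algebra occurs. *)
Lemma piece_loop s : piece (s, s) = orbit_union rho s s.
Proof.
apply/seteqP; split=> A; last exact: orbit_union_sub_piece.
move=> /pieceP[f [f0 f1 fst ->]].
apply/(orbit_unionP D J2_0); exists f; split=> //; apply: contrapT => h.
case/eqP: f0; apply/lfunP => x; rewrite lfunE.
rewrite [LHS](supported_formula D x f1 (kills_J2_all J2_0 _) fst) subrr mul0r add0r.
apply: big1 => b _; have [z|nz] := eqVneq (f (X b) : k) 0.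
  by rewrite [Y in _ * Y]z mulr0.
by case: h; exists b.
Qed.

Lemma piece_glue s t : s != t ->
  (forall b, ~~ (arrow_from_to s t b || arrow_from_to t s b)) ->
  piece (s, t) = [set alg_glue rho s t].
Proof.
move=> st na; rewrite piece_neq //; apply/setUidPr => A.
move=> /(orbit_unionP D J2_0)[f [_ fst [b fb] _]]; move: fb.
by have := na b; rewrite negb_or => /andP[/fst.2 -> _]; rewrite eqxx.
Qed.

Lemma maximal_pieces :
  [set Z | exists2 p, maximal_piece p & Z = piece p] =
  components_glue rho `|` components_arrow rho `|` components_loop rho.
Proof.
apply/seteqP; split=> Z.
  move=> [[s t] mp ->]; have [st|st] := eqVneq s t.
    right; exists s; split; last by rewrite -st piece_loop.
    case/orP: mp => [/existsP[b sb]|/andP[/=]]; last by rewrite st eqxx.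
    by exists b; move: sb; rewrite /= -st.
  left; have [/existsP[b sb]|na] := boolP [exists b, arrow_from_to s t b].
    by right; exists s, t; split=> //; [exists b | rewrite piece_neq].
  left; exists s, t; split=> //.
    move: mp; rewrite /maximal_piece (negPf na) /= => /andP[_].
    rewrite negb_exists => /forallP nb b; rewrite negb_or nb andbT.
    by move: na; rewrite negb_exists => /forallP.
  apply: piece_glue => // b; rewrite negb_or.
  move: mp; rewrite /maximal_piece (negPf na) /= => /andP[_].
  rewrite negb_exists => /forallP nb; rewrite nb andbT.
  by move: na; rewrite negb_exists => /forallP.
case=> [[[s [t [st na ->]]]|[s [t [st [b sb] ->]]]]|[s [[b sb] ->]]].
- exists (s, t); last by rewrite piece_glue.
  apply/orP; right; rewrite /= st /= negb_exists; apply/forallP => b.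
  by have := na b; rewrite negb_or => /andP[].
- exists (s, t); last by rewrite piece_neq.
  by apply/orP; left; apply/existsP; exists b.
exists (s, s); last by rewrite piece_loop.
by apply/orP; left; apply/existsP; exists b.
Qed.

End PiecesOfTruncation.

Theorem theorem1p1 (k : closedFieldType) (Q : quiver)
    (arrow_gt0 : (0 < #|arrow Q|)%N)
    (I : set (path_algebra k Q)) (admI : admissible I)
    (B : falgType k) (pi : {lrmorphism path_algebra k Q -> B})
    (piP : is_quotient I pi)
    (T2Q : falgType k) (rho : {lrmorphism path_algebra k Q -> T2Q})
    (rhoP : is_quotient (ideal_exp (arrow_ideal k Q) 2) rho) :
  let AlgGrB := alg_gr B (\dim {: B}).-1 in
  let AlgGrT := alg_gr T2Q (\dim {: T2Q}).-1 in
  (* (a) and (c): [q] identifies B / J(B)^2 with T_2 Q *)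
  (exists q : {lrmorphism B -> T2Q},
    let toT2Q (A : {vspace B}) := (linfun q @: A)%VS in
    [/\ forall x, q (pi x) = rho x,
        forall b, q b = 0 <-> b \in (jacobson B * jacobson B)%VS,
        isomorphism AlgGrB AlgGrT toT2Q
      & [set toT2Q @` Z | Z in irreducible_component AlgGrB] =
        components_glue rho `|` components_arrow rho `|` components_loop rho])
  /\
  (* (b) *)
  (forall (n0 n1 : nat) (v : 'I_n0.+1 -> vertex Q) (a : 'I_n1 -> arrow Q),
    ordered_quiver v a ->
    exists phi : {vspace B} -> {vspace 'cV[k]_(n0 + n1)},
      let image := phi @` pts AlgGrB in
      [/\ closed_embedding AlgGrB (hyperplanes k (n0 + n1)) phi,
          forall Z, irreducible_component AlgGrB Z ->
            linear_subspace (hyperplanes k (n0 + n1)) (phi @` Z),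
          vanishing_ideal (hyperplanes k (n0 + n1)) image =
            X_ideal k v a
        & image = zeros (hyperplanes k (n0 + n1)) (X_ideal k v a)]).
Proof.
move=> AlgGrB AlgGrT.
have [DB [DBv DBa]] := quotient_truncation admI piP.
have [DT [DTv DTa]] := quotient_truncation (@admissible_arrow_ideal2 k Q) rhoP.
split; last first.
  move=> n0 n1 v a [v_bij a_bij _]; exists (embedding (vertex_elt pi) (arrow_elt pi) v a).
  split.
  - split; first exact: (embedding_image_closed DB v_bij a_bij arrow_gt0).
    exact: (embedding_isomorphism DB v_bij a_bij arrow_gt0).
  - by move=> Z; apply: (embedding_linear DB v_bij a_bij arrow_gt0).
  - exact: (embedding_vanishing_ideal DB v_bij a_bij arrow_gt0).
  exact: (embedding_image_zeros DB v_bij a_bij arrow_gt0).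
have rhoI f : I f -> rho f = 0.
  by case: admI => _ sub _ /sub; apply: (proj2 (rhoP.2 f)).
have [q qpi] := descend_lrmorphism piP rhoI.
have q_ker b : q b = 0 <-> b \in (jacobson B * jacobson B)%VS.
  have [f <-] := piP.1 b; rewrite qpi (rhoP.2 f) arrow_ideal2E (memJ2 DB).
  by split=> -[h1 h2]; split=> u; [rewrite DBv | rewrite DBa | rewrite -DBv | rewrite -DBa].
have J2_0 x : x \in (jacobson T2Q * jacobson T2Q)%VS -> x = 0.
  have [f <-] := rhoP.1 x => /(memJ2 DT)[h1 h2]; apply/(rhoP.2 f)/arrow_ideal2E.
  by split=> u; [rewrite -DTv | rewrite -DTa].
have q_surj c : exists b, q b = c.
  by have [f <-] := rhoP.1 c; exists (pi f).
have [u0 _] := card_gt0P (vertex_gt0 Q).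
(* Parts (a) and (c) mention no order, but the charts behind them need enumerations; any will do. n0
   is one less than the number of vertices, as v_0 carries no coordinate. *)
pose n0 := #|vertex Q|.-1; have n0E : n0.+1 = #|vertex Q| by rewrite prednK ?vertex_gt0.
pose v (i : 'I_n0.+1) : vertex Q := enum_val (cast_ord n0E i).
pose a (i : 'I_#|arrow Q|) : arrow Q := enum_val i.
have v_bij : bijective v.
  exists (fun u => cast_ord (esym n0E) (enum_rank u)) => [i|u].
    by rewrite /v enum_valK cast_ordK.
  by rewrite /v cast_ordKV enum_rankK.
have a_bij : bijective a.
  by exists enum_rank => [i|u]; rewrite /a ?enum_valK ?enum_rankK.
have qE u : q (vertex_elt pi u) = vertex_elt rho u by apply: qpi.
have qX u : q (arrow_elt pi u) = arrow_elt rho u by apply: qpi.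
exists q; split=> //.
  exact: (image_isomorphism DB DT qE qX q_surj q_ker v_bij a_bij).
rewrite -(maximal_pieces DT J2_0 v_bij a_bij).
have img := image_piece DB DT qE qX q_surj q_ker v a.
apply/seteqP; split=> Z.
  move=> [Z' /(alg_componentE DB v_bij a_bij)[p mp ->] <-]; by exists p; last exact: img.
move=> [p mp ->]; exists (alg_piece (vertex_elt pi) (arrow_elt pi) v a p).
  by apply/(alg_componentE DB v_bij a_bij); exists p.
exact: img.
Qed.
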